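(* Assume that either $$1<r<q\le p<\infty,\qquad \alpha s=n,$$ or $$1<r<q\le p<\infty,\qquad \frac{n-\alpha s}{n}\le\frac{q}{p},\qquad \alpha s<n.$$ Then $$M^{p,r}\hookrightarrow M^{p,q}\qquad\text{and}\qquad L^{\infty}\hookrightarrow M^{p,q}.$$ In fact, there is a positive constant $C(n,\alpha,s,p,q)$ depending only on $n,\alpha,s,p,q$ such that for all $f\in\mathcal{M}(\mathbb{R}^n)$ $$C(n,\alpha,s,p,q)^{-1}\|f\|_{M^{p,q}}\le\sup_{{\rm diam}(K)\le1}\frac{\|f\chi_K\|_{L^{p,q}}}{\mathcal{C}(K)^{1/q}}\le C(n,\alpha,s,p,q)\|f\|_{M^{p,q}},$$ where the supremum is taken over all compact sets $K\subseteq\mathbb{R}^n$ with nonzero capacity and diameter at most $1$.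
   Context: Fix $n\in\mathbb{N}$, $0<\alpha<\infty$, $1<s\le n/\alpha$. Let $G_\alpha=\mathcal{F}^{-1}[(1+|\cdot|^2)^{-\alpha/2}]$ be the Bessel kernel on $\mathbb{R}^n$. For $E\subseteq\mathbb{R}^n$ the Bessel capacity is $\mathcal{C}(E)=\inf\{\|f\|_{L^s(\mathbb{R}^n)}^s: f\ge 0,\ G_\alpha\ast f\ge 1\text{ on }E\}$. $\mathcal{M}(\mathbb{R}^n)$ is the set of extended real-valued Lebesgue measurable functions on $\mathbb{R}^n$. For $0<p,q<\infty$, $\|f\|_{L^{p,q}}=p^{1/q}\left(\int_0^\infty |\{|f|>t\}|^{q/p}t^q\frac{dt}{t}\right)^{1/q}$. For $1<p,q<\infty$, $M^{p,q}$ is the set of $f\in\mathcal{M}(\mathbb{R}^n)$ with $\|f\|_{M^{p,q}}=\sup_K\|f\chi_K\|_{L^{p,q}}/\mathcal{C}(K)^{1/q}<\infty$, supremum over all compact $K\subseteq\mathbb{R}^n$ with $\mathcal{C}(K)\ne0$. $X\hookrightarrow Y$ means $\|\cdot\|_Y\le c\|\cdot\|_X$ for some constant $c>0$. *)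

(* Defs.v *)
From HB Require Import structures.
From mathcomp Require Import all_boot all_order all_algebra.
From mathcomp Require Import complex.
From mathcomp Require Import all_classical all_reals all_analysis.
From mathcomp Require Import measurable_realfun.

Set Implicit Arguments.
Unset Strict Implicit.
Unset Printing Implicit Defensive.

Import Order.TTheory GRing.Theory Num.Theory.
Import numFieldNormedType.Exports.

Local Open Scope classical_set_scope.
Local Open Scope ring_scope.

Definition rV_display : measure_display -> measure_display.
Proof. exact. Qed.

(* The product (= Borel) sigma-algebra on 'rV[R]_n. *)
Section measurable_rV.
Context (R : realType) (n : nat).

Let coord (i : 'I_n) (v : 'rV[R]_n) : measurableTypeR R := v ord0 i.

Let rV_set0 : g_sigma_preimage coord set0.
Proof. exact: sigma_algebra0. Qed.

Let rV_setC A : g_sigma_preimage coord A -> g_sigma_preimage coord (~` A).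
Proof. exact: sigma_algebraC. Qed.

Let rV_bigcup (F : (set 'rV[R]_n)^nat) :
  (forall i, g_sigma_preimage coord (F i)) ->
  g_sigma_preimage coord (\bigcup_i F i).
Proof. exact: sigma_algebra_bigcup. Qed.

HB.instance Definition _ := @isMeasurable.Build (rV_display default_measure_display)
  'rV[R]_n (g_sigma_preimage coord) rV_set0 rV_setC rV_bigcup.

Lemma measurable_coord (i : 'I_n) :
  measurable_fun [set: 'rV[R]_n] (fun v => v ord0 i : measurableTypeR R).
Proof.
move=> _ Y mY; rewrite setTI; apply: sub_sigma_algebra => /=.
rewrite -bigcup_seq/=; exists i => /=; first by rewrite mem_index_enum.
by exists Y => //; rewrite setTI.
Qed.

Lemma measurable_fun_rV d (T : measurableType d) (f : T -> 'rV[R]_n) :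
  (forall i, measurable_fun [set: T] (fun t => f t ord0 i : measurableTypeR R)) ->
  measurable_fun [set: T] f.
Proof.
move=> mf _ A mA; rewrite setTI.
suff : g_sigma_preimage coord `<=` [set B | measurable (f @^-1` B)] by exact.
apply: smallest_sub.
  split => /=.
  - by rewrite preimage_set0.
  - by move=> B mB; rewrite setTD preimage_setC; exact: measurableC.
  - move=> F mF; rewrite preimage_bigcup; exact: bigcupT_measurable.
move=> B; rewrite -bigcup_seq/= => -[i _ [Y mY <-]] /=.
by rewrite setTI -[X in measurable X]setTI; exact: mf.
Qed.

End measurable_rV.

Section lebesgue_cons.
Context (R : realType) (n : nat).

Definition rV_cons (xv : measurableTypeR R * 'rV[R]_n) : 'rV[R]_n.+1 :=
  \row_i (if unlift ord0 i is Some j then xv.2 ord0 j else xv.1).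

Lemma measurable_rV_cons : measurable_fun setT rV_cons.
Proof.
apply: measurable_fun_rV => i; rewrite /rV_cons.
under eq_fun do rewrite mxE.
case: unliftP => [j _|_]; last exact: measurable_fst.
by apply: (measurableT_comp (measurable_coord j)); exact: measurable_snd.
Qed.

Let uncons (v : 'rV[R]_n.+1) : measurableTypeR R * 'rV[R]_n :=
  (v ord0 ord0, \row_j v ord0 (lift ord0 j)).

Let measurable_uncons : measurable_fun setT uncons.
Proof.
apply/measurable_fun_pairP; split; first exact: measurable_coord.
apply: measurable_fun_rV => i; rewrite /comp /uncons/=.
under eq_fun do rewrite mxE.
exact: measurable_coord.
Qed.

Let rV_consK : cancel rV_cons uncons.
Proof.
move=> [x v]; rewrite /uncons /rV_cons mxE unlift_none; congr pair.
by apply/rowP => j; rewrite !mxE liftK.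
Qed.

Variable mu : {sigma_finite_measure set 'rV[R]_n -> \bar R}.

Definition lebesgue_cons : set 'rV[R]_n.+1 -> \bar R :=
  pushforward (lebesgue_measure \x mu)%E rV_cons.

HB.instance Definition _ := Measure.copy lebesgue_cons
  (measure_function_pushforward__canonical__measure_function_Measure
     (lebesgue_measure \x mu)%E measurable_rV_cons).

Let lebesgue_cons_sigma_finite : sigma_finite setT lebesgue_cons.
Proof.
have /sigma_finiteP[F [TF ndF Foo]] := sigma_finiteT (@lebesgue_measure R).
have /sigma_finiteP[G [TG ndG Goo]] := sigma_finiteT mu.
exists (fun k => uncons @^-1` (F k `*` G k)).
  apply/esym/seteqP; split=> // v _.
  have [k _ Fk] : (\bigcup_k F k) (uncons v).1 by rewrite -TF.
  have [l _ Gl] : (\bigcup_k G k) (uncons v).2 by rewrite -TG.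
  exists (maxn k l) => //; split.
  - by move: Fk; exact/subsetPset/ndF/leq_maxl.
  - by move: Gl; exact/subsetPset/ndG/leq_maxr.
move=> k; have [mF Fk] := Foo k; have [mG Gk] := Goo k; split.
  by rewrite -[X in measurable X]setTI; apply: measurable_uncons => //; exact: measurableX.
rewrite /lebesgue_cons /pushforward -comp_preimage.
rewrite (_ : uncons \o rV_cons = id); last first.
  by apply/funext => x /=; rewrite rV_consK.
by rewrite preimage_id product_measure1E// lte_mul_pinfty// ge0_fin_numE.
Qed.

HB.instance Definition _ := @Measure_isSigmaFinite.Build _ _ _
  lebesgue_cons lebesgue_cons_sigma_finite.

End lebesgue_cons.

Fixpoint borel_lebesgue (R : realType) (n : nat) :
    {sigma_finite_measure set 'rV[R]_n -> \bar R} :=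
  if n is m.+1 then lebesgue_cons (borel_lebesgue R m) else dirac (0 : 'rV[R]_0).

Lemma borel_lebesgue_rect (R : realType) (n : nat)
    (A : 'I_n -> set (measurableTypeR R)) :
  (forall i, measurable (A i)) ->
  borel_lebesgue R n [set v | forall i, A i (v ord0 i)] =
  (\prod_(i < n) lebesgue_measure (A i))%E.
Proof.
elim: n A => [A _|n IH A mA].
  rewrite big_ord0 /= diracE mem_set//; by case.
rewrite big_ord_recl -IH//= /lebesgue_cons /pushforward.
have mB : measurable [set v : 'rV[R]_n | forall i, A (lift ord0 i) (v ord0 i)].
  rewrite (_ : [set _ | _] = \bigcap_(i in [set: 'I_n])
      [set v : 'rV[R]_n | A (lift ord0 i) (v ord0 i)]); last first.
    by apply/seteqP; split => [v Av i _|v Av i]; [exact: Av|exact: Av].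
  apply: fin_bigcap_measurable => // i _.
  by rewrite -[X in measurable X]setTI; apply: measurable_coord => //; exact: mA.
rewrite -product_measure1E//.
congr product_measure1; apply/seteqP; split => [[x v] /= Av|[x v] /= [Ax Av] i].
  split; first by have := Av ord0; rewrite mxE unlift_none.
  by move=> i; have := Av (lift ord0 i); rewrite mxE liftK.
by rewrite mxE; case: unliftP => [j ->|->].
Qed.

(* [Rn R n] is 'rV[R]_n equipped with the sigma-algebra of Lebesgue measurable
   sets (the completion of the Borel sigma-algebra), which is the domain of
   n-dimensional Lebesgue measure. *)
Definition Rn (R : realType) (n : nat) : Type :=
  caratheodory_type ((borel_lebesgue R n)^*)%mu.

Definition lebesgue_rV (R : realType) (n : nat) : set (Rn R n) -> \bar R :=
  @completed_measure_extension _ _ _ (borel_lebesgue R n).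
HB.instance Definition _ (R : realType) (n : nat) :=
  Measurable.on (Rn R n).
HB.instance Definition _ (R : realType) (n : nat) :=
  Measure.on (@lebesgue_rV R n).

Lemma lebesgue_rV_sigma_finite (R : realType) (n : nat) :
  sigma_finite setT (@lebesgue_rV R n).
Proof. exact/completed_measure_extension_sigma_finite/sigma_finiteT. Qed.

HB.instance Definition _ (R : realType) (n : nat) :=
  @Measure_isSigmaFinite.Build _ _ _
    (@lebesgue_rV R n) (@lebesgue_rV_sigma_finite R n).

Section bessel_capacity.
Context {R : realType} {n : nat}.
Implicit Types (x y xi : 'rV[R]_n) (g : 'rV[R]_n -> R) (f : 'rV[R]_n -> \bar R).
Implicit Types (E K : set 'rV[R]_n) (alpha s p q : R).

Local Notation mu := (@lebesgue_rV R n).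

Definition dot x y : R := \sum_(i < n) x ord0 i * y ord0 i.

(* The norm that MathComp-Analysis puts on 'rV[R]_n is the sup norm. *)
Definition enorm x : R := Num.sqrt (dot x x).

Definition diam E : \bar R :=
  ereal_sup [set z | exists x y, [/\ E x, E y & z = (enorm (x - y))%:E]].

Definition lebesgue_measurable f : Prop := measurable_fun [set: Rn R n] (f : Rn R n -> \bar R).

(* F[g](xi) is the integral of g(x) exp(-i x.xi) dx. *)
Definition fourier g xi : R[i] :=
  Complex (\int[mu]_(x in [set: Rn R n]) (g x * cos (dot x xi)))
          (- \int[mu]_(x in [set: Rn R n]) (g x * sin (dot x xi))).

(* For a symbol m that is the Fourier transform of a real-valued integrable
   function, the inverse transform of m; it is determined up to a null set,
   and a representative is chosen. *)
Definition inverse_fourier (m : 'rV[R]_n -> R[i]) : 'rV[R]_n -> R :=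
  xget (fun=> 0) [set g : 'rV[R]_n -> R | mu.-integrable [set: Rn R n] (fun x => (g x)%:E) /\
                          forall xi, fourier g xi = m xi].

Definition bessel_kernel alpha : 'rV[R]_n -> R :=
  inverse_fourier (fun xi => real_complex R ((1 + enorm xi ^+ 2) `^ (- alpha / 2))).

Local Open Scope ereal_scope.

(* Since f is only integrated, the result does not depend on the chosen
   representative of g. *)
Definition convolution g f x : \bar R :=
  \int[mu]_(y in [set: Rn R n]) ((g (x - y)%R)%:E * f y).

Definition capacity alpha s E : \bar R :=
  ereal_inf [set 'N[mu]_s%:E[f] `^ s | f in
    [set f | [/\ lebesgue_measurable f, forall x, 0 <= f x &
                 forall x, E x -> 1 <= convolution (bessel_kernel alpha) f x]]].

Definition lorentz_norm p q f : \bar R :=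
  (p `^ q^-1)%:E *
  (\int[lebesgue_measure]_(t in `]0%R, +oo[)
     (mu [set x | t%:E < `|f x|] `^ (q / p) * (t `^ q / t)%:E)) `^ q^-1.

Definition restr f K x : \bar R := f x * (\1_K x)%:E.

Definition capacitary_ratio alpha s p q f K : \bar R :=
  lorentz_norm p q (restr f K) / capacity alpha s K `^ q^-1.

Definition M_norm alpha s p q f : \bar R :=
  ereal_sup [set capacitary_ratio alpha s p q f K | K in
    [set K | compact K /\ capacity alpha s K != 0]].

Definition M_norm_local alpha s p q f : \bar R :=
  ereal_sup [set capacitary_ratio alpha s p q f K | K in
    [set K | [/\ compact K, capacity alpha s K != 0 & diam K <= 1]]].

Definition Linfty_norm f : \bar R := 'N[mu]_+oo[f].

(* The space of a norm N consists of the Lebesgue measurable functions f with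
   N f < +oo. *)
Definition embeds (NX NY : ('rV[R]_n -> \bar R) -> \bar R) : Prop :=
  exists2 c : R, (0 < c)%R &
    forall f, lebesgue_measurable f -> NX f < +oo -> NY f <= c%:E * NX f.

End bessel_capacity.

(* Main.v *)
(** The Bessel kernel is a mixture of centred Gaussians; by uniqueness of the Fourier
    transform this mixture agrees almost everywhere with the chosen inverse transform.
    Splitting the mixture at a scale and applying Hoelder's inequality gives
    |K|^(1 - a' s / n) <= c C(K) for every 0 < a' <= alpha with a' s < n, whence
    |K|^(q/p) <= c C(K) when K has diameter at most 1; such K also have bounded capacity.

    The capacity is quasi-additive: let f be admissible for K.  Away from the origin the
    kernel is dominated by an exponential kernel E satisfying a Harnack inequality, so
    F = f + c (E * f), restricted to the double of a small cube Q, is admissible for the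
    intersection of K and Q.  Averaging over the translates of Q bounds the integral of
    C(K /\ Q_z) over the centre z by a multiple of C(K).  As q <= p, concavity gives
    |Q| |A|^(q/p) <= int |A /\ Q_z|^(q/p) dz for the level sets A of f on K; so a bound
    for the ratios over sets of diameter at most 1 integrates to a bound for all K.

    It remains to treat K of diameter at most 1, where the L^oo bound is
    |K|^(q/p) <= c C(K), and the embedding for r < q follows from that of L^{p,r} in
    L^{p,q} and the boundedness of C(K). *)
From HB Require Import structures.
Require Import Defs.
From mathcomp Require Import all_boot all_order all_algebra.
From mathcomp Require Import complex.
From mathcomp Require Import all_classical all_reals all_analysis.
From mathcomp Require Import measurable_realfun ess_sup_inf hoelder.
From mathcomp Require Import ring lra.

Set Implicit Arguments.
Unset Strict Implicit.
Unset Printing Implicit Defensive.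

Import Order.TTheory GRing.Theory Num.Theory.
Import numFieldNormedType.Exports.

Local Open Scope classical_set_scope.
Local Open Scope ring_scope.

Lemma eqW_le d (T : porderType d) (x y : T) : x = y -> (x <= y)%O.
Proof. by move=> ->. Qed.

(** * Lebesgue measure on R^n *)

Section Rn_basics.
Context (R : realType) (n : nat).
Local Notation mu := (@lebesgue_rV R n).
Local Notation L := (borel_lebesgue R n).

Lemma measurable_rV_Rn (A : set 'rV[R]_n) :
  measurable A -> measurable (A : set (Rn R n)).
Proof. by move=> mA; apply: sub_caratheodory; exact: sub_sigma_algebra. Qed.

Lemma measurable_Rn_id :
  measurable_fun [set: Rn R n] (fun x : Rn R n => x : 'rV[R]_n).
Proof. by move=> _ A mA; rewrite setTI; exact: measurable_rV_Rn. Qed.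

Lemma lebesgue_rVE (A : set 'rV[R]_n) : measurable A -> mu A = L A.
Proof. by move=> mA; exact: (measurable_mu_extE L mA). Qed.

Lemma measurable_fun_Rn d (T : measurableType d) (f : 'rV[R]_n -> T) :
  measurable_fun setT f -> measurable_fun [set: Rn R n] (f : Rn R n -> T).
Proof. by move=> mf; exact: (measurableT_comp mf measurable_Rn_id). Qed.

Lemma ge0_integral_Rn (F : 'rV[R]_n -> \bar R) :
  measurable_fun setT F -> (forall x, 0 <= F x)%E ->
  (\int[mu]_x F x = \int[L]_x F x)%E.
Proof.
move=> mF F0.
have := @ge0_integral_pushforward _ _ _ _ R _ measurable_Rn_id mu setT F
  measurableT mF (fun x _ => F0 x).
rewrite preimage_setT => <-.
apply: (@eq_measure_integral _ _ _ setT L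
  (measure_function_pushforward__canonical__measure_function_Measure mu
    measurable_Rn_id)) => A mA _.
exact: (lebesgue_rVE mA).
Qed.

Lemma lebesgue_rV_complete (A N : set (Rn R n)) :
  measurable N -> mu N = 0%E -> A `<=` N -> measurable A.
Proof.
move=> mN N0 AN.
have H := @measure_is_complete_caratheodory R 'rV[R]_n
  (measure_extension_mu_ext__canonical__measure_extension_OuterMeasure L).
by apply: H; exists N; split.
Qed.

End Rn_basics.

Lemma ge0_integral_rV_cons (R : realType) (n : nat) (F : 'rV[R]_n.+1 -> \bar R) :
  measurable_fun setT F -> (forall x, 0 <= F x)%E ->
  (\int[borel_lebesgue R n.+1]_x F x =
   \int[lebesgue_measure]_x \int[borel_lebesgue R n]_v F (rV_cons (x, v)))%E.
Proof.
move=> mF F0.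
have mc := @measurable_rV_cons R n.
have mFc := measurableT_comp mF mc.
rewrite (_ : \int[_]_x F x = \int[(lebesgue_measure \x borel_lebesgue R n)%E]_z F (rV_cons z))%E.
  exact: (fubini_tonelli1 (F \o @rV_cons R n) mFc (fun z => F0 _)).
exact: (@ge0_integral_pushforward _ _ _ _ R _ mc (lebesgue_measure \x borel_lebesgue R n)%E setT F
  measurableT mF (fun x _ => F0 x)).
Qed.

Lemma rV_consK0 (R : realType) n (x : R) (v : 'rV[R]_n) : rV_cons (x, v) ord0 ord0 = x.
Proof. by rewrite mxE unlift_none. Qed.

Lemma rV_consK1 (R : realType) n (x : R) (v : 'rV[R]_n) i : rV_cons (x, v) ord0 (lift ord0 i) = v ord0 i.
Proof. by rewrite mxE liftK. Qed.

Lemma ge0_integral_rV_prod (R : realType) (n : nat) (h : 'I_n -> R -> R) :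
  (forall i, measurable_fun [set: R] (h i)) -> (forall i x, 0 <= h i x) ->
  (\int[borel_lebesgue R n]_v (\prod_(i < n) h i (v ord0 i))%:E =
   \prod_(i < n) \int[lebesgue_measure]_x (h i x)%:E)%E.
Proof.
elim: n h => [|n IH] h mh h0.
  rewrite big_ord0; under eq_integral do rewrite big_ord0.
  by rewrite integral_cst//= diracE mem_set// mule1.
have mp (m : nat) (g : 'I_m -> R -> R) : (forall i, measurable_fun [set: R] (g i)) ->
    measurable_fun setT (fun v : 'rV[R]_m => (\prod_(i < m) g i (v ord0 i))%R).
  move=> mg; apply: measurable_prod => i _.
  by apply: (measurableT_comp (mg i)); exact: measurable_coord.
rewrite ge0_integral_rV_cons; first last.
- by move=> v; rewrite lee_fin prodr_ge0.
- by apply/measurable_EFinP; apply: (mp _ (fun i => h _)) => i; exact: mh.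
rewrite big_ord_recl -IH//.
rewrite -ge0_integralZr//; last 3 first.
- by apply/measurable_EFinP; exact: mh.
- by move=> x _; rewrite lee_fin.
- by apply: integral_ge0 => v _; rewrite lee_fin prodr_ge0.
apply: eq_integral => x _.
rewrite -ge0_integralZl//; last 3 first.
- by apply/measurable_EFinP; apply: (mp _ (fun i => h _)) => i; exact: mh.
- by move=> v _; rewrite lee_fin prodr_ge0.
- by rewrite lee_fin.
apply: eq_integral => v _.
rewrite big_ord_recl rV_consK0 EFinM; congr (_ * _%:E)%E.
by apply: eq_bigr => i _; rewrite rV_consK1.
Qed.

Lemma measurable_rV_affine (R : realType) (n : nat) d (T : measurableType d)
    (f g : T -> 'rV[R]_n) :
  measurable_fun setT f -> measurable_fun setT g ->
  measurable_fun setT (fun t => f t - g t).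
Proof.
move=> mf mg; apply: measurable_fun_rV => i.
under eq_fun do rewrite !mxE.
by apply: measurable_funB; apply: (measurableT_comp (measurable_coord i)).
Qed.

Lemma lebesgue_measure_reflect (R : realType) (a : R) (A : set R) : measurable A ->
  lebesgue_measure ((fun x => a - x) @^-1` A) = lebesgue_measure A :> \bar R.
Proof.
move=> mA.
have mr : measurable_fun [set: measurableTypeR R] (fun x : measurableTypeR R => a - x : measurableTypeR R).
  exact: measurable_funB.
apply/esym.
apply: (@lebesgue_measure_unique R (measure_function_pushforward__canonical__measure_function_Measure lebesgue_measure mr)) => // _ [[b c]] _ <-.
rewrite /= /pushforward/=.
rewrite (_ : _ @^-1` _ = `[a - c, a - b[%classic); last first.
  apply/seteqP; split => x /=; rewrite !in_itv/=; lra.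
by rewrite !lebesgue_measure_itv/= !lte_fin -!EFinB ltrD2l ltrN2; case: ifP => // _; congr EFin; ring.
Qed.

Lemma ge0_integral_reflect1 (R : realType) (a : R) (F : R -> \bar R) :
  measurable_fun setT F -> (forall x, 0 <= F x)%E ->
  (\int[lebesgue_measure]_x F (a - x)%R = \int[lebesgue_measure]_x F x)%E.
Proof.
move=> mF F0.
have mr : measurable_fun [set: measurableTypeR R] (fun x : measurableTypeR R => a - x : measurableTypeR R).
  exact: measurable_funB.
have := @ge0_integral_pushforward _ _ _ _ R _ mr lebesgue_measure setT F
  measurableT mF (fun x _ => F0 x).
rewrite preimage_setT => <-.
apply: (@eq_measure_integral _ _ _ setT lebesgue_measure
  (measure_function_pushforward__canonical__measure_function_Measure lebesgue_measure
    mr)) => A mA _.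
exact: lebesgue_measure_reflect.
Qed.

Lemma ge0_integral_rV_reflect (R : realType) (n : nat) (a : 'rV[R]_n) (F : 'rV[R]_n -> \bar R) :
  measurable_fun setT F -> (forall x, 0 <= F x)%E ->
  (\int[borel_lebesgue R n]_v F (a - v)%R = \int[borel_lebesgue R n]_v F v)%E.
Proof.
elim: n a F => [|n IH] a F mF F0.
  by apply: eq_integral => v _; congr F; apply/rowP; case.
have mFr : measurable_fun setT (fun v : 'rV[R]_n.+1 => F (a - v)).
  by apply: (measurableT_comp mF); apply: measurable_rV_affine => //; exact: measurable_cst.
rewrite (ge0_integral_rV_cons mFr (fun v => F0 _)) (ge0_integral_rV_cons mF F0).
pose a' : 'rV[R]_n := \row_i a ord0 (lift ord0 i).
have mFc := measurableT_comp mF (@measurable_rV_cons R n).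
transitivity (\int[lebesgue_measure]_x \int[borel_lebesgue R n]_v F (rV_cons (a ord0 ord0 - x, v)%R))%E.
  apply: eq_integral => x _.
  rewrite -(IH a' _ (measurableT_comp mFc (pair1_measurable _)) (fun v => F0 _)).
  apply: eq_integral => v _; congr F; apply/rowP => i; rewrite !mxE.
  by case: unliftP => [j ->|->]; rewrite ?mxE ?liftK ?unlift_none// !mxE.
apply: (ge0_integral_reflect1 _ (F := fun x => \int[borel_lebesgue R n]_v F (rV_cons (x, v)))%E).
- exact: (measurable_fun_fubini_tonelli_F (F \o @rV_cons R n) mFc (fun z => F0 _)).
- by move=> x; exact: integral_ge0.
Qed.

Definition cube (R : realType) (n : nat) (z : 'rV[R]_n) (r : R) : set 'rV[R]_n :=
  [set y | forall i, `|y ord0 i - z ord0 i| <= r].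
Lemma rV_rect_measurable (R : realType) (n : nat) (A : 'I_n -> set (measurableTypeR R)) :
  (forall i, measurable (A i)) -> measurable [set v : 'rV[R]_n | forall i, A i (v ord0 i)].
Proof.
move=> mA; rewrite (_ : [set _ | _] = \bigcap_(i in [set: 'I_n])
      [set v : 'rV[R]_n | A i (v ord0 i)]); last first.
  by apply/seteqP; split => [v Av i _|v Av i]; [exact: Av|exact: Av].
apply: fin_bigcap_measurable => // i _.
by rewrite -[X in measurable X]setTI; apply: measurable_coord => //; exact: mA.
Qed.

Lemma cube_rect (R : realType) (n : nat) (z : 'rV[R]_n) (r : R) :
  cube z r = [set v : 'rV[R]_n | forall i, `[z ord0 i - r, z ord0 i + r]%classic (v ord0 i)].
Proof.
by apply/seteqP; split => v /= vz i; have := vz i; rewrite ler_distl in_itv/=.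
Qed.

Lemma measurable_cube (R : realType) (n : nat) (z : 'rV[R]_n) (r : R) : measurable (cube z r).
Proof.
by rewrite cube_rect; apply: (rV_rect_measurable (A := fun i => `[z ord0 i - r, z ord0 i + r]%classic)).
Qed.

Lemma compact_cube (R : realType) (n : nat) (z : 'rV[R]_n) (r : R) : compact (cube z r).
Proof.
rewrite cube_rect; apply: (@rV_compact _ _ (fun i => `[z ord0 i - r, z ord0 i + r]%classic)) => i.
exact: segment_compact.
Qed.

Lemma lebesgue_cube (R : realType) (n : nat) (z : 'rV[R]_n) (r : R) : 0 <= r ->
  (@lebesgue_rV R n (cube z r) = ((2 * r) ^+ n)%:E)%E.
Proof.
move=> r0; rewrite (lebesgue_rVE (measurable_cube z r)) cube_rect.
rewrite (borel_lebesgue_rect (A := fun i => `[z ord0 i - r, z ord0 i + r]%classic))//.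
under eq_bigr => i _.
  rewrite lebesgue_measure_itv/= lte_fin.
  rewrite (_ : (if _ then _ else _) = (2 * r)%:E); first over.
  case: ifPn => [_|]; first by rewrite -EFinB; congr EFin; ring.
  by rewrite -leNgt => h; congr EFin; lra.
by rewrite prodEFin prodr_const card_ord.
Qed.

Lemma rV_open_measurable (R : realType) (n : nat) (U : set 'rV[R]_n) : open U -> measurable U.
Proof.
move=> oU.
pose box (ck : 'rV[rat]_n * nat) : set 'rV[R]_n :=
  cube (map_mx ratr ck.1) ck.2.+1%:R^-1.
rewrite (_ : U = \bigcup_(ck in [set ck | box ck `<=` U]) box ck); last first.
  apply/seteqP; split => [x Ux|x [ck /= ckU]]; last exact: ckU.
  have /nbhs_ballP[e /= e0 xeU] : nbhs x U by apply: open_nbhs_nbhs.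
  have [k /= ke] : exists k : nat, k.+1%:R^-1 < e / 2 :> R.
    have [N _ /(_ N (leqnn _))] := near_infty_natSinv_lt (PosNum (divr_gt0 e0 (ltr0n R 2))).
    by exists N.
  have k0 : 0 < k.+1%:R^-1 :> R by rewrite invr_gt0.
  move: ke k0 @box; set d : R := k.+1%:R^-1 => ke k0 box.
  have q_ i : exists q : rat, ratr q \in `]x ord0 i - d, x ord0 i + d[.
    by apply: rat_in_itvoo; lra.
  have [c cP] := choice q_.
  exists (\row_i c i, k); last first.
    by rewrite /box/= -/d => i /=; rewrite !mxE; have := cP i; rewrite in_itv/= ler_distl => /andP[? ?]; apply/andP; split; lra.
  rewrite /box/= -/d; move=> y /= yc; apply: xeU; split=> // i j; rewrite ord1 /ball/=.
  have := cP j; have := yc j; rewrite !mxE in_itv/= !ler_distl ltr_distl => /andP[? ?] /andP[? ?].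
  by apply/andP; split; lra.
rewrite bigcup_mkcond; apply: countable_bigcupT_measurable => // ck.
by case: ifP => // _; exact: measurable_cube.
Qed.

Lemma compact_rV_measurable (R : realType) (n : nat) (K : set 'rV[R]_n) : compact K -> measurable K.
Proof.
move=> cK; rewrite -(setCK K); apply: measurableC; apply: rV_open_measurable.
by rewrite openC; apply: compact_closed => //; exact: norm_hausdorff.
Qed.

Lemma ge0_integral_Rn_reflect (R : realType) (n : nat) (a : 'rV[R]_n) (F : 'rV[R]_n -> \bar R) :
  measurable_fun setT F -> (forall x, 0 <= F x)%E ->
  (\int[@lebesgue_rV R n]_v F (a - v)%R = \int[@lebesgue_rV R n]_v F v)%E.
Proof.
move=> mF F0; rewrite !ge0_integral_Rn//; first exact: ge0_integral_rV_reflect.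
by apply: (measurableT_comp mF); apply: measurable_rV_affine => //; exact: measurable_cst.
Qed.

Lemma lebesgue_rV_envelope (R : realType) (n : nat) (E : set (Rn R n)) :
  measurable E -> (@lebesgue_rV R n E < +oo)%E ->
  exists B : set 'rV[R]_n, [/\ measurable B, @lebesgue_rV R n B = @lebesgue_rV R n E & E `<=` B].
Proof.
move=> mE Eoo.
have Efin : @lebesgue_rV R n E \is a fin_num by rewrite ge0_fin_numE.
have cov (k : nat) : exists A : (set 'rV[R]_n)^nat, @measurable_cover _ 'rV[R]_n E A /\
    (\sum_(0 <= i <oo) borel_lebesgue R n (A i) < @lebesgue_rV R n E + k.+1%:R^-1%:E)%E.
  have : (ereal_inf [set \sum_(0 <= i <oo) borel_lebesgue R n (A i) |
      A in @measurable_cover _ 'rV[R]_n E] < @lebesgue_rV R n E + k.+1%:R^-1%:E)%E.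
    change (@lebesgue_rV R n E < @lebesgue_rV R n E + k.+1%:R^-1%:E)%E.
    by rewrite lteDl// lte_fin.
  by move=> /ereal_inf_lt[_ [A cA <-] ?]; exists A.
have [A AP] := choice cov.
have mA k i : measurable (A k i) by exact: cover_measurable (AP k).1 i.
have mU k : measurable (\bigcup_i A k i) by exact: bigcupT_measurable.
have mB : measurable (\bigcap_k \bigcup_i A k i) by exact: bigcapT_measurable.
have EB : E `<=` \bigcap_k \bigcup_i A k i.
  by apply: sub_bigcap => k _; exact: cover_subset (AP k).1.
exists (\bigcap_k \bigcup_i A k i); split => //.
apply/eqP; rewrite eq_le; apply/andP; split; last first.
  by apply: le_measure; rewrite ?inE//; exact: measurable_rV_Rn.
rewrite [leLHS](lebesgue_rVE mB).
apply/lee_addgt0Pr => e e0.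
have [k /= ke] : exists k : nat, k.+1%:R^-1 < e.
  have [M _ /(_ M (leqnn _))] := near_infty_natSinv_lt (PosNum e0).
  by exists M.
apply: (@le_trans _ _ (@lebesgue_rV R n E + k.+1%:R^-1%:E)%E); last by rewrite leeD2l// lee_fin ltW.
apply: le_trans (ltW (AP k).2).
apply: (@le_trans _ _ (borel_lebesgue R n (\bigcup_i A k i))).
  by apply: le_measure; rewrite ?inE//; exact: bigcap_inf.
exact: (measure_sigma_subadditive (borel_lebesgue R n) (mA k) (mU k) (fun _ h => h)).
Qed.

Lemma lebesgue_rV_null_envelope (R : realType) (n : nat) (N : set (Rn R n)) :
  measurable N -> (@lebesgue_rV R n N = 0)%E ->
  exists B : set 'rV[R]_n, [/\ measurable B, (@lebesgue_rV R n B = 0)%E & N `<=` B].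
Proof.
move=> mN N0; have [|B [mB BE NB]] := lebesgue_rV_envelope mN; first by rewrite N0.
by exists B; split => //; rewrite BE.
Qed.

Lemma lebesgue_rV_borel_cover (R : realType) (n : nat) (E : set (Rn R n)) : measurable E ->
  exists B : set 'rV[R]_n, [/\ measurable B, (@lebesgue_rV R n (B `\` E) = 0)%E & E `<=` B].
Proof.
move=> mE.
have /= [S ST Sfin] := @lebesgue_rV_sigma_finite R n.
have mES k : measurable (E `&` S k) by apply: measurableI => //; exact: (Sfin k).1.
have h k : exists B : set 'rV[R]_n, [/\ measurable B, @lebesgue_rV R n B = @lebesgue_rV R n (E `&` S k) & E `&` S k `<=` B].
  apply: lebesgue_rV_envelope => //; apply: le_lt_trans (Sfin k).2.
  by apply: le_measure; rewrite ?inE//; exact: (Sfin k).1.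
have [B BP] := choice h.
have mB k : measurable (B k : set (Rn R n)) by case: (BP k) => ? _ _; exact: measurable_rV_Rn.
have mU : measurable (\bigcup_k B k).
  by apply: bigcupT_measurable => k; case: (BP k).
exists (\bigcup_k B k); split => //; last first.
  move=> x Ex; have [k _ Sx] : (\bigcup_k S k) x by rewrite -ST.
  by exists k => //; case: (BP k) => _ _; apply.
have mD k : measurable (B k `\` (E `&` S k) : set (Rn R n)) by exact: measurableD.
have mDU : measurable (\bigcup_k (B k `\` (E `&` S k)) : set (Rn R n)) by exact: bigcupT_measurable.
apply: (@subset_measure0 _ _ _ (@lebesgue_rV R n) _ (\bigcup_k (B k `\` (E `&` S k)))) => //.
- by apply: measurableD => //; exact: measurable_rV_Rn.
- by move=> x [[k _ Bx] nE]; exists k => //; split => // -[].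
apply/eqP; rewrite eq_le measure_ge0 andbT.
apply: le_trans (measure_sigma_subadditive (@lebesgue_rV R n) mD mDU (fun _ h => h)) _.
rewrite eseries0// => k _ _.
case: (BP k) => _ Bk sub.
have Bkoo : (@lebesgue_rV R n (B k) < +oo)%E.
  rewrite Bk; apply: le_lt_trans (Sfin k).2.
  by apply: le_measure; rewrite ?inE//; exact: (Sfin k).1.
rewrite measureD// setIidr// [X in (X - _)%E]Bk subee// ge0_fin_numE//.
by rewrite -Bk.
Qed.

Lemma ae_lebesgue_reflect (R : realType) (n : nat) (a : 'rV[R]_n) (P : set 'rV[R]_n) :
  {ae @lebesgue_rV R n, forall x, P x} -> {ae @lebesgue_rV R n, forall y, P (a - y)}.
Proof.
move=> [N [mN N0 PN]].
have [B [mB B0 NB]] := lebesgue_rV_null_envelope mN N0.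
have mBr : measurable ((fun y : 'rV[R]_n => a - y) @^-1` B).
  rewrite -[X in measurable X]setTI.
  by apply: measurable_rV_affine => //; exact: measurable_cst.
exists ((fun y : 'rV[R]_n => a - y) @^-1` B); split.
- exact: measurable_rV_Rn.
- have mBi : measurable_fun setT (fun x : 'rV[R]_n => (\1_B x)%:E : \bar R).
    by apply/measurable_EFinP; exact: measurable_indic.
  have B0i (x : 'rV[R]_n) : (0 <= (\1_B x)%:E :> \bar R)%E by rewrite lee_fin.
  have := ge0_integral_Rn_reflect a mBi B0i.
  rewrite integral_indic//; last exact: measurable_rV_Rn mBr.
  rewrite integral_indic//; last exact: measurable_rV_Rn.
  rewrite !setIT => h; transitivity (@lebesgue_rV R n B); [exact: h|exact: B0].
- by move=> y /= nP; apply: NB; exact: PN.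
Qed.

Lemma ae_measurable_fun_Rn (R : realType) (n : nat) d (T : measurableType d) (f g : Rn R n -> T) :
  measurable_fun setT f -> {ae @lebesgue_rV R n, forall x, f x = g x} -> measurable_fun setT g.
Proof.
move=> mf [N [mN N0 fgN]] _ Y mY; rewrite setTI.
have mfY : measurable (f @^-1` Y) by rewrite -[X in measurable X]setTI; exact: mf.
rewrite (_ : g @^-1` Y = ((f @^-1` Y) `\` N) `|` (g @^-1` Y `&` N)); last first.
  apply/seteqP; split => [x /= gY|x /= [[fY nN]|[]//]].
    have [Nx|nNx] := pselect (N x); [by right|left; split => //].
    suff -> : f x = g x by [].
    by apply: contrapT => h; apply: nNx; exact: fgN.
  suff <- : f x = g x by [].
  by apply: contrapT => h; apply: nN; exact: fgN.
apply: measurableU; first exact: measurableD.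
by apply: (lebesgue_rV_complete mN N0); exact: subIsetr.
Qed.

(** * Fourier transform of Gaussians *)

Lemma derivable_oo_LR (R : realType) (F f : R -> R) (a b : R) :
  (forall x : R, is_derive x 1 F (f x)) -> a < b -> derivable_oo_LRcontinuous F a b.
Proof.
move=> dF ab.
have cF x : {for x, continuous F}.
  by apply: differentiable_continuous; apply/derivable1_diffP; case: (dF x).
split=> [x _||]; first by case: (dF x).
- exact: cvg_at_right_filter (cF a).
- exact: cvg_at_left_filter (cF b).
Qed.

Lemma integral_derive_eq0 (R : realType) (F f : R -> R) :
  (forall x : R, is_derive x 1 F (f x)) -> continuous f ->
  lebesgue_measure.-integrable setT (EFin \o f) ->
  F n%:R @[n --> \oo] --> (0 : R) -> F (- n%:R) @[n --> \oo] --> (0 : R) ->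
  (\int[lebesgue_measure]_x (f x)%:E = 0)%E.
Proof.
move=> dF cf intf F1 F2.
pose h (k : nat) (x : R) := (f x * \1_(`[- k%:R, k%:R]%classic) x)%:E.
have mf := measurable_int _ intf.
have mh k : measurable_fun setT (h k).
  apply/measurable_EFinP; apply: measurable_funM; first exact/measurable_EFinP.
  exact: measurable_indic.
have hf x : h ^~ x @ \oo --> (f x)%:E.
  apply: cvg_near_cst; near=> k; rewrite /h indicE mem_set ?mulr1//= in_itv/= -ler_norml.
  by near: k; exact: nbhs_infty_ger.
have hfae : {ae lebesgue_measure, forall x : measurableTypeR R,
    [set: measurableTypeR R] x -> h ^~ x @ \oo --> (EFin \o f) x}.
  by apply: aeW => x _; exact: hf.
have hb : {ae lebesgue_measure, forall (x : measurableTypeR R) k,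
    [set: measurableTypeR R] x -> (`|h k x| <= (abse \o (EFin \o f)) x)%E}.
  apply: aeW => x k _; rewrite /h lee_fin normrM ler_piMr// indicE.
  by case: (_ \in _); rewrite ?normr1 ?normr0.
have [_ _] := @dominated_convergence _ _ _ lebesgue_measure setT measurableT h
  (EFin \o f) (abse \o (EFin \o f)) mh mf hfae (integrable_abse intf) hb.
rewrite /=.
have -> : (fun k => \int[lebesgue_measure]_x h k x)%E = (fun k => (F k%:R - F (- k%:R))%:E).
  apply/funext => k.
  have -> : (\int[lebesgue_measure]_x h k x = \int[lebesgue_measure]_(x in `[(- k%:R)%R, k%:R]) (f x)%:E)%E.
    rewrite [RHS]integral_mkcond; apply: eq_integral => x _.
    by rewrite /h patchE indicE; case: (_ \in _); rewrite ?mulr1 ?mulr0.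
  case: k => [|k]; first by rewrite oppr0 set_itv1 integral_set1 subrr.
  have k0 : - k.+1%:R < k.+1%:R :> R by rewrite (@lt_trans _ _ 0)// oppr_lt0.
  rewrite EFinB; apply: continuous_FTC2 => //.
  - exact: continuous_subspaceT.
  - exact: (derivable_oo_LR dF).
  - by move=> x _; rewrite derive1E; exact: derive_val.
move=> cv; apply/esym; apply: (cvg_unique _ _ cv) => //.
apply: cvg_EFin; first by near=> k.
by rewrite -(subrr (0:R)); apply: cvgB.
Unshelve. all: by end_near. Qed.

Lemma normal_pdf0E (R : realType) (s x : R) : s != 0 ->
  normal_pdf 0 s x = normal_peak s * expR (- (x ^+ 2 / (s ^+ 2 *+ 2))).
Proof. by move=> s0; rewrite normal_pdfE// /normal_fun subr0 mulNr. Qed.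

Lemma normal_pdf_sqrt2 (R : realType) : exists2 c : R, 0 <= c &
  forall s x, s != 0 -> `|x| * normal_pdf 0 s x <= c * `|s| * normal_pdf 0 (Num.sqrt 2 * s) x.
Proof.
exists (2 * Num.sqrt 2); first by rewrite mulr_ge0// sqrtr_ge0.
move=> s x s0.
have r0 : Num.sqrt 2 * s != 0 :> R by rewrite mulf_neq0// gt_eqF// sqrtr_gt0.
have p1 := normal_peak_gt0 s0. have p2 := normal_peak_gt0 r0.
have pE : normal_peak s = Num.sqrt 2 * normal_peak (Num.sqrt 2 * s).
  have q0 : 0 < Num.sqrt 2 :> R by rewrite sqrtr_gt0.
  rewrite /normal_peak exprMn sqr_sqrtr// -(mulrnAl _ _ 2) -(mulrA 2) -mulrnAr mulrnAl.
  by rewrite (sqrtrM (s ^+ 2 * pi *+ 2) (ler0n R 2)) invfM mulrA mulfV ?mul1r// gt_eqF.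
rewrite (_ : 2 * Num.sqrt 2 * `|s| = 2 * `|s| * normal_peak s / normal_peak (Num.sqrt 2 * s)); last first.
  by rewrite [X in _ * X / _]pE; field; rewrite gt_eqF.
rewrite !normal_pdf0E// exprMn sqr_sqrtr//.
rewrite mulrCA [leRHS]mulrA mulfVK ?gt_eqF// (mulrC _ (normal_peak s)) -(mulrA (normal_peak s)).
rewrite ler_pM2l//.
set u := `|x| / (2 * `|s|).
have sn0 : 0 < `|s| by rewrite normr_gt0.
have u0 : 0 <= u by rewrite divr_ge0// mulr_ge0// ltW.
have -> : `|x| = 2 * `|s| * u by rewrite /u mulrC mulfVK// mulf_neq0// gt_eqF.
have -> : x ^+ 2 / (s ^+ 2 *+ 2) = u ^+ 2 + u ^+ 2.
  rewrite /u !expr_div_n !exprMn !real_normK ?num_real//.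
  by field.
have -> : x ^+ 2 / (2 * s ^+ 2 *+ 2) = u ^+ 2.
  rewrite /u !expr_div_n !exprMn !real_normK ?num_real//.
  by field.
clearbody u; rewrite -!mulrA ler_pM2l// ler_pM2l// opprD expRD.
suff h : u * expR (- u ^+ 2) <= 1.
  by rewrite mulrA -[leRHS]mul1r ler_wpM2r ?expR_ge0.
rewrite expRN ler_pdivrMr ?expR_gt0// mul1r.
apply: le_trans (expR_ge1Dx _).
by nra.
Qed.

Lemma integrable_mul_normal_pdf (R : realType) (s : R) : s != 0 ->
  lebesgue_measure.-integrable [set: R] (fun x => (`|x| * normal_pdf 0 s x)%:E).
Proof.
move=> s0; have [c c0 cP] := normal_pdf_sqrt2 R.
apply: (@le_integrable _ (measurableTypeR R) R lebesgue_measure setT measurableT _ (fun x => ((c * `|s|)%:E * (normal_pdf 0 (Num.sqrt 2 * s) x)%:E)%E)).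
- apply/measurable_EFinP/measurable_funM; first exact: continuous_measurable_fun (@norm_continuous _ R).
  exact: measurable_normal_pdf.
- move=> x _; rewrite -EFinM !abse_EFin lee_fin.
  have h1 : 0 <= `|x| * normal_pdf 0 s x by rewrite mulr_ge0// normal_pdf_ge0.
  by rewrite (ger0_norm h1) (le_trans (cP s x s0))// ler_norm.
- exact/integrableZl/integrable_normal_pdf.
Qed.

Lemma integrable_mul_le1 d (T : measurableType d) (R : realType)
    (mu : {measure set T -> \bar R}) (f g : T -> R) :
  mu.-integrable [set: T] (fun x => (g x)%:E) ->
  measurable_fun setT f -> (forall x, `|f x| <= 1) ->
  mu.-integrable [set: T] (fun x => (f x * g x)%:E).
Proof.
move=> ig mf f1.
have mg : measurable_fun setT g by apply/measurable_EFinP; exact: measurable_int ig.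
apply: (le_integrable measurableT _ _ ig).
- by apply/measurable_EFinP/measurable_funM.
- by move=> x _; rewrite !abse_EFin lee_fin normrM ler_piMl.
Qed.

Lemma is_derive_normal_pdf (R : realType) (s x : R) : s != 0 ->
  is_derive x 1 (normal_pdf 0 s) (- (x / s ^+ 2) * normal_pdf 0 s x).
Proof.
move=> s0.
have -> : normal_pdf 0 s = fun x => normal_peak s * expR (- (x ^+ 2 / (s ^+ 2 *+ 2))).
  by apply/funext => y; rewrite normal_pdf0E.
apply: is_derive_eq.
rewrite /GRing.scale/=; field.
by [].
Qed.

Lemma cos_norm_le1 (R : realType) (x : R) : `|cos x| <= 1.
Proof. by rewrite ler_norml cos_geN1 cos_le1. Qed.

Lemma sin_norm_le1 (R : realType) (x : R) : `|sin x| <= 1.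
Proof. by rewrite ler_norml sin_geN1 sin_le1. Qed.

Lemma cvg0_natinv (R : realType) (u : R^nat) (c : R) :
  (forall k, `|u k.+1| <= c / k.+1%:R) -> u n @[n --> \oo] --> (0 : R).
Proof.
move=> uc; apply/cvgrPdist_le => e e0.
near=> n; rewrite sub0r normrN.
have n0 : (0 < n)%N by near: n; exact: nbhs_infty_gt.
rewrite -(prednK n0); apply: le_trans (uc _) _.
rewrite prednK// ler_pdivrMr ?ltr0n// mulrC -ler_pdivrMr//.
by near: n; exact: nbhs_infty_ger.
Unshelve. all: by end_near. Qed.

Lemma normal_cos_derive (R : realType) (s x : R) : s != 0 ->
  is_derive x 1 (fun u => \int[lebesgue_measure]_y (cos (u * y) * normal_pdf 0 s y))
    (\int[lebesgue_measure]_y (- y * sin (x * y) * normal_pdf 0 s y)).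
Proof.
move=> s0.
pose f (u y : R) : R := cos (u * y) * normal_pdf 0 s y.
have df (u y : R) : is_derive u 1 (f ^~ y) (- y * sin (u * y) * normal_pdf 0 s y).
  rewrite /f; apply: is_derive_eq.
  by rewrite /GRing.scale/=; ring.
have mc u : measurable_fun setT (fun y : R => cos (u * y)).
  apply: continuous_measurable_fun => y.
  by apply: (continuous_comp (f := fun y => u * y) (g := cos)); [exact: mulrl_continuous|exact: continuous_cos].
have intf u : (u : R) \in `]x - 1, x + 1[ -> lebesgue_measure.-integrable setT (EFin \o f u).
  move=> _; exact: (integrable_mul_le1 (integrable_normal_pdf 0 s) (mc u) (fun y => cos_norm_le1 _)).
have xI : x \in `]x - 1, x + 1[ by rewrite in_itv/=; apply/andP; split; lra.
have d1 (u y : R) : partial1of2 f u y = - y * sin (u * y) * normal_pdf 0 s y.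
  by rewrite partial1of2E; exact: derive_val.
have Gb (u y : R) : u \in `]x - 1, x + 1[ -> setT y -> `|partial1of2 f u y| <= `|y| * normal_pdf 0 s y.
  move=> _ _; rewrite d1 !normrM normrN (ger0_norm (normal_pdf_ge0 _ _ _)).
  by rewrite ler_wpM2r ?normal_pdf_ge0// ler_piMr// sin_norm_le1.
have G0 y : 0 <= `|y| * normal_pdf 0 s y by rewrite mulr_ge0// normal_pdf_ge0.
have df' (u y : R) : u \in `]x - 1, x + 1[ -> setT y -> derivable (f ^~ y) u 1 by move=> _ _; case: (df u y).
apply: DeriveDef.
  exact: (@derivable_under_integral R _ (measurableTypeR R) lebesgue_measure f setT measurableT
    x (x - 1) (x + 1) xI intf df' _ G0 (integrable_mul_normal_pdf s0) Gb).
rewrite -derive1E (@differentiation_under_integral R _ (measurableTypeR R) lebesgue_measure f setT measurableT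
    x (x - 1) (x + 1) xI intf df' _ G0 (integrable_mul_normal_pdf s0) Gb).
by apply: eq_Rintegral => y _; exact: d1.
Qed.

Lemma normal_sin_parts (R : realType) (s x : R) : s != 0 ->
  \int[lebesgue_measure]_y (- y * sin (x * y) * normal_pdf 0 s y) =
  - (s ^+ 2 * x) * \int[lebesgue_measure]_y (cos (x * y) * normal_pdf 0 s y).
Proof.
move=> s0.
have mc : measurable_fun setT (fun y : R => cos (x * y)).
  apply: continuous_measurable_fun => y.
  by apply: (continuous_comp (f := fun y => x * y) (g := cos)); [exact: mulrl_continuous|exact: continuous_cos].
have ms : measurable_fun setT (fun y : R => sin (x * y)).
  apply: continuous_measurable_fun => y.
  by apply: (continuous_comp (f := fun y => x * y) (g := sin)); [exact: mulrl_continuous|exact: continuous_sin].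
have ic : lebesgue_measure.-integrable [set: measurableTypeR R] (fun y => (cos (x * y) * normal_pdf 0 s y)%:E).
  exact: (integrable_mul_le1 (integrable_normal_pdf 0 s) mc (fun y => cos_norm_le1 _)).
have isn : lebesgue_measure.-integrable [set: measurableTypeR R] (fun y => (- y * sin (x * y) * normal_pdf 0 s y)%:E).
  apply: (le_integrable measurableT _ _ (integrable_mul_normal_pdf s0)).
    apply/measurable_EFinP/measurable_funM; last exact: measurable_normal_pdf.
    by apply: measurable_funM => //; exact: measurable_funN.
  move=> y _; rewrite !abse_EFin lee_fin !normrM normrN normr_id ler_wpM2r//.
  by rewrite ler_piMr// sin_norm_le1.
have s20 : s ^+ 2 != 0 by rewrite expf_neq0.
pose F (y : R) := s ^+ 2 * (sin (x * y) * normal_pdf 0 s y).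
pose f (y : R) := - y * sin (x * y) * normal_pdf 0 s y + (s ^+ 2 * x) * (cos (x * y) * normal_pdf 0 s y).
have dF (y : R) : is_derive y 1 F (f y).
  have := is_derive_normal_pdf y s0 => dn.
  apply: is_derive_eq; rewrite /GRing.scale/= /f.
  by field.
have cf : continuous f.
  have cn := @continuous_normal_pdf R 0 s s0.
  have cm (g : R -> R) : continuous g -> continuous (fun y => g (x * y)).
    by move=> cg y; apply: (continuous_comp (f := fun y => x * y) (g := g)); [exact: mulrl_continuous|exact: cg].
  move=> y; apply: cvgD.
    apply: cvgM; last exact: cn.
    apply: cvgM; last exact: (cm _ (@continuous_sin R)).
    by apply: cvgN; exact: cvg_id.
  apply: cvgM; first exact: cvg_cst.
  by apply: cvgM; [exact: (cm _ (@continuous_cos R))|exact: cn].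
have if_ : lebesgue_measure.-integrable setT (EFin \o f).
  rewrite /f/=; apply: (@integrableD _ (measurableTypeR R) R lebesgue_measure setT measurableT (fun y => (- y * sin (x * y) * normal_pdf 0 s y)%:E) (fun y => ((s ^+ 2 * x) * (cos (x * y) * normal_pdf 0 s y))%:E)) => //.
  exact: (@integrableZl _ (measurableTypeR R) R lebesgue_measure setT measurableT (s ^+ 2 * x) _ ic).
have Fb (y : R) : `|F y| <= s ^+ 2 * normal_pdf 0 s y.
  rewrite /F normrM (ger0_norm (sqr_ge0 s)) normrM (ger0_norm (normal_pdf_ge0 _ _ _)).
  by rewrite ler_wpM2l ?sqr_ge0// ler_piMl ?normal_pdf_ge0// sin_norm_le1.
have pb (k : nat) : normal_pdf 0 s k.+1%:R <= normal_peak s * (s ^+ 2 *+ 2) / k.+1%:R.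
  rewrite normal_pdf0E// -mulrA ler_wpM2l ?normal_peak_ge0//.
  rewrite expRN -[leRHS]invrK lef_pV2 ?posrE ?expR_gt0//; last first.
    by rewrite invr_gt0 divr_gt0// pmulrn_lgt0// exprn_even_gt0.
  apply: le_trans (expR_ge1Dx _); rewrite invf_div.
  have s2 : 0 < s ^+ 2 *+ 2 by rewrite pmulrn_lgt0// exprn_even_gt0.
  rewrite (@le_trans _ _ (k.+1%:R ^+ 2 / (s ^+ 2 *+ 2)))//; last by rewrite lerDr.
  by rewrite ler_pM2r ?invr_gt0// expr2 ler_peMr// ler1n.
have F1 : F n%:R @[n --> \oo] --> (0 : R).
  apply: (@cvg0_natinv _ _ (s ^+ 2 * (normal_peak s * (s ^+ 2 *+ 2)))) => k.
  by apply: le_trans (Fb _) _; rewrite -mulrA ler_wpM2l ?sqr_ge0.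
have F2 : F (- n%:R) @[n --> \oo] --> (0 : R).
  apply: (@cvg0_natinv _ _ (s ^+ 2 * (normal_peak s * (s ^+ 2 *+ 2)))) => k.
  apply: le_trans (Fb _) _; rewrite -mulrA ler_wpM2l ?sqr_ge0//.
  by have := pb k; rewrite !normal_pdf0E// sqrrN.
have := integral_derive_eq0 dF cf if_ F1 F2.
move=> /(congr1 fine); rewrite -/(Rintegral _ _ _) /=.
rewrite /f (@RintegralD _ (measurableTypeR R))//; last first.
  exact: (@integrableZl _ (measurableTypeR R) R lebesgue_measure setT measurableT (s ^+ 2 * x) _ ic).
rewrite (@RintegralZl _ (measurableTypeR R))//.
by move/eqP; rewrite addr_eq0 => /eqP ->; rewrite mulNr.
Qed.

Lemma normal_fourier (R : realType) (s x : R) : s != 0 ->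
  \int[lebesgue_measure]_y (cos (x * y) * normal_pdf 0 s y) = expR (- (s ^+ 2 * x ^+ 2 / 2)).
Proof.
move=> s0.
pose phi (u : R) := \int[lebesgue_measure]_y (cos (u * y) * normal_pdf 0 s y).
have dphi (u : R) : is_derive u 1 phi (- (s ^+ 2 * u) * phi u).
  by rewrite -normal_sin_parts//; exact: normal_cos_derive.
pose psi (u : R) := phi u * expR (s ^+ 2 * u ^+ 2 / 2).
have dpsi (u : R) : is_derive u 1 psi 0.
  rewrite /psi; apply: is_derive_eq; rewrite /GRing.scale/=.
  by field.
have := is_derive_0_is_cst x 0 dpsi.
rewrite /psi expr0n mulr0 mul0r expR0 mulr1 /phi.
rewrite [in RHS]/Rintegral.
have -> : (\int[lebesgue_measure]_y (cos (0 * y) * normal_pdf 0 s y)%:E = 1)%E.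
  rewrite -(integral_normal_pdf 0 s); apply: eq_integral => y _.
  by rewrite mul0r cos0 mul1r.
move=> /= h.
by rewrite expRN -div1r; apply: (canRL (mulfK _)) h; rewrite gt_eqF// expR_gt0.
Qed.

Lemma normal_fourier_sin (R : realType) (s x : R) : s != 0 ->
  (\int[lebesgue_measure]_y (sin (x * y) * normal_pdf 0 s y)%:E = 0)%E.
Proof.
move=> s0.
have ms : measurable_fun setT (fun y : R => sin (x * y)).
  apply: continuous_measurable_fun => y.
  by apply: (continuous_comp (f := fun y => x * y) (g := sin)); [exact: mulrl_continuous|exact: continuous_sin].
have isn := integrable_mul_le1 (integrable_normal_pdf 0 s) ms (fun y => sin_norm_le1 _).
have mr : measurable_fun [set: measurableTypeR R] (fun x : measurableTypeR R => 0 - x : measurableTypeR R).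
  exact: measurable_funB.
set I := (\int[_]_y _)%E.
have Ifin : I \is a fin_num by exact: (integrable_fin_num _ isn).
suff h : (I = - I)%E.
  move: h; rewrite -(fineK Ifin) => -[h]; congr EFin; lra.
have e (y : measurableTypeR R) : (sin (x * (0 - y)) * normal_pdf 0 s (0 - y))%:E = (- (sin (x * y) * normal_pdf 0 s y)%:E)%E :> \bar R.
  by rewrite sub0r mulrN sinN !normal_pdf0E// sqrrN mulNr EFinN.
have isn' : lebesgue_measure.-integrable [set: measurableTypeR R] (fun y => (sin (x * (0 - y)) * normal_pdf 0 s (0 - y))%:E).
  by under eq_fun do rewrite e; exact: integrableN.
rewrite /I -integralN//; last exact: integrable_add_def.
rewrite -(eq_integral _ _ (fun y _ => e y)).
rewrite -(@integral_pushforward _ _ _ _ R _ mr lebesgue_measure setT (fun y => (sin (x * y) * normal_pdf 0 s y)%:E) (measurable_int _ isn) isn' measurableT).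
apply: (@eq_measure_integral _ _ _ setT (measure_function_pushforward__canonical__measure_function_Measure lebesgue_measure
    mr) lebesgue_measure) => A mA _.
by apply/esym; exact: lebesgue_measure_reflect.
Qed.

Lemma integral_rV_cons (R : realType) (n : nat) (F : 'rV[R]_n.+1 -> \bar R) :
  (borel_lebesgue R n.+1).-integrable setT F ->
  (\int[borel_lebesgue R n.+1]_x F x =
   \int[lebesgue_measure]_x \int[borel_lebesgue R n]_v F (rV_cons (x, v)))%E.
Proof.
move=> iF; have mF := measurable_int _ iF.
have mc := @measurable_rV_cons R n.
have iFc : (lebesgue_measure \x borel_lebesgue R n)%E.-integrable setT (F \o @rV_cons R n).
  apply/integrableP; split; first exact: (measurableT_comp mF mc).
  have /integrableP[_] := iF; apply: le_lt_trans.
  rewrite -(@ge0_integral_pushforward _ _ _ _ R _ mc (lebesgue_measure \x borel_lebesgue R n)%E setT (abse \o F) measurableT)//.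
    exact: measurableT_comp.
  by move=> y _; exact: abse_ge0.
rewrite (_ : \int[_]_x F x = \int[(lebesgue_measure \x borel_lebesgue R n)%E]_z F (rV_cons z))%E.
  by apply/esym; exact: (integral12_prod_meas1 iFc).
exact: (@integral_pushforward _ _ _ _ R _ mc (lebesgue_measure \x borel_lebesgue R n)%E setT F mF iFc measurableT).
Qed.

Lemma integrable_cos_normal (R : realType) (s x : R) :
  lebesgue_measure.-integrable [set: measurableTypeR R] (fun y => (cos (x * y) * normal_pdf 0 s y)%:E).
Proof.
apply: (integrable_mul_le1 (integrable_normal_pdf 0 s) _ (fun y => cos_norm_le1 _)).
apply: continuous_measurable_fun => y.
by apply: (continuous_comp (f := fun y => x * y) (g := cos)); [exact: mulrl_continuous|exact: continuous_cos].
Qed.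

Lemma integrable_sin_normal (R : realType) (s x : R) :
  lebesgue_measure.-integrable [set: measurableTypeR R] (fun y => (sin (x * y) * normal_pdf 0 s y)%:E).
Proof.
apply: (integrable_mul_le1 (integrable_normal_pdf 0 s) _ (fun y => sin_norm_le1 _)).
apply: continuous_measurable_fun => y.
by apply: (continuous_comp (f := fun y => x * y) (g := sin)); [exact: mulrl_continuous|exact: continuous_sin].
Qed.

Section gaussian.
Context (R : realType).
Definition gaussian (n : nat) (s : R) (x : 'rV[R]_n) : R :=
  \prod_(i < n) normal_pdf 0 s (x ord0 i).
Lemma gaussian_ge0 n s (x : 'rV[R]_n) : 0 <= gaussian s x.
Proof. by apply: prodr_ge0 => i _; exact: normal_pdf_ge0. Qed.

Lemma gaussian_ub n s (x : 'rV[R]_n) : s != 0 -> gaussian s x <= normal_peak s ^+ n.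
Proof.
move=> s0; rewrite -[X in _ ^+ X]card_ord -prodr_const; apply: ler_prod => i _.
by rewrite normal_pdf_ge0 normal_pdf_ub.
Qed.

Lemma gaussianE n s (x : 'rV[R]_n) : s != 0 ->
  gaussian s x = normal_peak s ^+ n * expR (- (dot x x / (s ^+ 2 *+ 2))).
Proof.
move=> s0; rewrite /gaussian; under eq_bigr do rewrite normal_pdf0E//.
rewrite big_split/= prodr_const card_ord -expR_sum; congr (_ * expR _).
by rewrite /dot mulr_suml -sumrN; apply: eq_bigr => i _; rewrite expr2.
Qed.

Lemma measurable_gaussian n s : measurable_fun setT (@gaussian n s).
Proof.
apply: measurable_prod => i _.
by apply: (measurableT_comp (measurable_normal_pdf 0 s)); exact: measurable_coord.
Qed.

Lemma integral_gaussian n s : (\int[borel_lebesgue R n]_x (gaussian s x)%:E = 1)%E.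
Proof.
rewrite (ge0_integral_rV_prod (h := fun=> normal_pdf 0 s)).
- by rewrite big1// => i _; exact: integral_normal_pdf.
- by move=> i; exact: measurable_normal_pdf.
- by move=> i x; exact: normal_pdf_ge0.
Qed.

Lemma integrable_gaussian n s :
  (borel_lebesgue R n).-integrable setT (fun x => (gaussian s x)%:E).
Proof.
apply/integrableP; split; first by apply/measurable_EFinP; exact: measurable_gaussian.
rewrite (_ : (\int[_]_x _)%E = 1%E) ?ltry// -(integral_gaussian n s).
by apply: eq_integral => x _; rewrite gee0_abs// lee_fin gaussian_ge0.
Qed.

Lemma measurable_dot n (x : 'rV[R]_n) : measurable_fun setT (fun y => dot x y).
Proof.
apply: measurable_sum => i; apply: measurable_funM; first exact: measurable_cst.
exact: measurable_coord.
Qed.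

Lemma dot_rV_cons n (x : 'rV[R]_n.+1) a (v : 'rV[R]_n) :
  dot x (rV_cons (a, v)) = x ord0 ord0 * a + dot (\row_i x ord0 (lift ord0 i)) v.
Proof.
rewrite /dot big_ord_recl rV_consK0; congr +%R.
by apply: eq_bigr => i _; rewrite rV_consK1 mxE.
Qed.

Lemma gaussian_rV_cons n s a (v : 'rV[R]_n) :
  gaussian s (rV_cons (a, v)) = normal_pdf 0 s a * gaussian s v.
Proof.
rewrite /gaussian big_ord_recl rV_consK0; congr *%R.
by apply: eq_bigr => i _; rewrite rV_consK1.
Qed.

Lemma integrable_cos_gaussian n s (x : 'rV[R]_n) :
  (borel_lebesgue R n).-integrable setT (fun y => (cos (dot x y) * gaussian s y)%:E).
Proof.
apply: (integrable_mul_le1 (integrable_gaussian n s)) => [|y]; last exact: cos_norm_le1.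
by apply: measurableT_comp (measurable_dot x); exact: continuous_measurable_fun (@continuous_cos R).
Qed.

Lemma integrable_sin_gaussian n s (x : 'rV[R]_n) :
  (borel_lebesgue R n).-integrable setT (fun y => (sin (dot x y) * gaussian s y)%:E).
Proof.
apply: (integrable_mul_le1 (integrable_gaussian n s)) => [|y]; last exact: sin_norm_le1.
by apply: measurableT_comp (measurable_dot x); exact: continuous_measurable_fun (@continuous_sin R).
Qed.

Lemma gaussian_fourier n s (x : 'rV[R]_n) : s != 0 ->
  (\int[borel_lebesgue R n]_y (cos (dot x y) * gaussian s y)%:E =
    (expR (- (s ^+ 2 * dot x x / 2)))%:E)%E /\
  (\int[borel_lebesgue R n]_y (sin (dot x y) * gaussian s y)%:E = 0)%E.
Proof.
move=> s0; elim: n x => [x|n IH x].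
  have g1 (y : 'rV[R]_0) : gaussian s y = 1 by rewrite /gaussian big_ord0.
  have d0 (y : 'rV[R]_0) : dot x y = 0 by rewrite /dot big_ord0.
  split; under eq_integral do rewrite g1 d0 ?cos0 ?sin0 mulr1.
    by rewrite integral_cst//= diracE mem_set// mule1 d0 mulr0 mul0r oppr0 expR0.
  by rewrite integral0.
pose x' : 'rV[R]_n := \row_i x ord0 (lift ord0 i).
have [IHc IHs] := IH x'.
have E0 : dot x x = x ord0 ord0 ^+ 2 + dot x' x'.
  by rewrite /dot big_ord_recl -expr2; congr +%R; apply: eq_bigr => i _; rewrite !mxE.
pose e' := expR (- (s ^+ 2 * dot x' x' / 2)).
have inner (a b : R) : (\int[borel_lebesgue R n]_v
    (a * (cos (dot x' v) * gaussian s v) + b * (sin (dot x' v) * gaussian s v))%:E = (a * e')%:E)%E.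
  have ic := integrableZl measurableT a (integrable_cos_gaussian s x').
  have isn := integrableZl measurableT b (integrable_sin_gaussian s x').
  transitivity (\int[borel_lebesgue R n]_v
      (a%:E * (cos (dot x' v) * gaussian s v)%:E + b%:E * (sin (dot x' v) * gaussian s v)%:E))%E.
    by apply: eq_integral => v _; rewrite EFinD !EFinM.
  rewrite (integralD measurableT ic isn).
  rewrite (integralZl measurableT (integrable_cos_gaussian s x')).
  rewrite (integralZl measurableT (integrable_sin_gaussian s x')).
  by rewrite IHc IHs mule0 adde0.
split.
- rewrite integral_rV_cons; last exact: integrable_cos_gaussian.
  rewrite (eq_integral (fun a : measurableTypeR R => e'%:E * (cos (x ord0 ord0 * a) * normal_pdf 0 s a)%:E)%E) => [|a _].
    rewrite integralZl//; last exact: integrable_cos_normal.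
    rewrite -[X in (_ * X)%E]fineK; last exact: (integrable_fin_num _ (integrable_cos_normal _ _)).
    rewrite (normal_fourier (x ord0 ord0) s0 : fine _ = _).
    by rewrite -EFinM mulrC -expRD E0; congr (expR _)%:E; field.
  rewrite -EFinM (mulrC e') -(inner _ (- (sin (x ord0 ord0 * a) * normal_pdf 0 s a))).
  apply: eq_integral => v _; congr EFin.
  rewrite dot_rV_cons gaussian_rV_cons cosD -/x'.
  by ring.
- rewrite integral_rV_cons; last exact: integrable_sin_gaussian.
  rewrite (eq_integral (fun a : measurableTypeR R => e'%:E * (sin (x ord0 ord0 * a) * normal_pdf 0 s a)%:E)%E) => [|a _].
    rewrite integralZl//; last exact: integrable_sin_normal.
    by rewrite normal_fourier_sin// mule0.
  rewrite -EFinM (mulrC e') -(inner _ (cos (x ord0 ord0 * a) * normal_pdf 0 s a)).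
  apply: eq_integral => v _; congr EFin.
  rewrite dot_rV_cons gaussian_rV_cons sinD -/x'.
  by ring.
Qed.

End gaussian.

(** * Uniqueness of the Fourier transform *)

Lemma integrable_tensor d1 d2 (T1 : measurableType d1) (T2 : measurableType d2) (R : realType)
    (m1 : {sigma_finite_measure set T1 -> \bar R}) (m2 : {sigma_finite_measure set T2 -> \bar R})
    (f : T1 -> R) (g : T2 -> R) :
  m1.-integrable setT (fun x => (f x)%:E) -> m2.-integrable setT (fun x => (g x)%:E) ->
  (m1 \x m2)%E.-integrable setT (fun z => (f z.1 * g z.2)%:E).
Proof.
move=> if_ ig.
have mf : measurable_fun setT f by apply/measurable_EFinP; exact: measurable_int if_.
have mg : measurable_fun setT g by apply/measurable_EFinP; exact: measurable_int ig.
have mm : measurable_fun setT (fun z : T1 * T2 => (f z.1 * g z.2)%:E).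
  apply/measurable_EFinP/measurable_funM; first exact: (measurableT_comp mf measurable_fst).
  exact: (measurableT_comp mg measurable_snd).
apply/(integrable12ltyP m1 m2 mm).
have /integrableP[_ if1] := if_.
have /integrableP[_ ig1] := ig.
rewrite (_ : (\int[m1]_x _)%E = ((\int[m1]_x `|(f x)%:E|) * \int[m2]_y `|(g y)%:E|)%E).
  have h1 : (0 <= \int[m1]_x `|(f x)%:E|)%E by exact: integral_ge0.
  by rewrite lte_mul_pinfty// ge0_fin_numE.
rewrite -ge0_integralZr//; last 2 first.
- by apply: measurableT_comp => //; exact/measurable_EFinP.
- exact: integral_ge0.
apply: eq_integral => x _.
rewrite -ge0_integralZl//.
- by apply: eq_integral => y _; rewrite EFinM abseM.
- by apply: measurableT_comp => //; exact/measurable_EFinP.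
Qed.

Definition normal_tail (R : realType) (s y : R) : R :=
  \int[lebesgue_measure]_u (\1_(`]y, +oo[%classic) u * normal_pdf 0 s u).
Lemma integrable_normal_tail (R : realType) (s y : R) :
  lebesgue_measure.-integrable [set: measurableTypeR R]
    (fun u => (\1_(`]y, +oo[%classic) u * normal_pdf 0 s u)%:E).
Proof.
apply: (integrable_mul_le1 (integrable_normal_pdf 0 s)) => [|u].
  exact: measurable_indic.
by rewrite indicE; case: (_ \in _); rewrite ?normr1 ?normr0.
Qed.

Lemma normal_tailE (R : realType) (s y : R) :
  (\int[lebesgue_measure]_u (\1_(`]y, +oo[%classic) u * normal_pdf 0 s u)%:E = (normal_tail s y)%:E)%E.
Proof. by rewrite /normal_tail/Rintegral fineK//; exact: (integrable_fin_num _ (integrable_normal_tail s y)). Qed.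

Lemma normal_tail_ge0 (R : realType) (s y : R) : 0 <= normal_tail s y.
Proof.
rewrite -lee_fin -normal_tailE; apply: integral_ge0 => u _.
by rewrite lee_fin mulr_ge0// normal_pdf_ge0.
Qed.

Lemma normal_tail_le1 (R : realType) (s y : R) : normal_tail s y <= 1.
Proof.
rewrite -lee_fin -normal_tailE -(integral_normal_pdf 0 s); apply: ge0_le_integral => //.
- by move=> u _; rewrite lee_fin mulr_ge0// normal_pdf_ge0.
- exact: measurable_int (integrable_normal_tail s y).
- exact: measurable_int (integrable_normal_pdf 0 s).
- move=> u _; rewrite lee_fin ler_piMl// ?normal_pdf_ge0//.
Qed.

Lemma normal_tail_bound (R : realType) : exists2 c : R, 0 <= c & forall s y : R, s != 0 -> y != 0 ->
  `|normal_tail s y - (y < 0)%R%:R| <= c * `|s| / `|y|.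
Proof.
have [c c0 cP] := normal_pdf_sqrt2 R; exists c => // s y s0 y0.
have ny : 0 < `|y| by rewrite normr_gt0.
pose k := c * `|s| / `|y|.
have k0 : 0 <= k by rewrite divr_ge0// mulr_ge0.
have kP u : `|u| / `|y| * normal_pdf 0 s u <= k * normal_pdf 0 (Num.sqrt 2 * s) u.
  rewrite mulrAC /k [leRHS]mulrAC ler_pM2r ?invr_gt0//.
  exact: cP.
have mk : measurable_fun [set: measurableTypeR R] (fun u => (k * normal_pdf 0 (Num.sqrt 2 * s) u)%:E).
  by apply/measurable_EFinP/measurable_funM => //; exact: measurable_normal_pdf.
have kint : (\int[lebesgue_measure]_u (k * normal_pdf 0 (Num.sqrt 2 * s) u)%:E = k%:E)%E.
  under eq_integral do rewrite EFinM.
  by rewrite integralZl ?integral_normal_pdf ?mule1//; exact: integrable_normal_pdf.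
rewrite -/k; case: ltgtP y0 => // y0 _ /=.
- rewrite ler0_norm ?subr_le0 ?normal_tail_le1// opprB lerBlDr addrC.
  rewrite -lee_fin EFinD -normal_tailE -kint -ge0_integralD//; first last.
  + by move=> u _; rewrite lee_fin mulr_ge0// normal_pdf_ge0.
  + exact: measurable_int (integrable_normal_tail s y).
  + by move=> u _; rewrite lee_fin mulr_ge0// normal_pdf_ge0.
  rewrite -(integral_normal_pdf 0 s); apply: ge0_le_integral => //.
  + by move=> u _; rewrite lee_fin normal_pdf_ge0.
  + exact: measurable_int (integrable_normal_pdf 0 s).
  + apply: emeasurable_funD => //; exact: measurable_int (integrable_normal_tail s y).
  + move=> u _; rewrite -EFinD lee_fin indicE.
    have p0 := normal_pdf_ge0 0 s u.
    have [uy|uy] := ltP y u.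
      rewrite mem_set/= ?in_itv/= ?andbT// mul1r lerDl mulr_ge0// normal_pdf_ge0//.
    rewrite memNset/= ?in_itv/= ?andbT; last by apply/negP; rewrite -leNgt.
    rewrite mul0r add0r; apply: le_trans (kP u).
    rewrite ler_peMl// ler_pdivlMr// mul1r !ltr0_norm ?lerN2//.
    exact: le_lt_trans uy y0.
- rewrite subr0 ger0_norm ?normal_tail_ge0// -lee_fin -normal_tailE -kint.
  apply: ge0_le_integral => //.
  + by move=> u _; rewrite lee_fin mulr_ge0// normal_pdf_ge0.
  + exact: measurable_int (integrable_normal_tail s y).
  + move=> u _; rewrite lee_fin indicE.
    have p0 := normal_pdf_ge0 0 s u.
    have [uy|uy] := ltP y u; last first.
      rewrite memNset/= ?in_itv/= ?andbT; last by apply/negP; rewrite -leNgt.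
      by rewrite mul0r mulr_ge0// normal_pdf_ge0.
    rewrite mem_set/= ?in_itv/= ?andbT// mul1r; apply: le_trans (kP u).
    rewrite ler_peMl// ler_pdivlMr// mul1r !gtr0_norm ?ltW//.
    exact: lt_trans uy.
Qed.

Lemma gaussian_opp (R : realType) n (s : R) (x : 'rV[R]_n) : s != 0 -> gaussian s (- x) = gaussian s x.
Proof. by move=> s0; apply: eq_bigr => i _; rewrite mxE !normal_pdf0E// sqrrN. Qed.

Lemma dotBl (R : realType) n (x y z : 'rV[R]_n) : dot (x - y) z = dot x z - dot y z.
Proof.
by rewrite /dot -sumrB; apply: eq_bigr => i _; rewrite !mxE mulrBl.
Qed.

Lemma measurable_dot2 (R : realType) n d (T : measurableType d) (f g : T -> 'rV[R]_n) :
  measurable_fun setT f -> measurable_fun setT g -> measurable_fun setT (fun t => dot (f t) (g t)).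
Proof.
move=> mf mg; apply: measurable_sum => i; apply: measurable_funM.
  exact: (measurableT_comp (measurable_coord i) mf).
exact: (measurableT_comp (measurable_coord i) mg).
Qed.

Lemma cvg_prodr (R : realType) (I : Type) (r : seq I) (u : I -> nat -> R) (l : I -> R) :
  (forall i, u i k @[k --> \oo] --> l i) ->
  \prod_(i <- r) u i k @[k --> \oo] --> \prod_(i <- r) l i.
Proof.
move=> ul; elim: r => [|i r IH].
  by rewrite big_nil; under eq_fun do rewrite big_nil; exact: cvg_cst.
by rewrite big_cons; under eq_fun do rewrite big_cons; apply: cvgM.
Qed.

Lemma rV_orthant_generated (R : realType) (n : nat) :
  @measurable _ 'rV[R]_n = <<s range (fun b : 'rV[R]_n => [set v : 'rV[R]_n | forall i, v ord0 i < b ord0 i]) >>.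
Proof.
pose orth (b : 'rV[R]_n) := [set v : 'rV[R]_n | forall i, v ord0 i < b ord0 i].
have sal := @smallest_sigma_algebra _ [set: 'rV[R]_n] (range orth).
apply/seteqP; split; last first.
  apply: smallest_sub; first exact: sigma_algebra_measurable.
  move=> _ [b _ <-].
  rewrite (_ : [set v | _] = [set v : 'rV[R]_n | forall i, `]-oo, b ord0 i[%classic (v ord0 i)]).
    exact: (rV_rect_measurable (A := fun i => `]-oo, b ord0 i[%classic)).
  by apply/seteqP; split => v /= vb i; have := vb i; rewrite in_itv.
apply: smallest_sub => // B; rewrite -bigcup_seq/= => -[i _ [Y mY <-]]; rewrite setTI.
suff : (@ocitv R).-sigma.-measurable `<=` [set Y | <<s range orth>> ((fun v : 'rV[R]_n => v ord0 i) @^-1` Y)] by exact.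
rewrite RGenInftyO.measurableE; apply: smallest_sub.
  split => /=.
  - by rewrite preimage_set0; case: sal.
  - move=> A mA; rewrite setTD -preimage_setC -setTD; case: sal => _ + _; exact.
  - by move=> F mF; rewrite preimage_bigcup; case: sal => _ _; apply.
move=> _ [c ->] /=.
rewrite (_ : _ @^-1` _ = \bigcup_k orth (\row_j (if j == i then c else k%:R))).
  case: sal => _ _; apply => k; apply: sub_sigma_algebra.
  by exists (\row_j (if j == i then c else k%:R)).
apply/seteqP; split => [v /=|v [k _ /(_ i)]].
  rewrite in_itv/= => vc.
  have [k kP] : exists k : nat, forall j, v ord0 j < k%:R.
    exists (\max_j (Num.truncn `|v ord0 j|).+1)%N => j.
    apply: le_lt_trans (ler_norm _) _.
    apply: lt_le_trans (truncnS_gt _) _.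
    by rewrite ler_nat (leq_bigmax j).
  by exists k => // j; rewrite mxE; case: eqP => [->|].
by rewrite mxE eqxx /= in_itv.
Qed.

Section fourier_injective.
Context (R : realType) (n : nat).
Local Notation mu := (@lebesgue_rV R n).
Local Notation L := (borel_lebesgue R n).
Variable f : Rn R n -> R.
Hypothesis intf : mu.-integrable setT (fun x => (f x)%:E).
Hypothesis fcos : forall xi, \int[mu]_x (f x * cos (dot x xi)) = 0.
Hypothesis fsin : forall xi, \int[mu]_x (f x * sin (dot x xi)) = 0.

Let mf : measurable_fun setT f.
Proof. by apply/measurable_EFinP; exact: measurable_int intf. Qed.

Let integrable_cos xi : mu.-integrable setT (fun x => (f x * cos (dot x xi))%:E).
Proof.
under eq_fun do rewrite mulrC.
apply: (integrable_mul_le1 intf) => [|x]; last exact: cos_norm_le1.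
apply: measurableT_comp; first exact: continuous_measurable_fun (@continuous_cos R).
by apply: measurable_dot2; [exact: measurable_Rn_id|exact: measurable_cst].
Qed.

Let integrable_sin xi : mu.-integrable setT (fun x => (f x * sin (dot x xi))%:E).
Proof.
under eq_fun do rewrite mulrC.
apply: (integrable_mul_le1 intf) => [|x]; last exact: sin_norm_le1.
apply: measurableT_comp; first exact: continuous_measurable_fun (@continuous_sin R).
by apply: measurable_dot2; [exact: measurable_Rn_id|exact: measurable_cst].
Qed.

Let integrable_cos_shift a xi : mu.-integrable setT (fun x => (f x * cos (dot (a - x) xi))%:E).
Proof.
under eq_fun do rewrite mulrC.
apply: (integrable_mul_le1 intf) => [|x]; last exact: cos_norm_le1.
apply: measurableT_comp; first exact: continuous_measurable_fun (@continuous_cos R).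
apply: measurable_dot2; last exact: measurable_cst.
by apply: measurable_rV_affine; [exact: measurable_cst|exact: measurable_Rn_id].
Qed.

Let fourier_shift a xi : (\int[mu]_x (f x * cos (dot (a - x) xi))%:E = 0)%E.
Proof.
transitivity (\int[mu]_x ((cos (dot a xi))%:E * (f x * cos (dot x xi))%:E +
   (sin (dot a xi))%:E * (f x * sin (dot x xi))%:E))%E.
  apply: eq_integral => x _; rewrite -!EFinM -EFinD; congr EFin.
  by rewrite dotBl cosB; ring.
rewrite (integralD measurableT (integrableZl measurableT _ (integrable_cos xi)) (integrableZl measurableT _ (integrable_sin xi))).
rewrite (integralZl measurableT (integrable_cos xi)) (integralZl measurableT (integrable_sin xi)).
rewrite -(fineK (integrable_fin_num measurableT (integrable_cos xi))) (fcos xi : fine _ = _).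
rewrite -(fineK (integrable_fin_num measurableT (integrable_sin xi))) (fsin xi : fine _ = _).
by rewrite !mule0 adde0.
Qed.

(* The Gaussian is, up to a constant, its own Fourier transform, so by Fubini a
   vanishing Fourier transform makes all Gaussian averages of f vanish. *)
Let gaussian_conv0 (s : R) (a : 'rV[R]_n) : s != 0 ->
  (\int[mu]_x (f x * gaussian s (a - x))%:E = 0)%E.
Proof.
move=> s0; have si0 : s^-1 != 0 by rewrite invr_eq0.
pose F (z : Rn R n * 'rV[R]_n) := (cos (dot (a - z.1) z.2) * (f z.1 * gaussian s^-1 z.2))%:E.
have iF : (mu \x L)%E.-integrable setT F.
  apply: (integrable_mul_le1 (integrable_tensor intf (integrable_gaussian n s^-1))) => [|x]; last exact: cos_norm_le1.
  apply: measurableT_comp; first exact: continuous_measurable_fun (@continuous_cos R).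
  apply: measurable_dot2; last exact: measurable_snd.
  apply: measurable_rV_affine; first exact: measurable_cst.
  exact: (measurableT_comp (measurable_Rn_id (n := n)) measurable_fst).
have FE x : (\int[L]_y F (x, y) = (normal_peak s ^- n)%:E * (f x * gaussian s (a - x))%:E)%E.
  rewrite /F/=; transitivity (\int[L]_y ((f x)%:E * (cos (dot (a - x) y) * gaussian s^-1 y)%:E))%E.
    by apply: eq_integral => y _; rewrite -EFinM; congr EFin; ring.
  rewrite integralZl//; last exact: integrable_cos_gaussian.
  rewrite (gaussian_fourier _ si0).1 -!EFinM; congr EFin.
  rewrite gaussianE// mulrCA mulKf; last by rewrite expf_neq0// gt_eqF// normal_peak_gt0.
  by congr (_ * expR _); field.
have := Fubini iF; rewrite /=.
under eq_integral do rewrite FE.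
rewrite integralZl//; last first.
  apply: (@eq_integrable _ _ _ _ _ measurableT _ _ _ (integrableZl measurableT (normal_peak s ^+ n) (integrable_fubini_F iF))).
  move=> x _; rewrite /fubini_F FE -!EFinM mulrA mulfV ?mul1r//.
  by rewrite expf_neq0// gt_eqF// normal_peak_gt0.
under [in X in _ = X -> _]eq_integral => y _.
  rewrite (_ : (\int[mu]_x _)%E = 0%E); first over.
  transitivity (\int[mu]_x ((gaussian s^-1 y)%:E * (f x * cos (dot (a - x) y))%:E))%E.
    by apply: eq_integral => x _; rewrite -EFinM /F; congr EFin => /=; ring.
  by rewrite integralZl ?fourier_shift ?mule0//.
rewrite integral0 => /eqP; rewrite mule_eq0 eqe invr_eq0 gt_eqF/=; first by move/eqP.
by rewrite exprn_gt0// normal_peak_gt0.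
Qed.

Let orthant (b : 'rV[R]_n) : set 'rV[R]_n := [set v | forall i, v ord0 i < b ord0 i].

Let measurable_orthant b : measurable (orthant b).
Proof.
rewrite (_ : orthant b = [set v : 'rV[R]_n | forall i, `]-oo, b ord0 i[%classic (v ord0 i)]).
  exact: (rV_rect_measurable (A := fun i => `]-oo, b ord0 i[%classic)).
by apply/seteqP; split => v /= vb i; have := vb i; rewrite in_itv.
Qed.

(* The Gaussian mollification of the indicator of [orthant b]. *)
Let smooth_orthant (s : R) (b x : 'rV[R]_n) : R := \prod_i normal_tail s (x ord0 i - b ord0 i).

Let smooth_orthantE s b x : s != 0 ->
  (\int[L]_a (\1_(orthant b) a * gaussian s (a - x))%:E = (smooth_orthant s b x)%:E)%E.
Proof.
move=> s0.
have m1 : measurable_fun setT (fun a => (\1_(orthant b) a * gaussian s (a - x))%:E : \bar R).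
  apply/measurable_EFinP/measurable_funM; first exact: measurable_indic.
  apply: (measurableT_comp (@measurable_gaussian R n s)).
  by apply: measurable_rV_affine => //; exact: measurable_cst.
rewrite -(ge0_integral_rV_reflect x m1) => [|a]; last first.
  by rewrite lee_fin mulr_ge0// gaussian_ge0.
transitivity (\int[L]_a (\prod_i (\1_(`]x ord0 i - b ord0 i, +oo[%classic) (a ord0 i) *
    normal_pdf 0 s (a ord0 i)))%:E)%E.
  apply: eq_integral => a _; congr EFin; rewrite big_split/=; congr *%R; last first.
    by rewrite addrAC subrr add0r gaussian_opp.
  rewrite indicE.
  have [h|h] := pselect (orthant b (x - a)).
    rewrite mem_set// big1// => i _; rewrite indicE mem_set//= in_itv/= andbT.
    by have := h i; rewrite !mxE; lra.
  rewrite memNset//; have [i hi] : exists i, b ord0 i <= (x - a) ord0 i.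
    by apply/not_existsP => h'; apply: h => i; rewrite ltNge; apply/negP/h'.
  rewrite (bigD1 i)//= indicE memNset ?mul0r//= in_itv/= andbT; apply/negP; rewrite -leNgt.
  by move: hi; rewrite !mxE; lra.
rewrite (ge0_integral_rV_prod (h := fun i u => \1_(`]x ord0 i - b ord0 i, +oo[%classic) u * normal_pdf 0 s u)).
- by rewrite (eq_bigr _ (fun i _ => normal_tailE s (x ord0 i - b ord0 i))) prodEFin.
- by move=> i; apply: measurable_funM; [exact: measurable_indic|exact: measurable_normal_pdf].
- by move=> i u; rewrite mulr_ge0// normal_pdf_ge0.
Qed.

Let integral_gaussian_shift s x : s != 0 -> (\int[L]_a (gaussian s (a - x))%:E = 1)%E.
Proof.
move=> s0; rewrite -(integral_gaussian n s).
have mg : measurable_fun setT (fun a : 'rV[R]_n => (gaussian s a)%:E : \bar R).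
  by apply/measurable_EFinP; exact: measurable_gaussian.
rewrite -(ge0_integral_rV_reflect x mg) => [|a]; last by rewrite lee_fin gaussian_ge0.
by apply: eq_integral => a _; rewrite -(opprB x) gaussian_opp.
Qed.

Let integrable_orthant_gaussian s b x : s != 0 ->
  L.-integrable setT (fun a => (\1_(orthant b) a * gaussian s (a - x))%:E).
Proof.
move=> s0; have mg : measurable_fun setT (fun a : 'rV[R]_n => (gaussian s (a - x))%:E : \bar R).
  apply/measurable_EFinP; apply: (measurableT_comp (@measurable_gaussian R n s)).
  by apply: measurable_rV_affine => //; exact: measurable_cst.
apply: (@integrable_mul_le1 _ _ _ _ (\1_(orthant b))) => [||a].
- apply/integrableP; split => //.
  rewrite (_ : (\int[_]_y _)%E = 1%E) ?ltry// -(integral_gaussian_shift x s0).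
  by apply: eq_integral => a _; rewrite gee0_abs// lee_fin gaussian_ge0.
- exact: measurable_indic.
- by rewrite indicE; case: (_ \in _); rewrite ?normr1 ?normr0.
Qed.

Let integrable_mul_gaussian s a : s != 0 ->
  mu.-integrable setT (fun x => (f x * gaussian s (a - x))%:E).
Proof.
move=> s0.
have i1 : mu.-integrable setT (fun x => (expR (- (dot (a - x) (a - x) / (s ^+ 2 *+ 2))) * f x)%:E).
  apply: (integrable_mul_le1 intf) => [|x].
  - apply: measurableT_comp; first exact: continuous_measurable_fun (@continuous_expR R).
    apply: measurableT_comp; first exact: measurable_funN.
    apply: measurable_funM; last exact: measurable_cst.
    apply: measurable_dot2; (apply: measurable_rV_affine;
      [exact: measurable_cst|exact: measurable_Rn_id]).
  - rewrite ger0_norm ?expR_ge0// -expR0 ler_expR oppr_le0 divr_ge0 ?mulrn_wge0 ?sqr_ge0//.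
    by apply: sumr_ge0 => i _; rewrite -expr2 sqr_ge0.
have := integrableZl measurableT (normal_peak s ^+ n) i1; apply: eq_integrable => // x _.
by rewrite -EFinM; congr EFin; rewrite gaussianE//; ring.
Qed.

Let smooth_orthant_integral0 s b : s != 0 ->
  (\int[mu]_x (f x * smooth_orthant s b x)%:E = 0)%E.
Proof.
move=> s0.
pose F (z : Rn R n * 'rV[R]_n) := (\1_(orthant b) z.2 * (f z.1 * gaussian s (z.2 - z.1)))%:E.
have m1 : measurable_fun setT (fun z : Rn R n * 'rV[R]_n => f z.1 * gaussian s (z.2 - z.1)).
  apply: measurable_funM; first exact: (measurableT_comp mf measurable_fst).
  apply: (measurableT_comp (@measurable_gaussian R n s)).
  apply: measurable_rV_affine; first exact: measurable_snd.
  exact: (measurableT_comp (measurable_Rn_id (n := n)) measurable_fst).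
have iF : (mu \x L)%E.-integrable setT F.
  apply: (@integrable_mul_le1 _ _ _ _ (fun z => \1_(orthant b) z.2) (fun z => f z.1 * gaussian s (z.2 - z.1))).
  - apply/(integrable12ltyP mu L); first exact/measurable_EFinP.
    have /integrableP[_ if1] := intf; apply: le_lt_trans if1.
    apply: eqW_le; apply: eq_integral => x _.
    rewrite -[RHS]mule1 -(integral_gaussian_shift x s0) -ge0_integralZl//.
    + by apply: eq_integral => a _; rewrite EFinM abseM [in X in (_ * X)%E]gee0_abs// lee_fin gaussian_ge0.
    + apply/measurable_EFinP; apply: (measurableT_comp (@measurable_gaussian R n s)).
      by apply: measurable_rV_affine => //; exact: measurable_cst.
    + by move=> a _; rewrite lee_fin gaussian_ge0.
  - by apply: (measurableT_comp (measurable_indic (measurable_orthant b))); exact: measurable_snd.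
  - by move=> z; rewrite indicE; case: (_ \in _); rewrite ?normr1 ?normr0.
transitivity (\int[mu]_x \int[L]_y F (x, y))%E.
  apply: eq_integral => x _; rewrite /F/=.
  transitivity (\int[L]_a ((f x)%:E * (\1_(orthant b) a * gaussian s (a - x))%:E))%E.
    by rewrite integralZl ?smooth_orthantE//; exact: integrable_orthant_gaussian.
  by apply: eq_integral => a _; rewrite -EFinM; congr EFin; ring.
rewrite (Fubini iF) integral0_eq// => a _ /=.
transitivity (\int[mu]_x ((\1_(orthant b) a)%:E * (f x * gaussian s (a - x))%:E))%E => //.
by rewrite integralZl ?gaussian_conv0 ?mule0//; exact: integrable_mul_gaussian.
Qed.

Let cvg_smooth_orthant (b x : 'rV[R]_n) : (forall i, x ord0 i != b ord0 i) ->
  smooth_orthant k.+1%:R^-1 b x @[k --> \oo] --> (\1_(orthant b) x : R).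
Proof.
move=> xb.
have -> : \1_(orthant b) x = \prod_i (x ord0 i - b ord0 i < 0)%R%:R :> R.
  rewrite indicE; have [h|h] := pselect (orthant b x).
    by rewrite mem_set// big1// => i _; rewrite subr_lt0 h.
  rewrite memNset//; have [i hi] : exists i, b ord0 i <= x ord0 i.
    by apply/not_existsP => h'; apply: h => i; rewrite ltNge; apply/negP/h'.
  by rewrite (bigD1 i)//= subr_lt0 ltNge hi mul0r.
apply: cvg_prodr => i.
have [c c0 cP] := normal_tail_bound R.
set y := x ord0 i - b ord0 i; have y0 : y != 0 by rewrite subr_eq0.
apply/subr_cvg0; apply: (@cvg0_natinv _ _ (c / `|y|)) => k.
have k0 : k.+2%:R^-1 != 0 :> R by rewrite invr_eq0.
apply: le_trans (cP _ _ k0 y0) _.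
rewrite mulrAC ler_wpM2l ?divr_ge0// ger0_norm ?invr_ge0// lef_pV2 ?posrE// ler_nat//.
Qed.

Let ae_off_orthant_boundary (b : 'rV[R]_n) : {ae mu, forall x : 'rV[R]_n, forall i, x ord0 i != b ord0 i}.
Proof.
apply: filter_forall => i.
pose A j : set (measurableTypeR R) := if j == i then [set b ord0 i] else setT.
have mA j : measurable (A j) by rewrite /A; case: ifP.
exists [set v : 'rV[R]_n | forall j, A j (v ord0 j)]; split.
- exact: measurable_rV_Rn (rV_rect_measurable mA).
- rewrite [LHS](lebesgue_rVE (rV_rect_measurable mA)) borel_lebesgue_rect//.
  by rewrite (bigD1 i)//= /A eqxx lebesgue_measure_set1 mul0e.
- move=> x /= /negP; rewrite negbK => /eqP xi j; rewrite /A.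
  by have [->|] := eqVneq j i.
Qed.

Let orthant_integral0 b : (\int[mu]_x (f x * \1_(orthant b) x)%:E = 0)%E.
Proof.
pose F (k : nat) (x : Rn R n) := (f x * smooth_orthant k.+1%:R^-1 b x)%:E.
have so1 k x : `|smooth_orthant k.+1%:R^-1 b x| <= 1.
  rewrite normr_prod; apply: (@le_trans _ _ (\prod_(i < n) 1)); last by rewrite big1.
  apply: ler_prod => i _.
  by rewrite normr_ge0/= ger0_norm ?normal_tail_ge0// normal_tail_le1.
have mF k : measurable_fun setT (F k).
  apply/measurable_EFinP/measurable_funM; first exact: mf.
  rewrite (_ : smooth_orthant _ _ = fine \o (fun x => \int[L]_a (\1_(orthant b) a * gaussian k.+1%:R^-1 (a - x))%:E)%E); last first.
    by apply/funext => x; rewrite /= smooth_orthantE ?invr_eq0.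
  have mj : measurable_fun setT (fun z : 'rV[R]_n * 'rV[R]_n => (\1_(orthant b) z.2 * gaussian k.+1%:R^-1 (z.2 - z.1))%:E : \bar R).
    apply/measurable_EFinP/measurable_funM.
      exact: (measurableT_comp (measurable_indic (measurable_orthant b)) measurable_snd).
    apply: (measurableT_comp (@measurable_gaussian R n _)).
    by apply: measurable_rV_affine; [exact: measurable_snd|exact: measurable_fst].
  have := measurable_fun_fubini_tonelli_F (m2 := L) _ mj.
  rewrite /fubini_F/= => mi; apply: measurable_fun_Rn.
  apply: measurableT_comp => //; apply: mi => z.
  by rewrite lee_fin mulr_ge0// gaussian_ge0.
have mlim : measurable_fun setT (fun x : Rn R n => (f x * \1_(orthant b) x)%:E).
  apply/measurable_EFinP/measurable_funM; first exact: mf.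
  apply: measurable_indic; exact: measurable_rV_Rn.
have cF : {ae mu, forall x : Rn R n, [set: Rn R n] x -> F ^~ x @ \oo --> (f x * \1_(orthant b) x)%:E}.
  have [N [mN N0 sub]] := ae_off_orthant_boundary b.
  exists N; split => //; apply: subset_trans sub => x /= nx xb; apply: nx => _.
  apply: cvg_EFin; first by near=> k.
  by apply: cvgM; [exact: cvg_cst|exact: cvg_smooth_orthant].
have bF : {ae mu, forall (x : Rn R n) k, [set: Rn R n] x -> (`|F k x| <= (abse \o (EFin \o f)) x)%E}.
  by apply: aeW => x k _; rewrite /F lee_fin normrM ler_piMr.
have [_ _] := dominated_convergence measurableT mF mlim cF (integrable_abse intf) bF.
rewrite /= (_ : (fun k => \int[mu]_x F k x)%E = cst 0%E); last first.
  by apply/funext => k; rewrite smooth_orthant_integral0.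
by move=> cv; apply/esym; apply: (cvg_unique _ _ cv) => //; exact: cvg_cst.
Unshelve. all: by end_near. Qed.

Let borel_integral0 (B : set 'rV[R]_n) : measurable B -> (\int[mu]_(x in B) (f x)%:E = 0)%E.
Proof.
move=> mB0.
have intf1 : (\int[mu]_x (f x)%:E = 0%:E)%E.
  rewrite -(fcos 0) /Rintegral fineK; last exact: (integrable_fin_num measurableT (integrable_cos 0)).
  apply: eq_integral => x _; congr EFin.
  by rewrite /dot big1 ?cos0 ?mulr1// => i _; rewrite mxE mulr0.
have intfS (A : set 'rV[R]_n) : measurable A -> mu.-integrable A (EFin \o f).
  by move=> mA; apply: integrableS intf => //; exact: measurable_rV_Rn.
apply: (@dynkin_induction _ _ (range orthant) (fun A => (\int[mu]_(x in A) (f x)%:E = 0)%E)) => //.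
- exact: rV_orthant_generated.
- move=> _ _ [b _ <-] [c _ <-]; exists (\row_i Num.min (b ord0 i) (c ord0 i)) => //.
  apply/seteqP; split => v /= => [h|[h1 h2] i].
    by split => i; have := h i; rewrite mxE lt_min => /andP[].
  by rewrite mxE lt_min h1 h2.
- move=> _ [b _ <-]; rewrite -[RHS](orthant_integral0 b) integral_mkcond.
  apply: eq_integral => x _; rewrite patchE indicE; case: ifP; rewrite ?mulr1 ?mulr0//.
- move=> A mA A0; have mA' := measurable_rV_Rn mA.
  have mCA := measurable_rV_Rn (measurableC mA).
  have mfA : measurable_fun (A `|` ~` A : set (Rn R n)) (EFin \o f).
    by rewrite setUv; exact: measurable_int intf.
  have dA : [disjoint A & ~` A] by apply/disj_setPS; rewrite setICr.
  have := integral_setU mu mA' mCA mfA dA.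
  by rewrite setUv intf1 A0 add0e.
- move=> F mF tF F0.
  have mF' k := measurable_rV_Rn (mF k).
  rewrite (@integral_bigcup _ (Rn R n) R mu F (EFin \o f) tF mF' (intfS _ (bigcupT_measurable _ mF))).
  by rewrite eseries0.
- by rewrite -rV_orthant_generated.
Qed.

Lemma fourier_eq0_ae : {ae mu, forall x, f x = 0}.
Proof.
have := @integral_ae_eq _ _ _ mu setT measurableT (cst 0%E) (EFin \o f) intf (measurable_cst _).
move=> h; have [N [mN N0 sub]] : ae_eq mu setT (EFin \o f) (cst 0%E).
  apply: h => E _ mE; rewrite integral0.
  have [B [mB BE0 EB]] := lebesgue_rV_borel_cover mE.
  have mB' := measurable_rV_Rn mB.
  have intfB : mu.-integrable B (EFin \o f) by apply: integrableS intf.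
  rewrite -[RHS](borel_integral0 mB).
  have mBE : measurable (B `\` E : set (Rn R n)) by exact: measurableD.
  rewrite [RHS](negligible_integral mBE mB' intfB BE0); congr integral.
  by rewrite setDD setIidr.
exists N; split => //; apply: subset_trans sub => x /= nx h'; apply: nx.
by have [] := h' I.
Qed.

End fourier_injective.

(** * The Bessel kernel as a mixture of Gaussians *)

Lemma integral_powR (R : realType) (c u v : R) : c != 0 -> 0 < u -> u < v ->
  (\int[lebesgue_measure]_(x in `[u, v]) (x `^ (c - 1))%:E = ((v `^ c - u `^ c) / c)%:E)%E.
Proof.
move=> c0 u0 uv.
pose F (x : R) := c^-1 * x `^ c.
have dF (x : R) : 0 < x -> is_derive x 1 F (x `^ (c - 1)).
  move=> x0; rewrite /F; have := is_derive1_powR c x0 => d.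
  by apply: is_derive_eq; rewrite /GRing.scale/= mulKf.
have cF (x : R) : 0 < x -> {for x, continuous F}.
  move=> x0; apply: differentiable_continuous; apply/derivable1_diffP; by case: (dF x x0).
rewrite (@continuous_FTC2 _ _ F)//.
- by rewrite /F -EFinB -mulrBr mulrC.
- apply: derivable_within_continuous => x; rewrite in_itv/= => /andP[ux _].
  by case: (is_derive1_powR (c - 1) (lt_le_trans u0 ux)).
- split=> [x||].
  + by rewrite in_itv/= => /andP[ux _]; case: (dF x (lt_trans u0 ux)).
  + exact: cvg_at_right_filter (cF u u0).
  + exact: cvg_at_left_filter (cF v (lt_trans u0 uv)).
- move=> x; rewrite in_itv/= => /andP[ux _]; rewrite derive1E.
  by have := dF x (lt_trans u0 ux) => ?; exact: derive_val.
Qed.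

Lemma measurable_powR_EFin (R : realType) (c : R) (D : set (measurableTypeR R)) : measurable_fun D (fun x => (x `^ c)%:E : \bar R).
Proof. by apply/measurable_EFinP; exact: measurable_funTS (measurable_powR c). Qed.

Lemma ge0_integral_nondecreasing_bigcup_le d (T : measurableType d) (R : realType)
    (mu : {measure set T -> \bar R}) (F : (set T)^nat) (f : T -> \bar R) (b : \bar R) :
  {homo F : n m / (n <= m)%N >-> n `<=` m} -> (forall i, measurable (F i)) ->
  measurable_fun setT f -> (forall x, 0 <= f x)%E ->
  (forall i, \int[mu]_(x in F i) f x <= b)%E -> (\int[mu]_(x in \bigcup_i F i) f x <= b)%E.
Proof.
move=> ndF mF mf f0 Fb.
have ndF' : {homo F : n m / (n <= m)%N >-> (n <= m)%O}.
  by move=> i j ij; apply/subsetPset; exact: ndF.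
have mfi i : measurable_fun (F i) f by exact: measurable_funTS.
apply: cvge_le (ge0_nondecreasing_set_cvg_integral ndF' mF mfi (fun _ x _ => f0 x)).
by near=> i.
Unshelve. all: by end_near. Qed.

Lemma integral_powR0 (R : realType) (a t : R) : 0 < a -> 0 < t ->
  (\int[lebesgue_measure]_(x in `]0%R, t]) (x `^ (a - 1))%:E <= (t `^ a / a)%:E)%E.
Proof.
move=> a0 t0.
pose F (i : nat) : set (measurableTypeR R) := `[t / i.+2%:R, t]%classic.
have FU : `]0%R, t]%classic = \bigcup_i F i.
  apply/seteqP; split => x /=; rewrite ?in_itv/=.
    move=> /andP[x0 xt].
    have [k kP] : exists k : nat, t / x < k%:R.
      exists (Num.truncn `|t / x|).+1; exact: le_lt_trans (ler_norm _) (truncnS_gt _).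
    exists k => //=; rewrite /F/= in_itv/= xt andbT.
    rewrite ler_pdivrMr// mulrC -ler_pdivrMr//; apply: ltW; apply: lt_le_trans kP _.
    by rewrite ler_nat (leq_trans (leqnSn k))// leqnSn.
  move=> [k _]; rewrite /F/= in_itv/= => /andP[h ->]; rewrite andbT.
  by apply: lt_le_trans h; rewrite divr_gt0.
rewrite FU; apply: ge0_integral_nondecreasing_bigcup_le => [i j ij x|i||x|i].
- rewrite /F/= !in_itv/= => /andP[h ->]; rewrite andbT; apply: le_trans h.
  by rewrite ler_pM2l// lef_pV2 ?posrE// ler_nat !ltnS.
- exact: measurable_itv.
- exact: measurable_powR_EFin.
- by rewrite lee_fin powR_ge0.
- rewrite integral_powR ?gt_eqF ?divr_gt0//; last by rewrite ltr_pdivrMr// ltr_pMr// ltr1n.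
  by rewrite lee_fin ler_pM2r ?invr_gt0// gerBl powR_ge0.
Qed.

Lemma integral_powRy (R : realType) (b t : R) : 0 < b -> 0 < t ->
  (\int[lebesgue_measure]_(x in `[t, +oo[) (x `^ (- b - 1))%:E <= (t `^ (- b) / b)%:E)%E.
Proof.
move=> b0 t0.
pose F (i : nat) : set (measurableTypeR R) := `[t, t + i.+1%:R]%classic.
have FU : `[t, +oo[%classic = \bigcup_i F i.
  apply/seteqP; split => x /=; rewrite ?in_itv/= ?andbT.
    move=> tx; exists (Num.truncn x) => //; rewrite /F/= in_itv/= tx/=.
    rewrite (le_trans (ltW (truncnS_gt x)))// lerDr ltW//.
  by move=> [k _]; rewrite /F/= in_itv/= => /andP[].
rewrite FU; apply: ge0_integral_nondecreasing_bigcup_le => [i j ij x|i||x|i].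
- rewrite /F/= !in_itv/= => /andP[-> h] /=; apply: le_trans h _.
  by rewrite lerD2l ler_nat ltnS.
- exact: measurable_itv.
- exact: measurable_powR_EFin.
- by rewrite lee_fin powR_ge0.
- rewrite integral_powR ?oppr_eq0 ?gt_eqF//; last by rewrite ltrDl.
  rewrite lee_fin invrN mulrN -mulNr opprB ler_pM2r ?invr_gt0// gerBl powR_ge0//.
Qed.

Lemma expR_gt_powR (R : realType) (m c : R) : 0 <= m -> 0 < c ->
  exists2 C : R, 0 < C & forall x, 0 < x -> x `^ m * expR (- (c * x)) <= C.
Proof.
move=> m0 c0.
pose N := (Num.truncn m).+1.
exists (1 + N`!%:R / c ^+ N); first by rewrite ltr_wpDr// divr_ge0// exprn_ge0// ltW.
move=> x x0.
have mN : m <= N%:R by rewrite ltW// truncnS_gt.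
have xm : x `^ m <= 1 + x ^+ N.
  have [x1|x1] := leP x 1.
    apply: (@le_trans _ _ 1); last by rewrite lerDl exprn_ge0// ltW.
    by rewrite -[leRHS](powRr0 x); apply: ger_powR; rewrite ?x0.
  apply: (@le_trans _ _ (x ^+ N)); last by rewrite lerDr.
  by rewrite -(powR_mulrn _ (ltW x0)); apply: ler_powR => //; exact: ltW.
apply: (@le_trans _ _ ((1 + x ^+ N) * expR (- (c * x)))); first by rewrite ler_wpM2r ?expR_ge0.
rewrite mulrDl mul1r; apply: lerD.
  by rewrite -expR0 ler_expR oppr_le0 mulr_ge0// ltW.
have cx0 : 0 <= c * x by rewrite mulr_ge0// ltW.
have f0 : 0 < N`!%:R :> R by rewrite ltr0n fact_gt0.
have cN : 0 < c ^+ N by rewrite exprn_gt0.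
rewrite expRN ler_pdivrMr ?expR_gt0//.
rewrite mulrAC ler_pdivlMr// mulrC -exprMn -ler_pdivrMl// mulrC.
by apply: le_trans (expR_ge1Dxn (Num.truncn m) cx0); rewrite lerDr.
Qed.

Lemma ge0_integral_scale1 (R : realType) (c : R) (F : R -> \bar R) : 0 < c ->
  measurable_fun setT F -> (forall x, 0 <= F x)%E ->
  (\int[lebesgue_measure]_x F x = c%:E * \int[lebesgue_measure]_x F (c * x)%R)%E.
Proof.
move=> c0 mF F0.
have mr : measurable_fun [set: measurableTypeR R] (fun x : measurableTypeR R => c * x : measurableTypeR R).
  exact: measurable_funM.
have := @ge0_integral_pushforward _ _ _ _ R _ mr lebesgue_measure setT F
  measurableT mF (fun x _ => F0 x).
rewrite preimage_setT => <-.
pose nu := measure_function_pushforward__canonical__measure_function_Measure lebesgue_measure mr.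
pose c' := NngNum (ltW c0).
transitivity (\int[mscale c' nu]_x F x)%E; last first.
  by rewrite ge0_integral_mscale.
apply: (@eq_measure_integral _ _ _ setT (mscale c' nu) lebesgue_measure) => A mA _.
apply: (@lebesgue_measure_unique R (mscale c' nu)) => // _ [[a b]] _ <-.
transitivity (c%:E * lebesgue_measure ((fun x : R => (c * x)%R) @^-1` `]a, b]))%E => //=.
rewrite (_ : _ @^-1` _ = `]a / c, b / c]%classic); last first.
  by apply/seteqP; split => x /=; rewrite !in_itv/= ltr_pdivrMr// ler_pdivlMr// (mulrC x).
rewrite !lebesgue_measure_itv/= !lte_fin -!EFinB ltr_pM2r ?invr_gt0//.
case: ifP => // _; last by rewrite mule0.
by rewrite -EFinM; congr EFin; field; rewrite gt_eqF.
Qed.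

(* Up to normalization, the density in s of the mixture of centred Gaussians of
   standard deviation s that makes up the Bessel kernel: integrating
   exp(- s^2 u / 2) against it for k = 1 gives a multiple of (1 + u)^(-a/2). *)
Definition bessel_weight (R : realType) (a k s : R) : R :=
  \1_(`]0, +oo[%classic) s * (s `^ (a - 1) * expR (- (k * s ^+ 2 / 2))).
Lemma bessel_weight_ge0 (R : realType) (a k s : R) : 0 <= bessel_weight a k s.
Proof. by rewrite !mulr_ge0// ?powR_ge0 ?expR_ge0. Qed.

Lemma bessel_weightE (R : realType) (a k s : R) : 0 < s ->
  bessel_weight a k s = s `^ (a - 1) * expR (- (k * s ^+ 2 / 2)).
Proof. by move=> s0; rewrite /bessel_weight indicE mem_set ?mul1r//= in_itv/= s0. Qed.

Lemma bessel_weight_le0 (R : realType) (a k s : R) : s <= 0 -> bessel_weight a k s = 0.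
Proof.
by move=> s0; rewrite /bessel_weight indicE memNset ?mul0r//= in_itv/= andbT; apply/negP; rewrite -leNgt.
Qed.

Lemma measurable_bessel_weight (R : realType) (a k : R) :
  measurable_fun [set: measurableTypeR R] (bessel_weight a k).
Proof.
apply: measurable_funM; first exact: measurable_indic.
apply: measurable_funM; first exact: measurable_powR.
apply: continuous_measurable_fun => x.
apply: (continuous_comp (f := fun s : R => - (k * s ^+ 2 / 2)) (g := expR)); last exact: continuous_expR.
apply: cvgN; apply: cvgM; last exact: cvg_cst.
by apply: cvgM; [exact: cvg_cst|exact: sqr_continuous].
Qed.

Lemma powR_gaussian_bound (R : realType) (m c : R) : 0 <= m -> 0 < c ->
  exists2 C : R, 0 < C & forall s, 0 < s -> s `^ m * expR (- (c * s ^+ 2)) <= C.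
Proof.
move=> m0 c0; have [C C0 CP] := @expR_gt_powR R (m / 2) c (divr_ge0 m0 (ler0n R 2)) c0.
exists C => // s s0; apply: le_trans (CP (s ^+ 2) _); last by rewrite exprn_gt0.
suff -> : (s ^+ 2) `^ (m / 2) = s `^ m by [].
by rewrite -(powR_mulrn 2 (ltW s0)) -powRrM; congr (_ `^ _); field.
Qed.

Lemma powRN_gaussian_bound (R : realType) (m c : R) : 0 <= m -> 0 < c ->
  exists2 C : R, 0 < C & forall s, 0 < s -> s `^ (- m) * expR (- (c / s ^+ 2)) <= C.
Proof.
move=> m0 c0; have [C C0 CP] := powR_gaussian_bound m0 c0.
exists C => // s s0; apply: le_trans (CP s^-1 _); last by rewrite invr_gt0.
rewrite exprVn; suff -> : s^-1 `^ m = s `^ (- m) by [].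
by rewrite -(powR_inv1 (ltW s0)) -powRrM mulN1r.
Qed.

Lemma bessel_weight_le_powR (R : realType) (a' a k : R) : a' <= a -> 0 < k ->
  exists2 C : R, 0 < C & forall s, 0 < s -> bessel_weight a k s <= C * s `^ (a' - 1).
Proof.
move=> aa k0.
have [C C0 CP] := @powR_gaussian_bound R (a - a') (k / 2) ltac:(lra) ltac:(lra).
exists C => // s s0; rewrite bessel_weightE//.
have -> : s `^ (a - 1) = s `^ (a - a') * s `^ (a' - 1).
  by rewrite -powRD; [congr (_ `^ _); ring|rewrite (gt_eqF s0) implybT].
rewrite mulrAC ler_wpM2r ?powR_ge0//.
by have := CP s s0; rewrite (_ : k / 2 * s ^+ 2 = k * s ^+ 2 / 2)//; ring.
Qed.

Definition bessel_mass (R : realType) (a k : R) : \bar R :=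
  (\int[lebesgue_measure]_s (bessel_weight a k s)%:E)%E.
Lemma setT_pos_split (R : realType) (t : R) (f : R -> \bar R) : 0 < t ->
  measurable_fun [set: measurableTypeR R] f -> (forall s, 0 <= f s)%E -> (forall s, (s <= 0)%R -> f s = 0)%E ->
  (\int[lebesgue_measure]_s f s = \int[lebesgue_measure]_(s in `]0%R, t]) f s +
    \int[lebesgue_measure]_(s in `]t, +oo[) f s)%E.
Proof.
move=> t0 mf f0 fN.
rewrite -ge0_integral_setU//=.
- rewrite [RHS]integral_mkcond; apply: eq_integral => s _; rewrite patchE.
  case: ifPn => // /negP h; apply: fN; rewrite leNgt; apply/negP => s0; apply: h.
  rewrite inE/= !in_itv/= s0 /= andbT; by case: leP; [left|right].
- exact: measurable_funTS.
- apply/disj_setPS => s /=; rewrite !in_itv/= => -[/andP[_ h1] /andP[h2 _]].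
  by move: h2; rewrite ltNge h1.
Qed.

Lemma bessel_mass_lty (R : realType) (a k : R) : 0 < a -> 0 < k -> (bessel_mass a k < +oo)%E.
Proof.
move=> a0 k0.
have mw : measurable_fun [set: measurableTypeR R] (fun s => (bessel_weight a k s)%:E).
  by apply/measurable_EFinP; exact: measurable_bessel_weight.
rewrite /bessel_mass (setT_pos_split ltr01 mw); first last.
- by move=> s s0; rewrite bessel_weight_le0.
- by move=> s; rewrite lee_fin bessel_weight_ge0.
apply: lte_add_pinfty.
- have [C C0 CP] := bessel_weight_le_powR (lexx a) k0.
  apply: (@le_lt_trans _ _ (\int[lebesgue_measure]_(s in `]0%R, 1%R]) (C%:E * (s `^ (a - 1))%:E))%E).
    apply: ge0_le_integral => //=.
    + by move=> s _; rewrite lee_fin bessel_weight_ge0.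
    + exact: measurable_funTS.
    + by apply: measurable_funeM; exact: measurable_powR_EFin.
    + by move=> s; rewrite in_itv/= => /andP[s0 _]; rewrite -EFinM lee_fin CP.
  rewrite ge0_integralZl//=; last 3 first.
  - exact: measurable_powR_EFin.
  - by move=> s _; rewrite lee_fin powR_ge0.
  - by rewrite lee_fin ltW.
  by apply: lte_mul_pinfty; [rewrite lee_fin ltW|by []|apply: le_lt_trans (integral_powR0 a0 ltr01) _; rewrite ltry].
- have [C C0 CP] := @bessel_weight_le_powR R (- 1) a k ltac:(lra) k0.
  apply: (@le_lt_trans _ _ (\int[lebesgue_measure]_(s in `[1%R, +oo[) (C%:E * (s `^ (- 1 - 1))%:E))%E).
    rewrite -integral_itv_obnd_cbnd; last first.
      by apply: measurable_funeM; exact: measurable_powR_EFin.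
    apply: ge0_le_integral => //=.
    + by move=> s _; rewrite lee_fin bessel_weight_ge0.
    + exact: measurable_funTS.
    + by apply: measurable_funeM; exact: measurable_powR_EFin.
    + move=> s; rewrite in_itv/= andbT => s1; rewrite -EFinM lee_fin CP//.
      exact: lt_trans s1.
  rewrite ge0_integralZl//=; last 3 first.
  - exact: measurable_powR_EFin.
  - by move=> s _; rewrite lee_fin powR_ge0.
  - by rewrite lee_fin ltW.
  by apply: lte_mul_pinfty; [rewrite lee_fin ltW|by []|apply: le_lt_trans (integral_powRy ltr01 ltr01) _; rewrite ltry].
Qed.

Lemma bessel_mass_scale (R : realType) (a k : R) : 0 < a -> 0 < k ->
  (bessel_mass a k = (k `^ (- (a / 2)))%:E * bessel_mass a 1)%E.
Proof.
move=> a0 k0.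
have mw l : measurable_fun [set: measurableTypeR R] (fun s => (bessel_weight a l s)%:E).
  by apply/measurable_EFinP; exact: measurable_bessel_weight.
have w0 l s : (0 <= (bessel_weight a l s)%:E)%E by rewrite lee_fin bessel_weight_ge0.
have c0 : 0 < Num.sqrt k by rewrite sqrtr_gt0.
rewrite /bessel_mass (ge0_integral_scale1 c0 (mw 1) (w0 1)) -[LHS]mul1e.
have -> : (\int[lebesgue_measure]_s (bessel_weight a 1 (Num.sqrt k * s))%:E =
   (Num.sqrt k `^ (a - 1))%:E * \int[lebesgue_measure]_s (bessel_weight a k s)%:E)%E.
  rewrite -ge0_integralZl//.
  apply: eq_integral => s _; rewrite -EFinM; congr EFin.
  have [s0|s0] := ltP 0 s; last first.
    by rewrite !bessel_weight_le0 ?mulr0// pmulr_rle0.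
  rewrite !bessel_weightE ?mulr_gt0// powRM ?ltW// exprMn sqr_sqrtr ?ltW//.
  by rewrite mul1r -mulrA.
rewrite !muleA -!EFinM; congr (_%:E * _)%E.
rewrite -mulrA (mulr_powRB1 (ltW c0) a0) -powR12_sqrt ?ltW// -powRrM.
rewrite -powRD; last by rewrite (gt_eqF k0) implybT.
by rewrite (_ : _ + _ = 0) ?powRr0//; ring.
Qed.

Lemma bessel_weight_ge12 (R : realType) (a k s : R) : 0 < a -> 0 <= k -> 1 <= s <= 2 ->
  2^-1 * expR (- (2 * k)) <= bessel_weight a k s.
Proof.
move=> a0 k0 /andP[s1 s2]; have s0 : 0 < s by exact: lt_le_trans s1.
rewrite bessel_weightE//; apply: ler_pM; rewrite ?invr_ge0 ?expR_ge0//.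
- apply: (@le_trans _ _ (s `^ a / s)).
    apply: (@le_trans _ _ s^-1); first by rewrite lef_pV2 ?posrE.
    apply: ler_peMl; first by rewrite invr_ge0 ltW.
    by rewrite -[leLHS](powRr0 s); exact: ler_powR (ltW a0).
  by rewrite -(powR_inv1 (ltW s0)) -powRD// (gt_eqF s0) implybT.
- rewrite ler_expR lerN2.
  have : s ^+ 2 <= 2 ^+ 2 by rewrite lerXn2r// nnegrE ltW.
  by nra.
Qed.

Lemma bessel_mass_gt0 (R : realType) (a k : R) : 0 < a -> 0 <= k -> (0 < bessel_mass a k)%E.
Proof.
move=> a0 k0.
have mw : measurable_fun [set: measurableTypeR R] (fun s => (bessel_weight a k s)%:E).
  by apply/measurable_EFinP; exact: measurable_bessel_weight.
pose c := 2^-1 * expR (- (2 * k)).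
have c0 : 0 < c by rewrite mulr_gt0// expR_gt0.
apply: (@lt_le_trans _ _ (\int[lebesgue_measure]_(s in `[1%R, 2%R]) c%:E)%E).
  rewrite integral_cst//= lebesgue_measure_itv/= lte_fin ltr1n -EFinB -EFinM lte_fin.
  by rewrite mulr_gt0// subr_gt0 ltr1n.
apply: (@le_trans _ _ (\int[lebesgue_measure]_(s in `[1%R, 2%R]) (bessel_weight a k s)%:E)%E).
  apply: ge0_le_integral => //=.
  - by move=> s _; rewrite lee_fin ltW.
  - exact: measurable_funTS.
  - by move=> s; rewrite in_itv/= => s12; rewrite lee_fin bessel_weight_ge12.
apply: ge0_subset_integral => //=.
by move=> s _; rewrite lee_fin bessel_weight_ge0.
Qed.

Lemma bessel_mass_fin_num (R : realType) (a k : R) : 0 < a -> 0 < k -> bessel_mass a k \is a fin_num.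
Proof.
move=> a0 k0; rewrite ge0_fin_numE ?bessel_mass_lty//; apply: ltW.
by apply: bessel_mass_gt0 => //; exact: ltW.
Qed.

Lemma integralZl_sign d (T : measurableType d) (R : realType) (mu : {measure set T -> \bar R})
    (c : R) (w : T -> R) : measurable_fun setT w -> (forall x, 0 <= w x) ->
  (\int[mu]_x (c * w x)%:E = c%:E * \int[mu]_x (w x)%:E)%E.
Proof.
move=> mw w0.
have mw' : measurable_fun setT (fun x => (w x)%:E : \bar R) by exact/measurable_EFinP.
have w0' x : (0 <= (w x)%:E :> \bar R)%E by rewrite lee_fin.
have [c0|c0] := leP 0 c.
  by rewrite -ge0_integralZl//; apply: eq_integral.
have nc0 : (0 <= (- c)%:E)%E by rewrite lee_fin oppr_ge0 ltW.
transitivity (- \int[mu]_x ((- c)%:E * (w x)%:E))%E.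
  rewrite -integral_ge0N; last by move=> x _; rewrite mule_ge0.
  by apply: eq_integral => x _; rewrite -EFinM -EFinN mulNr opprK.
by rewrite ge0_integralZl// EFinN mulNe oppeK.
Qed.

Lemma integral_Rn (R : realType) (n : nat) (F : 'rV[R]_n -> \bar R) :
  measurable_fun setT F -> (@lebesgue_rV R n).-integrable setT (F : Rn R n -> \bar R) ->
  (\int[@lebesgue_rV R n]_x F x = \int[borel_lebesgue R n]_x F x)%E.
Proof.
move=> mF iF.
have := @integral_pushforward _ _ _ _ R _ (measurable_Rn_id (n := n)) (@lebesgue_rV R n) setT F mF iF measurableT.
rewrite preimage_setT => <-.
apply: (@eq_measure_integral _ _ _ setT (borel_lebesgue R n)
  (measure_function_pushforward__canonical__measure_function_Measure (@lebesgue_rV R n)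
    (measurable_Rn_id (n := n)))) => A mA _.
exact: (lebesgue_rVE mA).
Qed.

Lemma integrable_EFin_fine d (T : measurableType d) (R : realType)
    (mu : {measure set T -> \bar R}) (f : T -> \bar R) :
  mu.-integrable setT f -> mu.-integrable setT (fun x => (fine (f x))%:E).
Proof.
move=> if_; have mf := measurable_int _ if_.
apply: (le_integrable measurableT _ _ if_).
  by apply/measurable_EFinP; apply: measurableT_comp.
by move=> x _; case: (f x) => [r||] //=; rewrite normr0 leey.
Qed.

Section bessel_density.
Context (R : realType) (n : nat) (a : R).
Hypothesis a0 : 0 < a.
Local Notation mu := (@lebesgue_rV R n).
Local Notation L := (borel_lebesgue R n).

Definition mixing_density (s : R) : R := bessel_weight a 1 s / fine (bessel_mass a 1).

Let mass_gt0 : 0 < fine (bessel_mass a 1).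
Proof. by rewrite fine_gt0// bessel_mass_gt0//= bessel_mass_lty. Qed.

Lemma mixing_density_ge0 s : 0 <= mixing_density s.
Proof. by rewrite divr_ge0 ?bessel_weight_ge0// ltW. Qed.

Lemma mixing_density_le0 s : s <= 0 -> mixing_density s = 0.
Proof. by move=> s0; rewrite /mixing_density bessel_weight_le0// mul0r. Qed.

Lemma measurable_mixing_density : measurable_fun [set: measurableTypeR R] mixing_density.
Proof.
by apply: measurable_funM; [exact: measurable_bessel_weight|exact: measurable_cst].
Qed.

Lemma integral_mixing_density_exp (u : R) : 0 <= u ->
  (\int[lebesgue_measure]_s (mixing_density s * expR (- (s ^+ 2 * u / 2)))%:E =
   ((1 + u) `^ (- a / 2))%:E)%E.
Proof.
move=> u0; have k0 : 0 < 1 + u by lra.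
have e s : mixing_density s * expR (- (s ^+ 2 * u / 2)) =
    (fine (bessel_mass a 1))^-1 * bessel_weight a (1 + u) s.
  rewrite /mixing_density mulrAC [RHS]mulrC; congr (_ / _).
  have [s0|s0] := ltP 0 s; last by rewrite !bessel_weight_le0// mul0r.
  by rewrite !bessel_weightE// -[LHS]mulrA -expRD; congr (_ * expR _); field.
under eq_integral do rewrite e.
rewrite integralZl_sign; [|exact: measurable_bessel_weight|exact: bessel_weight_ge0].
have := bessel_mass_scale a0 k0; rewrite {1}/bessel_mass => ->.
rewrite -[bessel_mass a 1]fineK ?bessel_mass_fin_num//= -!EFinM; congr EFin.
by rewrite mulrCA mulVf ?mulr1 ?gt_eqF// mulNr.
Qed.

Lemma integral_mixing_density : (\int[lebesgue_measure]_s (mixing_density s)%:E = 1)%E.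
Proof.
have := integral_mixing_density_exp (lexx 0); rewrite addr0 powR1 => <-.
by apply: eq_integral => s _; rewrite mulr0 mul0r oppr0 expR0 mulr1.
Qed.

Definition mixed_gaussian (z : measurableTypeR R * 'rV[R]_n) : R := mixing_density z.1 * gaussian z.1 z.2.

Lemma mixed_gaussian_ge0 z : 0 <= mixed_gaussian z.
Proof. by rewrite mulr_ge0 ?mixing_density_ge0// gaussian_ge0. Qed.

Lemma measurable_normal_peak : measurable_fun [set: measurableTypeR R] (@normal_peak R).
Proof.
rewrite (_ : normal_peak = fun s : R => (s ^+ 2 * pi *+ 2) `^ (- 2^-1)); last first.
  apply/funext => s; rewrite /normal_peak powRN powR12_sqrt//.
  by rewrite mulrn_wge0// mulr_ge0 ?sqr_ge0// pi_ge0.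
apply: (measurableT_comp (measurable_powR _)).
apply: continuous_measurable_fun => s.
rewrite (_ : (fun s : R => s ^+ 2 * pi *+ 2) = (fun s : R => s ^+ 2 * (pi *+ 2))).
  by apply: cvgM; [exact: sqr_continuous|exact: cvg_cst].
apply/funext => t; ring.
Qed.

Lemma measurable_mixed_gaussian : measurable_fun setT mixed_gaussian.
Proof.
rewrite (_ : mixed_gaussian = fun z => mixing_density z.1 * (normal_peak z.1 ^+ n *
    expR (- (dot z.2 z.2 * (z.1 ^+ 2 *+ 2) `^ (-1))))); last first.
  apply/funext => -[s x]; rewrite /mixed_gaussian/=.
  have [s0|s0] := ltP 0 s; last by rewrite mixing_density_le0// !mul0r.
  rewrite gaussianE ?gt_eqF// powR_inv1// mulrn_wge0// sqr_ge0//.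
apply: measurable_funM; first exact: (measurableT_comp measurable_mixing_density measurable_fst).
apply: measurable_funM.
  by apply: measurable_funX; exact: (measurableT_comp measurable_normal_peak measurable_fst).
apply: measurableT_comp; first exact: continuous_measurable_fun (@continuous_expR R).
apply: measurableT_comp; first exact: measurable_funN.
apply: measurable_funM; first by apply: measurable_dot2; exact: measurable_snd.
apply: (measurableT_comp (measurable_powR _)).
have m2 : measurable_fun setT (fun s : measurableTypeR R => s ^+ 2 *+ 2 : R).
  rewrite (_ : (fun s : R => s ^+ 2 *+ 2) = (fun s : R => s ^+ 2 * 2)).
    apply: continuous_measurable_fun => s.
    by apply: cvgM; [exact: sqr_continuous|exact: cvg_cst].
  by apply/funext => t; ring.
exact: (measurableT_comp m2 measurable_fst).
Qed.

Let mEmg : measurable_fun setT (EFin \o mixed_gaussian).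
Proof. by apply/measurable_EFinP; exact: measurable_mixed_gaussian. Qed.

Definition bessel_density (x : 'rV[R]_n) : \bar R :=
  (\int[lebesgue_measure]_s (mixed_gaussian (s, x))%:E)%E.

Lemma bessel_density_ge0 x : (0 <= bessel_density x)%E.
Proof. by apply: integral_ge0 => s _; rewrite lee_fin mixed_gaussian_ge0. Qed.

Lemma measurable_bessel_density : measurable_fun setT bessel_density.
Proof.
apply: (measurable_fun_fubini_tonelli_G (m1 := lebesgue_measure) (EFin \o mixed_gaussian)).
- exact: mEmg.
- by move=> z; rewrite lee_fin mixed_gaussian_ge0.
Qed.

Lemma integrable_mixed_gaussian :
  (lebesgue_measure \x L)%E.-integrable setT (EFin \o mixed_gaussian).
Proof.
have mm : measurable_fun setT (EFin \o mixed_gaussian).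
  exact: mEmg.
apply/(integrable12ltyP _ _ mm).
rewrite (_ : (\int[_]_s _)%E = 1%E) ?ltry// -integral_mixing_density.
apply: eq_integral => s _; rewrite -[RHS]mule1 -(integral_gaussian n s) -ge0_integralZl//.
- by apply: eq_integral => x _; rewrite gee0_abs ?lee_fin ?mixed_gaussian_ge0.
- by apply/measurable_EFinP; exact: measurable_gaussian.
- by move=> x _; rewrite lee_fin gaussian_ge0.
- by rewrite lee_fin mixing_density_ge0.
Qed.

Lemma integral_bessel_density : (\int[L]_x bessel_density x = 1)%E.
Proof.
rewrite /bessel_density -(fubini_tonelli (EFin \o mixed_gaussian)); last 2 first.
- exact: mEmg.
- by move=> z; rewrite lee_fin mixed_gaussian_ge0.
rewrite -integral_mixing_density; apply: eq_integral => s _ /=.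
rewrite -[RHS]mule1 -(integral_gaussian n s) -ge0_integralZl//.
- by apply/measurable_EFinP; exact: measurable_gaussian.
- by move=> x _; rewrite lee_fin gaussian_ge0.
- by rewrite lee_fin mixing_density_ge0.
Qed.

Lemma integrable_bessel_density : mu.-integrable setT (bessel_density : Rn R n -> \bar R).
Proof.
apply/integrableP; split; first exact: measurable_fun_Rn measurable_bessel_density.
rewrite (_ : (\int[_]_s _)%E = 1%E) ?ltry// -integral_bessel_density.
rewrite -ge0_integral_Rn; [|exact: measurable_bessel_density|exact: bessel_density_ge0].
by apply: eq_integral => x _; rewrite gee0_abs// bessel_density_ge0.
Qed.

Lemma bessel_density_fin_ae :
  {ae mu, forall x : 'rV[R]_n, (fine (bessel_density x))%:E = bessel_density x}.
Proof.
have [N [mN N0 sub]] := integrable_ae measurableT integrable_bessel_density.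
exists N; split => //; apply: subset_trans sub => x /= h h'; apply: h.
by rewrite fineK//; exact: h'.
Qed.

Let measurable_fine_bessel_density :
  measurable_fun setT (fun x : Rn R n => fine (bessel_density x)).
Proof. by apply: measurable_fun_Rn; apply: measurableT_comp => //; exact: measurable_bessel_density. Qed.

Let integrable_fine_bessel_density :
  mu.-integrable setT (fun x => (fine (bessel_density x))%:E).
Proof. exact: integrable_EFin_fine integrable_bessel_density. Qed.

Let integral_trig (T : R -> R) (u : R) (xi : 'rV[R]_n) :
    measurable_fun setT T -> (forall y, `|T y| <= 1) ->
    (forall s, s != 0 -> (\int[L]_x (T (dot xi x) * gaussian s x)%:E = (u * expR (- (s ^+ 2 * dot xi xi / 2)))%:E)%E) ->
  \int[mu]_x (fine (bessel_density x) * T (dot x xi)) = u * (1 + dot xi xi) `^ (- a / 2).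
Proof.
move=> mT T1 TE.
have mTd : measurable_fun setT (fun x : 'rV[R]_n => T (dot xi x)).
  by apply: measurableT_comp => //; exact: measurable_dot.
pose H (z : measurableTypeR R * 'rV[R]_n) := (T (dot xi z.2) * mixed_gaussian z)%:E.
have iH : (lebesgue_measure \x L)%E.-integrable setT H.
  apply: (integrable_mul_le1 integrable_mixed_gaussian) => [|z]; last exact: T1.
  exact: (measurableT_comp mTd measurable_snd).
have H1 x : (\int[lebesgue_measure]_s H (s, x) = (T (dot xi x))%:E * bessel_density x)%E.
  apply: (@integralZl_sign _ (measurableTypeR R) R lebesgue_measure (T (dot xi x)) (fun s => mixed_gaussian (s, x))).
  - exact: (measurableT_comp measurable_mixed_gaussian (pair2_measurable x)).
  - by move=> s; exact: mixed_gaussian_ge0.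
have mG2 : measurable_fun setT (fun x : 'rV[R]_n => ((T (dot xi x))%:E * bessel_density x)%E).
  apply: emeasurable_funM; last exact: measurable_bessel_density.
  exact/measurable_EFinP.
have dC (x : 'rV[R]_n) : dot x xi = dot xi x.
  by apply: eq_bigr => i _; rewrite mulrC.
suff h : (\int[mu]_x (fine (bessel_density x) * T (dot x xi))%:E = (u * (1 + dot xi xi) `^ (- a / 2))%:E)%E.
  by rewrite /Rintegral h.
transitivity (\int[mu]_x ((T (dot xi x))%:E * bessel_density x))%E.
  apply: ae_eq_integral; first exact: measurableT.
  - apply/measurable_EFinP; apply: measurable_funM; first exact: measurable_fine_bessel_density.
    under eq_fun do rewrite dC.
    exact: measurable_fun_Rn mTd.
  - exact: measurable_fun_Rn mG2.
  - have [N [mN N0 sub]] := bessel_density_fin_ae.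
    exists N; split => //; apply: subset_trans sub => x /= h h'; apply: h => _.
    by rewrite EFinM h' dC muleC.
transitivity (\int[L]_x ((T (dot xi x))%:E * bessel_density x))%E.
  apply: (integral_Rn mG2); apply: (le_integrable measurableT (measurable_fun_Rn mG2) _ integrable_bessel_density).
  move=> x _; rewrite abseM -[leRHS]mul1e lee_wpmul2r//.
  by rewrite lee_fin.
under eq_integral do rewrite -H1.
rewrite -(Fubini iH).
transitivity (\int[lebesgue_measure]_s (u * (mixing_density s * expR (- (s ^+ 2 * dot xi xi / 2))))%:E)%E.
  apply: eq_integral => s _; have [s0|s0] := ltP 0 s; last first.
    rewrite mixing_density_le0// mul0r mulr0 integral0_eq// => x _.
    by rewrite /H /mixed_gaussian/= mixing_density_le0// mul0r mulr0.
  transitivity (\int[L]_x ((mixing_density s)%:E * (T (dot xi x) * gaussian s x)%:E))%E.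
    by apply: eq_integral => x _; rewrite -EFinM /H /mixed_gaussian; congr EFin => /=; ring.
  rewrite integralZl//; last first.
    exact: (integrable_mul_le1 (integrable_gaussian n s) mTd (fun x => T1 _)).
  by rewrite TE ?gt_eqF// -EFinM; congr EFin; ring.
rewrite integralZl_sign.
- rewrite integral_mixing_density_exp//.
  by apply: sumr_ge0 => i _; rewrite -expr2 sqr_ge0.
- apply: measurable_funM; first exact: measurable_mixing_density.
  apply: continuous_measurable_fun => s.
  apply: (continuous_comp (f := fun s : R => - (s ^+ 2 * dot xi xi / 2)) (g := expR)); last exact: continuous_expR.
  apply: cvgN; apply: cvgM; last exact: cvg_cst.
  by apply: cvgM; [exact: sqr_continuous|exact: cvg_cst].
- by move=> s; rewrite mulr_ge0 ?expR_ge0// mixing_density_ge0.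
Qed.

Lemma bessel_density_cos xi :
  \int[mu]_x (fine (bessel_density x) * cos (dot x xi)) = (1 + dot xi xi) `^ (- a / 2).
Proof.
rewrite -[RHS]mul1r; apply: integral_trig => [||s s0].
- exact: continuous_measurable_fun (@continuous_cos R).
- exact: cos_norm_le1.
- by rewrite mul1r; exact: (gaussian_fourier xi s0).1.
Qed.

Lemma bessel_density_sin xi :
  \int[mu]_x (fine (bessel_density x) * sin (dot x xi)) = 0.
Proof.
rewrite -[RHS](mul0r ((1 + dot xi xi) `^ (- a / 2))); apply: integral_trig => [||s s0].
- exact: continuous_measurable_fun (@continuous_sin R).
- exact: sin_norm_le1.
- by rewrite mul0r; exact: (gaussian_fourier xi s0).2.
Qed.

Let enormE (xi : 'rV[R]_n) : enorm xi ^+ 2 = dot xi xi.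
Proof. by rewrite /enorm sqr_sqrtr//; apply: sumr_ge0 => i _; rewrite -expr2 sqr_ge0. Qed.

Lemma fourier_bessel_density xi :
  fourier (fun x => fine (bessel_density x)) xi = real_complex R ((1 + enorm xi ^+ 2) `^ (- a / 2)).
Proof. by rewrite /fourier bessel_density_cos bessel_density_sin enormE oppr0. Qed.

Lemma bessel_kernel_ae : {ae mu, forall x : 'rV[R]_n, (bessel_kernel a x)%:E = bessel_density x}.
Proof.
set g := @bessel_kernel R n a.
have [ig gE] : mu.-integrable setT (fun x => (g x)%:E) /\
    forall xi, fourier g xi = real_complex R ((1 + enorm xi ^+ 2) `^ (- a / 2)).
  rewrite /g /bessel_kernel /inverse_fourier; case: xgetP => [h _ //|/(_ (fun x => fine (bessel_density x)))].
  by case; split; [exact: integrable_fine_bessel_density|exact: fourier_bessel_density].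
have mg : measurable_fun setT (g : Rn R n -> R) by apply/measurable_EFinP; exact: measurable_int ig.
have iG := integrable_fine_bessel_density.
have mG := measurable_fine_bessel_density.
have bounded_trig (T : R -> R) (f : Rn R n -> R) (xi : 'rV[R]_n) : continuous T -> (forall y, `|T y| <= 1) ->
    mu.-integrable setT (fun x => (f x)%:E) ->
    mu.-integrable setT (fun x : Rn R n => (f x * T (dot x xi))%:E).
  move=> cT T1 if_; under eq_fun do rewrite mulrC.
  apply: (integrable_mul_le1 if_) => [|x]; last exact: T1.
  apply: (measurableT_comp (continuous_measurable_fun cT)).
  by apply: measurable_dot2; [exact: measurable_Rn_id|exact: measurable_cst].
have trig (T : R -> R) (xi : 'rV[R]_n) : continuous T -> (forall y, `|T y| <= 1) ->
    \int[mu]_x ((g x - fine (bessel_density x)) * T (dot x xi)) =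
    \int[mu]_x (g x * T (dot x xi)) - \int[mu]_x (fine (bessel_density x) * T (dot x xi)).
  move=> cT T1; rewrite -RintegralB.
  - by apply: eq_Rintegral => x _; rewrite mulrBl.
  - exact: measurableT.
  - exact: bounded_trig.
  - exact: (bounded_trig T (fun x => fine (bessel_density x))).
have if_ : mu.-integrable setT (fun x => (g x - fine (bessel_density x))%:E).
  under eq_fun do rewrite EFinB.
  exact: (integrableB measurableT ig iG).
have : {ae mu, forall x : Rn R n, g x - fine (bessel_density x) = 0}.
  apply: (fourier_eq0_ae if_) => xi; have [gc gs] := gE xi.
  - by rewrite (trig cos)//; [rewrite gc bessel_density_cos enormE subrr|exact: continuous_cos|exact: cos_norm_le1].
  - rewrite (trig sin)//; [|exact: continuous_sin|exact: sin_norm_le1].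
    by rewrite bessel_density_sin subr0 -[LHS]opprK gs oppr0.
move=> [N1 [mN1 N10 sub1]]; have [N2 [mN2 N20 sub2]] := bessel_density_fin_ae.
exists (N1 `|` N2); split.
- exact: measurableU.
- exact: (etrans (measureU0 mN1 mN2 N20) N10).
- move=> x /= nx; apply: contrapT => /not_orP[n1 n2]; apply: nx.
  have h1 : g x - fine (bessel_density x) = 0 by apply: contrapT => h; apply: n1; exact: sub1.
  have h2 : (fine (bessel_density x))%:E = bessel_density x by apply: contrapT => h; apply: n2; exact: sub2.
  by rewrite -h2; congr EFin; apply/eqP; rewrite -subr_eq0 h1.
Qed.

Lemma convolution_bessel (f : 'rV[R]_n -> \bar R) (x : 'rV[R]_n) : lebesgue_measurable f ->
  (convolution (bessel_kernel a) f x = \int[mu]_y (bessel_density (x - y) * f y))%E.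
Proof.
move=> mf; have gG := bessel_kernel_ae.
have mr : measurable_fun [set: Rn R n] (fun y : Rn R n => x - y : 'rV[R]_n).
  by apply: measurable_rV_affine; [exact: measurable_cst|exact: measurable_Rn_id].
have mGr : measurable_fun [set: Rn R n] (fun y : Rn R n => bessel_density (x - y)).
  exact: (measurableT_comp measurable_bessel_density mr).
have aeG := ae_lebesgue_reflect x gG.
have mgr : measurable_fun [set: Rn R n] (fun y : Rn R n => (bessel_kernel a (x - y))%:E).
  apply: (ae_measurable_fun_Rn mGr); have [N [mN N0 sub]] := aeG.
  by exists N; split => //; apply: subset_trans sub => y /= h h'; apply: h.
rewrite /convolution; apply: ae_eq_integral.
- exact: measurableT.
- exact: emeasurable_funM mgr mf.
- exact: emeasurable_funM mGr mf.
- have [N [mN N0 sub]] := aeG.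
  by exists N; split => //; apply: subset_trans sub => y /= h h'; apply: h => _; rewrite h'.
Qed.

End bessel_density.

(** * Bessel capacity *)

Lemma lee_poweR2 (R : realType) (r : R) (x y : \bar R) : 0 <= r -> (0 <= x)%E -> (x <= y)%E ->
  (x `^ r <= y `^ r)%E.
Proof.
move=> r0 x0 xy; apply: gt0_ler_poweR => //; rewrite in_itv/= leey andbT//.
exact: le_trans xy.
Qed.

(* Integrated against a weight and optimized over l, this gives Hoelder's inequality
   without the dual exponent. *)
Lemma lee_young_split (R : realType) (s l : R) (x : \bar R) : 1 < s -> 0 < l -> (0 <= x)%E ->
  (x <= l%:E + (l `^ (1 - s))%:E * x `^ s)%E.
Proof.
move=> s1 l0; case: x => [x||]// x0; last first.
  rewrite poweRyr; last by rewrite gt_eqF// (lt_trans _ s1).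
  by rewrite gt0_muley ?lte_fin ?powR_gt0// addey.
rewrite lee_fin in x0; rewrite poweR_EFin -EFinM -EFinD lee_fin.
have [xl|lx] := leP x l.
  by rewrite (le_trans xl)// lerDl mulr_ge0 ?powR_ge0.
have xp : 0 < x by exact: lt_trans lx.
apply: (@le_trans _ _ (l `^ (1 - s) * x `^ s)); last by rewrite lerDr ltW.
rewrite -(opprB s) powRN ler_pdivlMl ?powR_gt0// -(mulr_powRB1 (ltW xp) (lt_trans ltr01 s1)) mulrC.
rewrite ler_pM2l//; apply: ge0_ler_powR; rewrite ?nnegrE ?ltW//.
by rewrite subr_gt0.
Qed.

Lemma weighted_hoelder d (T : measurableType d) (R : realType) (mu : {measure set T -> \bar R})
    (s A : R) (k f : T -> \bar R) : 1 < s -> 0 < A ->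
  measurable_fun setT k -> (forall x, 0 <= k x)%E ->
  measurable_fun setT f -> (forall x, 0 <= f x)%E ->
  (\int[mu]_x k x <= A%:E)%E ->
  ((\int[mu]_x (k x * f x)) `^ s <= (2 `^ s * A `^ (s - 1))%:E * \int[mu]_x (k x * f x `^ s))%E.
Proof.
move=> s1 A0 mk k0 mf f0 kA.
have s0 : 0 < s by rewrite (lt_trans _ s1).
have mfs : measurable_fun setT (fun x => f x `^ s)%E by exact: (measurableT_comp (measurable_poweR s) mf).
have mkf : measurable_fun setT (fun x => k x * f x `^ s)%E by exact: emeasurable_funM.
set B := (\int[mu]_x (k x * f x `^ s))%E.
have B0 : (0 <= B)%E by apply: integral_ge0 => x _; rewrite mule_ge0// poweR_ge0.
have C0 : 0 < 2 `^ s * A `^ (s - 1) by rewrite mulr_gt0// powR_gt0.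
have kf0 : (0 <= \int[mu]_x (k x * f x))%E by apply: integral_ge0 => x _; rewrite mule_ge0.
have key l : 0 < l -> (\int[mu]_x (k x * f x) <= (l * A)%:E + (l `^ (1 - s))%:E * B)%E.
  move=> l0; have l0' : (0 <= l%:E)%E by rewrite lee_fin ltW.
  have p0 : (0 <= (l `^ (1 - s))%:E)%E by rewrite lee_fin powR_ge0.
  apply: (@le_trans _ _ (\int[mu]_x (l%:E * k x + (l `^ (1 - s))%:E * (k x * f x `^ s)))%E).
    apply: ge0_le_integral => //.
    - by move=> x _; rewrite mule_ge0.
    - exact: emeasurable_funM.
    - by apply: emeasurable_funD; exact: measurable_funeM.
    - move=> x _; rewrite (muleC l%:E) muleCA -ge0_muleDr ?mule_ge0 ?poweR_ge0//.
      by apply: lee_wpmul2l => //; exact: lee_young_split.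
  rewrite ge0_integralD//; first last.
  - exact: measurable_funeM.
  - by move=> x _; rewrite !mule_ge0 ?poweR_ge0.
  - exact: measurable_funeM.
  - by move=> x _; rewrite mule_ge0.
  rewrite !ge0_integralZl//; last by move=> x _; rewrite mule_ge0 ?poweR_ge0.
  by rewrite leeD2r// EFinM lee_wpmul2l.
case: (B) B0 key => [b||]// b0 key; last by rewrite gt0_muley ?lte_fin// leey.
rewrite lee_fin in b0.
have [b0'|b0'] := eqVneq b 0.
  have -> : (\int[mu]_x (k x * f x) = 0)%E.
    apply/eqP; rewrite eq_le kf0 andbT; apply/lee_addgt0Pr => e e0; rewrite add0e.
    have := key (e / A) (divr_gt0 e0 A0).
    by rewrite b0' mule0 adde0 divfK ?gt_eqF.
  by rewrite poweR0r ?gt_eqF// b0' mule0.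
have bp : 0 < b by rewrite lt0r b0' b0.
pose l := (b / A) `^ s^-1.
have l0 : 0 < l by rewrite powR_gt0// divr_gt0.
have ls : l `^ s = b / A by rewrite /l -powRrM mulVf ?gt_eqF// powRr1// divr_ge0 ?ltW.
have e1 : l `^ (1 - s) * b = l * A.
  have -> : b = l `^ s * A by rewrite ls divfK ?gt_eqF.
  rewrite mulrA -powRD; last by rewrite (gt_eqF l0) implybT.
  by rewrite (_ : 1 - s + s = 1) ?powRr1 ?ltW//; ring.
have := key l l0; rewrite -EFinM e1 -EFinD -mulr2n => h.
apply: (@le_trans _ _ ((l * A *+ 2)%:E `^ s)%E).
  by apply: lee_poweR2 => //; exact: ltW.
have [lw Aw] := (ltW l0, ltW A0).
rewrite poweR_EFin -EFinM lee_fin -mulr_natr powRM// ?mulr_ge0// powRM// ls.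
rewrite -(mulr_powRB1 Aw s0); apply: eqW_le; field.
by rewrite gt_eqF.
Qed.

Section bessel_capacity_theory.
Context (R : realType) (n : nat) (a s : R).
Hypothesis a0 : 0 < a.
Hypothesis s1 : 1 < s.
Local Notation mu := (@lebesgue_rV R n).
Local Notation L := (borel_lebesgue R n).
Local Notation G := (@bessel_density R n a).
Local Open Scope ereal_scope.

Let s0 : (0 < s)%R. Proof. exact: lt_trans s1. Qed.

Lemma Lnorm_poweR (f : Rn R n -> \bar R) : (forall x, 0 <= f x) ->
  'N[mu]_s%:E[f] `^ s = \int[mu]_x f x `^ s.
Proof.
move=> f0; rewrite poweR_Lnorm ?gt_eqF//; apply: eq_integral => x _.
by rewrite gee0_abs.
Qed.

Definition bessel_potential (f : 'rV[R]_n -> \bar R) (x : 'rV[R]_n) : \bar R :=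
  \int[mu]_y (G (x - y)%R * f y).

Definition bessel_admissible (E : set 'rV[R]_n) (f : 'rV[R]_n -> \bar R) : Prop :=
  [/\ lebesgue_measurable f, forall x, 0 <= f x & forall x, E x -> 1 <= bessel_potential f x].

Lemma capacity_ge0 (E : set 'rV[R]_n) : 0 <= capacity a s E.
Proof. by apply: le_ereal_inf_tmp => _ [f _ <-]; exact: poweR_ge0. Qed.

Lemma le_capacity (E E' : set 'rV[R]_n) : E `<=` E' -> capacity a s E <= capacity a s E'.
Proof.
move=> EE; apply: ereal_inf_le_tmp => _ [f [mf f0 fE] <-]; exists f => //.
by split=> // x Ex; apply: fE; exact: EE.
Qed.

Lemma capacity_set0 : capacity a s (set0 : set 'rV[R]_n) = 0.
Proof.
apply/eqP; rewrite eq_le capacity_ge0 andbT; apply: ereal_inf_lbound.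
exists (fun=> 0); first by split=> //; exact: measurable_cst.
by rewrite Lnorm_poweR// integral0_eq// => x _; rewrite poweR0r// gt_eqF.
Qed.

Lemma capacity_bessel (E : set 'rV[R]_n) :
  capacity a s E = ereal_inf [set \int[mu]_x f x `^ s | f in bessel_admissible E].
Proof.
congr ereal_inf; apply/seteqP; split => _ [f [mf f0 fE] <-].
- exists f; last by rewrite Lnorm_poweR.
  by split => // x Ex; rewrite /bessel_potential -(convolution_bessel a0 x mf); exact: fE.
- exists f; last by rewrite Lnorm_poweR.
  by split => // x Ex; rewrite (convolution_bessel a0 x mf); exact: fE.
Qed.

Lemma capacity_le_admissible (E : set 'rV[R]_n) f : bessel_admissible E f ->
  capacity a s E <= \int[mu]_x f x `^ s.
Proof. by move=> Ef; rewrite capacity_bessel; apply: ereal_inf_lbound; exists f. Qed.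

Definition partial_density (D : set (measurableTypeR R)) (x : 'rV[R]_n) : \bar R :=
  \int[lebesgue_measure]_(t in D) (mixed_gaussian a (t, x))%:E.

Lemma partial_density_ge0 D x : 0 <= partial_density D x.
Proof. by apply: integral_ge0 => t _; rewrite lee_fin mixed_gaussian_ge0. Qed.

Let mEmg : measurable_fun setT (fun z : measurableTypeR R * 'rV[R]_n => (mixed_gaussian a z)%:E).
Proof. by apply/measurable_EFinP; exact: measurable_mixed_gaussian. Qed.

Let mDmg (D : set (measurableTypeR R)) : measurable D ->
  measurable_fun setT (fun z : measurableTypeR R * 'rV[R]_n => (\1_D z.1 * mixed_gaussian a z)%:E).
Proof.
move=> mD; apply/measurable_EFinP; apply: measurable_funM; last exact: measurable_mixed_gaussian.
exact: (measurableT_comp (measurable_indic mD) measurable_fst).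
Qed.

Let partial_densityE D x :
  partial_density D x = \int[lebesgue_measure]_t (\1_D t * mixed_gaussian a (t, x))%:E.
Proof.
rewrite /partial_density integral_mkcond; apply: eq_integral => t _.
by rewrite patchE indicE; case: (_ \in _); rewrite ?mul1r ?mul0r.
Qed.

Lemma measurable_partial_density D : measurable D -> measurable_fun setT (partial_density D).
Proof.
move=> mD; rewrite (_ : partial_density D = fun x => \int[lebesgue_measure]_t (\1_D t * mixed_gaussian a (t, x))%:E).
  apply: (measurable_fun_fubini_tonelli_G (m1 := lebesgue_measure) _ (mDmg mD)) => z.
  by rewrite lee_fin mulr_ge0// mixed_gaussian_ge0.
by apply/funext => x; exact: partial_densityE.
Qed.

Lemma bessel_density_split (t : R) x : (0 < t)%R ->
  G x = partial_density `]0%R, t]%classic x + partial_density `]t, +oo[%classic x.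
Proof.
move=> t0; rewrite /bessel_density (setT_pos_split t0)//.
- exact: (measurableT_comp mEmg (pair2_measurable x)).
- by move=> u; rewrite lee_fin mixed_gaussian_ge0.
- by move=> u u0; rewrite /mixed_gaussian/= mixing_density_le0 ?mul0r.
Qed.

Lemma integral_partial_density D (x : 'rV[R]_n) : measurable D ->
  \int[mu]_y partial_density D (x - y)%R = \int[lebesgue_measure]_(t in D) (mixing_density a t)%:E.
Proof.
move=> mD.
rewrite (ge0_integral_Rn_reflect x (measurable_partial_density mD)) => [|y]; last exact: partial_density_ge0.
rewrite ge0_integral_Rn; [|exact: measurable_partial_density|by move=> y; exact: partial_density_ge0].
under eq_integral do rewrite partial_densityE.
rewrite -(@fubini_tonelli _ _ _ _ _ lebesgue_measure L (fun z => (\1_D z.1 * mixed_gaussian a z)%:E) (mDmg mD)); last first.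
  by move=> z; rewrite lee_fin mulr_ge0// mixed_gaussian_ge0.
rewrite [RHS]integral_mkcond; apply: eq_integral => t _.
transitivity (\int[L]_y ((\1_D t * mixing_density a t)%:E * (gaussian t y)%:E)).
  by apply: eq_integral => y _; rewrite -EFinM /mixed_gaussian mulrA.
rewrite ge0_integralZl//; last 3 first.
- by apply/measurable_EFinP; exact: measurable_gaussian.
- by move=> y _; rewrite lee_fin gaussian_ge0.
- by rewrite lee_fin mulr_ge0// mixing_density_ge0.
rewrite integral_gaussian mule1 patchE indicE.
by case: (_ \in _); rewrite ?mul1r ?mul0r.
Qed.

Let measurable_sub x : measurable_fun [set: Rn R n] (fun y : Rn R n => (x - y)%R : 'rV[R]_n).
Proof. by apply: measurable_rV_affine; [exact: measurable_cst|exact: measurable_Rn_id]. Qed.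

Definition gaussian_potential (t : R) (f : 'rV[R]_n -> \bar R) (x : 'rV[R]_n) : \bar R :=
  \int[mu]_y ((gaussian t (x - y)%R)%:E * f y).

Lemma partial_potential D f x : measurable D -> lebesgue_measurable f -> (forall y, 0 <= f y) ->
  \int[mu]_y (partial_density D (x - y)%R * f y) =
  \int[lebesgue_measure]_(t in D) ((mixing_density a t)%:E * gaussian_potential t f x).
Proof.
move=> mD mf f0.
pose F (z : measurableTypeR R * Rn R n) := (\1_D z.1 * mixed_gaussian a (z.1, (x - z.2)%R))%:E * f z.2.
have mg : measurable_fun setT (fun z : measurableTypeR R * Rn R n => (\1_D z.1 * mixed_gaussian a (z.1, (x - z.2)%R))%:E).
  have mp : measurable_fun setT (fun z : measurableTypeR R * Rn R n => (z.1, (x - z.2)%R : 'rV[R]_n)).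
    apply: measurable_fun_pair; first exact: measurable_fst.
    exact: (measurableT_comp (measurable_sub x) measurable_snd).
  exact: (measurableT_comp (mDmg mD) mp).
have mF : measurable_fun setT F.
  apply: emeasurable_funM; first exact: mg.
  exact: (measurableT_comp mf measurable_snd).
have w0 z : 0 <= (\1_D z.1 * mixed_gaussian a (z.1, (x - z.2)%R))%:E :> \bar R.
  by rewrite lee_fin mulr_ge0// mixed_gaussian_ge0.
have F0 z : 0 <= F z by rewrite mule_ge0.
transitivity (\int[mu]_y \int[lebesgue_measure]_t F (t, y)).
  apply: eq_integral => y _; rewrite partial_densityE -ge0_integralZr//.
  - exact: (measurableT_comp mg (pair2_measurable y)).
  - by move=> t _; exact: (w0 (t, y)).
rewrite -(fubini_tonelli F mF F0) [RHS]integral_mkcond.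
apply: eq_integral => t _; rewrite patchE.
case: ifPn => Dt; last first.
  by apply: integral0_eq => y _; rewrite /F indicE/= (negbTE Dt) mul0r mul0e.
rewrite /gaussian_potential -ge0_integralZl.
- by apply: eq_integral => y _; rewrite /F /mixed_gaussian indicE/= Dt mul1r EFinM muleA.
- exact: measurableT.
- apply: emeasurable_funM mf.
  by apply/measurable_EFinP; exact: (measurableT_comp (@measurable_gaussian R n t) (measurable_sub x)).
- by move=> y _; rewrite mule_ge0// lee_fin gaussian_ge0.
- by rewrite lee_fin mixing_density_ge0.
Qed.

Lemma normal_peak_leV (t : R) : (0 < t -> normal_peak t <= t^-1)%R.
Proof.
move=> t0; rewrite /normal_peak lef_pV2 ?posrE ?sqrtr_gt0//; last first.
  by rewrite mulrn_wgt0// mulr_gt0 ?pi_gt0// exprn_gt0.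
rewrite -[leLHS](ger0_norm (ltW t0)) -sqrtr_sqr ler_wsqrtr//.
have p2 := pi_ge2 R; have t2 : (0 <= t ^+ 2)%R by exact: sqr_ge0.
by rewrite -mulr_natr; nra.
Qed.

Lemma gaussian_potential_le (t b : R) f x : (0 < t)%R -> (0 < b)%R ->
  lebesgue_measurable f -> (forall y, 0 <= f y) -> \int[mu]_y f y `^ s <= b%:E ->
  gaussian_potential t f x <= (2 * t `^ (- (n%:R / s)) * b `^ s^-1)%:E.
Proof.
move=> t0 b0 mf f0 fb.
have mg : measurable_fun [set: Rn R n] (fun y : Rn R n => (gaussian t (x - y)%R)%:E).
  by apply/measurable_EFinP; exact: (measurableT_comp (@measurable_gaussian R n t) (measurable_sub x)).
have g0 y : 0 <= (gaussian t (x - y)%R)%:E :> \bar R by rewrite lee_fin gaussian_ge0.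
have g1 : \int[mu]_y (gaussian t (x - y)%R)%:E <= 1%:E.
  have mG : measurable_fun setT (fun y : 'rV[R]_n => (gaussian t y)%:E : \bar R).
    by apply/measurable_EFinP; exact: measurable_gaussian.
  rewrite (ge0_integral_Rn_reflect x mG) => [|y]; last by rewrite lee_fin gaussian_ge0.
  by rewrite ge0_integral_Rn// ?integral_gaussian// => y; rewrite lee_fin gaussian_ge0.
have P0 : 0 <= gaussian_potential t f x by apply: integral_ge0 => y _; rewrite mule_ge0.
have := weighted_hoelder s1 ltr01 mg g0 mf f0 g1.
rewrite powR1 mulr1 => h.
have mfs : measurable_fun setT (fun y : Rn R n => f y `^ s) by exact: (measurableT_comp (measurable_poweR s) mf).
have h2 : \int[mu]_y ((gaussian t (x - y)%R)%:E * f y `^ s) <= (t `^ (- n%:R))%:E * b%:E.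
  apply: (@le_trans _ _ (\int[mu]_y ((t `^ (- n%:R))%:E * f y `^ s))).
    apply: ge0_le_integral.
    - exact: measurableT.
    - by move=> y _; rewrite mule_ge0// poweR_ge0.
    - exact: emeasurable_funM.
    - exact: measurable_funeM.
    - move=> y _; apply: lee_wpmul2r; first exact: poweR_ge0.
      rewrite lee_fin; apply: le_trans (gaussian_ub _ (lt0r_neq0 t0)) _.
      rewrite powRN (powR_mulrn _ (ltW t0)) -exprVn; apply: lerXn2r.
      - by rewrite nnegrE normal_peak_ge0.
      - by rewrite nnegrE invr_ge0 ltW.
      - exact: normal_peak_leV.
  rewrite ge0_integralZl; last 4 first.
  - exact: measurableT.
  - exact: mfs.
  - by move=> y _; exact: poweR_ge0.
  - by rewrite lee_fin powR_ge0.
  by apply: lee_wpmul2l fb; rewrite lee_fin powR_ge0.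
have h3 : gaussian_potential t f x `^ s <= (2 `^ s * (t `^ (- n%:R) * b))%:E.
  apply: le_trans h _; rewrite EFinM; apply: lee_wpmul2l; first by rewrite lee_fin powR_ge0.
  by rewrite EFinM.
have := @lee_poweR2 R s^-1 _ _ _ (poweR_ge0 _ _) h3.
rewrite invr_ge0 => /(_ (ltW s0)).
rewrite -poweRrM mulfV ?gt_eqF// poweRe1// => h4; apply: (le_trans h4).
have [p1 p2 p3 pb] : [/\ 0 <= 2 `^ s, 0 <= t `^ (- n%:R), 0 <= t `^ (- n%:R) * b & 0 <= b]%R.
  by rewrite !powR_ge0 mulr_ge0 ?powR_ge0 ?(ltW b0).
rewrite poweR_EFin lee_fin (powRM _ p1 p3) (powRM _ p2 pb) -!powRrM.
by rewrite mulfV ?gt_eqF// powRr1// mulrA mulNr.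
Qed.

Lemma measurable_mixed_potential f x : lebesgue_measurable f -> (forall y, 0 <= f y) ->
  measurable_fun [set: measurableTypeR R] (fun t => (mixing_density a t)%:E * gaussian_potential t f x).
Proof.
move=> mf f0.
pose F (z : measurableTypeR R * Rn R n) := (mixed_gaussian a (z.1, (x - z.2)%R))%:E * f z.2.
have mp : measurable_fun setT (fun z : measurableTypeR R * Rn R n => (z.1, (x - z.2)%R : 'rV[R]_n)).
  apply: measurable_fun_pair; first exact: measurable_fst.
  exact: (measurableT_comp (measurable_sub x) measurable_snd).
have mF : measurable_fun setT F.
  apply: emeasurable_funM; first exact: (measurableT_comp mEmg mp).
  exact: (measurableT_comp mf measurable_snd).
have F0 z : 0 <= F z by rewrite mule_ge0// lee_fin mixed_gaussian_ge0.
rewrite (_ : (fun t => _) = fun t => \int[mu]_y F (t, y)).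
  exact: (measurable_fun_fubini_tonelli_F (m2 := mu) F mF F0).
apply/funext => t; rewrite /gaussian_potential -ge0_integralZl.
- by apply: eq_integral => y _; rewrite /F /mixed_gaussian/= EFinM muleA.
- exact: measurableT.
- apply: emeasurable_funM mf.
  by apply/measurable_EFinP; exact: (measurableT_comp (@measurable_gaussian R n t) (measurable_sub x)).
- by move=> y _; rewrite mule_ge0// lee_fin gaussian_ge0.
- by rewrite lee_fin mixing_density_ge0.
Qed.

Let mixing_le_powR a' : (a' <= a)%R ->
  exists2 C : R, (0 < C)%R & forall t, (0 < t -> mixing_density a t <= C * t `^ (a' - 1))%R.
Proof.
move=> aa; have [C C0 CP] := bessel_weight_le_powR aa (@ltr01 R).
have m0 : (0 < fine (bessel_mass a 1))%R.
  by rewrite fine_gt0// bessel_mass_gt0//= bessel_mass_lty.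
exists (C / fine (bessel_mass a 1))%R; first by rewrite divr_gt0.
by move=> t t0; rewrite /mixing_density [leRHS]mulrAC ler_pM2r ?invr_gt0// CP.
Qed.

Lemma mixing_mass_small a' : (0 < a')%R -> (a' <= a)%R ->
  exists2 C : R, (0 < C)%R & forall t, (0 < t)%R ->
    \int[lebesgue_measure]_(u in `]0%R, t]) (mixing_density a u)%:E <= (C * t `^ a')%:E.
Proof.
move=> a'0 aa; have [C C0 CP] := mixing_le_powR aa.
exists (C / a')%R; first by rewrite divr_gt0.
move=> t t0; have Cw : 0 <= C%:E by rewrite lee_fin ltW.
apply: (@le_trans _ _ (\int[lebesgue_measure]_(u in `]0%R, t]) (C%:E * (u `^ (a' - 1))%:E))).
  apply: ge0_le_integral.
  - exact: measurable_itv.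
  - by move=> u _; rewrite lee_fin mixing_density_ge0.
  - by apply/measurable_EFinP; apply: measurable_funTS; exact: measurable_mixing_density.
  - by apply: measurable_funeM; exact: measurable_powR_EFin.
  - by move=> u /=; rewrite in_itv/= => /andP[u0 _]; rewrite -EFinM lee_fin CP.
rewrite ge0_integralZl.
- have -> : (C / a' * t `^ a' = C * (t `^ a' / a'))%R by ring.
  rewrite [leRHS]EFinM.
  by apply: lee_wpmul2l => //; exact: integral_powR0.
- exact: measurable_itv.
- exact: measurable_powR_EFin.
- by move=> u _; rewrite lee_fin powR_ge0.
- exact: Cw.
Qed.

Lemma potential_tail a' : (a' <= a)%R -> (a' < n%:R / s)%R ->
  exists2 C : R, (0 < C)%R & forall t b f x, (0 < t)%R -> (0 < b)%R ->
    lebesgue_measurable f -> (forall y, 0 <= f y) -> \int[mu]_y f y `^ s <= b%:E ->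
    \int[mu]_y (partial_density `]t, +oo[ (x - y)%R * f y) <= (C * t `^ (a' - n%:R / s) * b `^ s^-1)%:E.
Proof.
move=> aa an; have [C C0 CP] := mixing_le_powR aa.
have d0 : (0 < n%:R / s - a')%R by rewrite subr_gt0.
exists (C * 2 / (n%:R / s - a'))%R; first by rewrite divr_gt0// mulr_gt0.
move=> t b f x t0 b0 mf f0 fb.
rewrite partial_potential//.
have B0 : (0 <= C * 2 * b `^ s^-1)%R by rewrite !mulr_ge0 ?powR_ge0// ltW.
apply: (@le_trans _ _ (\int[lebesgue_measure]_(u in `]t, +oo[)
    ((C * 2 * b `^ s^-1)%:E * (u `^ (- (n%:R / s - a') - 1))%:E))).
  apply: ge0_le_integral.
  - exact: measurable_itv.
  - move=> u _; rewrite mule_ge0 ?lee_fin ?mixing_density_ge0//.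
    by apply: integral_ge0 => y _; rewrite mule_ge0 ?lee_fin ?gaussian_ge0.
  - by apply: measurable_funTS; exact: measurable_mixed_potential.
  - by apply: measurable_funeM; exact: measurable_powR_EFin.
  - move=> u /=; rewrite in_itv/= andbT => tu; have u0 := lt_trans t0 tu.
    apply: le_trans (lee_wpmul2l _ (gaussian_potential_le x u0 b0 mf f0 fb)) _.
      by rewrite lee_fin mixing_density_ge0.
    rewrite -!EFinM lee_fin.
    apply: (@le_trans _ _ (C * u `^ (a' - 1) * (2 * u `^ (- (n%:R / s)) * b `^ s^-1))%R).
      by apply: ler_wpM2r (CP _ u0); rewrite !mulr_ge0// powR_ge0.
    have -> : (u `^ (- (n%:R / s - a') - 1) = u `^ (a' - 1) * u `^ (- (n%:R / s)))%R.
      rewrite -powRD; last by rewrite (gt_eqF u0) implybT.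
      by congr (_ `^ _)%R; ring.
    by apply: eqW_le; ring.
rewrite ge0_integralZl.
- have -> : (C * 2 / (n%:R / s - a') * t `^ (a' - n%:R / s) * b `^ s^-1 =
     (C * 2 * b `^ s^-1) * (t `^ (- (n%:R / s - a')) / (n%:R / s - a')))%R.
    by rewrite opprB; move: (_ - a')^-1%R => d; ring.
  rewrite [leRHS]EFinM; apply: lee_wpmul2l => //.
  apply: le_trans (integral_powRy d0 t0).
  apply: ge0_subset_integral => //.
  - exact: measurable_powR_EFin.
  - by move=> u _; rewrite lee_fin powR_ge0.
  - by move=> u /=; rewrite !in_itv/= !andbT => /ltW.
- exact: measurable_itv.
- exact: measurable_powR_EFin.
- by move=> u _; rewrite lee_fin powR_ge0.
- by rewrite lee_fin.
Qed.

Lemma measurable_potential (k f : 'rV[R]_n -> \bar R) :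
  measurable_fun setT k -> (forall y, 0 <= k y) -> lebesgue_measurable f -> (forall y, 0 <= f y) ->
  lebesgue_measurable (fun x => \int[mu]_y (k (x - y)%R * f y)).
Proof.
move=> mk k0 mf f0.
pose F (z : Rn R n * Rn R n) := k (z.1 - z.2)%R * f z.2.
have mF : measurable_fun setT F.
  apply: emeasurable_funM; last exact: (measurableT_comp mf measurable_snd).
  have mp : measurable_fun setT (fun z : Rn R n * Rn R n => (z.1 - z.2)%R : 'rV[R]_n).
    apply: measurable_rV_affine.
    - exact: (measurableT_comp (@measurable_Rn_id R n) measurable_fst).
    - exact: (measurableT_comp (@measurable_Rn_id R n) measurable_snd).
  exact: (measurableT_comp mk mp).
have F0 z : 0 <= F z by rewrite mule_ge0.
exact: (measurable_fun_fubini_tonelli_F (m2 := mu) F mF F0).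
Qed.

Lemma integral_potential (k f : 'rV[R]_n -> \bar R) :
  measurable_fun setT k -> (forall y, 0 <= k y) -> (forall y, k (- y)%R = k y) ->
  lebesgue_measurable f -> (forall y, 0 <= f y) ->
  \int[mu]_x \int[mu]_y (k (x - y)%R * f y) = \int[mu]_y k y * \int[mu]_y f y.
Proof.
move=> mk k0 kN mf f0.
pose F (z : Rn R n * Rn R n) := k (z.1 - z.2)%R * f z.2.
have mF : measurable_fun setT F.
  apply: emeasurable_funM; last exact: (measurableT_comp mf measurable_snd).
  have mp : measurable_fun setT (fun z : Rn R n * Rn R n => (z.1 - z.2)%R : 'rV[R]_n).
    apply: measurable_rV_affine.
    - exact: (measurableT_comp (@measurable_Rn_id R n) measurable_fst).
    - exact: (measurableT_comp (@measurable_Rn_id R n) measurable_snd).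
  exact: (measurableT_comp mk mp).
have F0 z : 0 <= F z by rewrite mule_ge0.
have mkx x : measurable_fun setT (fun y : Rn R n => k (x - y)%R) by exact: (measurableT_comp mk (measurable_sub x)).
rewrite (fubini_tonelli (m1 := mu) (m2 := mu) F mF F0) -ge0_integralZl; last 4 first.
- exact: measurableT.
- exact: mf.
- by move=> y _; exact: f0.
- by apply: integral_ge0.
apply: eq_integral => y _; rewrite -(ge0_integral_Rn_reflect y mk k0).
rewrite -ge0_integralZr; last 4 first.
- exact: measurableT.
- exact: mkx.
- by move=> x _; exact: k0.
- exact: f0.
by apply: eq_integral => x _; rewrite /F/= -kN opprB.
Qed.

Lemma young_convolution (k f : 'rV[R]_n -> \bar R) (A : R) : (0 < A)%R ->
  measurable_fun setT k -> (forall y, 0 <= k y) -> (forall y, k (- y)%R = k y) ->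
  \int[mu]_y k y <= A%:E ->
  lebesgue_measurable f -> (forall y, 0 <= f y) ->
  \int[mu]_x ((\int[mu]_y (k (x - y)%R * f y)) `^ s) <= (2 `^ s * A `^ s)%:E * \int[mu]_y f y `^ s.
Proof.
move=> A0 mk k0 kN kA mf f0.
have mfs : measurable_fun setT (fun y : Rn R n => f y `^ s) by exact: (measurableT_comp (measurable_poweR s) mf).
have fs0 y : 0 <= f y `^ s by exact: poweR_ge0.
have mkx x : measurable_fun setT (fun y : Rn R n => k (x - y)%R) by exact: (measurableT_comp mk (measurable_sub x)).
have kI x : \int[mu]_y k (x - y)%R = \int[mu]_y k y by exact: (ge0_integral_Rn_reflect x mk).
have mP : lebesgue_measurable (fun x => \int[mu]_y (k (x - y)%R * f y `^ s)) by exact: measurable_potential.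
have c0 : 0 <= (2 `^ s * A `^ (s - 1))%:E :> \bar R by rewrite lee_fin mulr_ge0 ?powR_ge0.
apply: (@le_trans _ _ (\int[mu]_x ((2 `^ s * A `^ (s - 1))%:E * \int[mu]_y (k (x - y)%R * f y `^ s)))).
  apply: ge0_le_integral.
  - exact: measurableT.
  - by move=> x _; exact: poweR_ge0.
  - exact: (measurableT_comp (measurable_poweR s) (measurable_potential mk k0 mf f0)).
  - exact: measurable_funeM.
  - move=> x _; apply: (weighted_hoelder s1 A0) => //.
    by rewrite kI.
rewrite ge0_integralZl; last 4 first.
- exact: measurableT.
- exact: mP.
- by move=> x _; apply: integral_ge0 => y _; rewrite mule_ge0.
- exact: c0.
have -> : (2 `^ s * A `^ s = 2 `^ s * A `^ (s - 1) * A)%R.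
  by rewrite -mulrA (mulrC (A `^ _)%R) mulr_powRB1// ltW.
rewrite (EFinM (_ * _)%R) -muleA; apply: lee_wpmul2l; first exact: c0.
rewrite (integral_potential mk k0 kN mfs fs0).
by apply: lee_wpmul2r => //; apply: integral_ge0.
Qed.

Lemma partial_density_opp D x : partial_density D (- x)%R = partial_density D x.
Proof.
apply: eq_integral => t _; rewrite /mixed_gaussian/=.
have [t0|t0] := ltP 0%R t; first by rewrite gaussian_opp// gt_eqF.
by rewrite mixing_density_le0// !mul0r.
Qed.

Lemma bessel_potential_split f x t : (0 < t)%R -> lebesgue_measurable f -> (forall y, 0 <= f y) ->
  bessel_potential f x = \int[mu]_y (partial_density `]0%R, t] (x - y)%R * f y) +
    \int[mu]_y (partial_density `]t, +oo[ (x - y)%R * f y).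
Proof.
move=> t0 mf f0.
have mD D : measurable D -> measurable_fun [set: Rn R n] (fun y : Rn R n => partial_density D (x - y)%R * f y).
  move=> mD; apply: emeasurable_funM mf.
  exact: (measurableT_comp (measurable_partial_density mD) (measurable_sub x)).
rewrite -ge0_integralD.
- apply: eq_integral => y _.
  by rewrite (bessel_density_split _ t0) ge0_muleDl// partial_density_ge0.
- exact: measurableT.
- by move=> y _; rewrite mule_ge0// partial_density_ge0.
- by apply: mD; exact: measurable_itv.
- by move=> y _; rewrite mule_ge0// partial_density_ge0.
- by apply: mD; exact: measurable_itv.
Qed.

(* Cut the mixture at the scale t where the Gaussians wider than t contribute at most
   1/2 to the potential of f: the narrower ones have total mass O(t^a').  The freedom
   a' < a is what covers the critical case a * s = n. *)
Lemma measure_le_admissible a' : (0 < a')%R -> (a' <= a)%R -> (a' < n%:R / s)%R ->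
  exists2 C : R, (0 < C)%R & forall (K : set 'rV[R]_n) f, measurable K -> bessel_admissible K f ->
    (mu K) `^ (1 - a' * s / n%:R)%R <= C%:E * \int[mu]_y f y `^ s.
Proof.
move=> a'0 aa an.
have n0 : (0 < n%:R :> R)%R.
  by rewrite -(@pmulr_lgt0 _ s^-1) ?invr_gt0//; exact: lt_trans an.
have [C1 C10 tailP] := potential_tail aa an.
have [C2 C20 smallP] := mixing_mass_small a'0 aa.
pose e := (n%:R / s - a')%R; have e0 : (0 < e)%R by rewrite subr_gt0.
pose ka := (1 - a' * s / n%:R)%R.
have kaE : ka = (e * (s / n%:R))%R by rewrite /ka /e; field; rewrite !gt_eqF.
have ka0 : (0 < ka)%R by rewrite kaE mulr_gt0// divr_gt0.
pose C3 := (4 `^ s * C2 `^ s * (2 * C1) `^ (a' * s / e))%R.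
have C30 : (0 < C3)%R by rewrite !mulr_gt0// powR_gt0// mulr_gt0.
exists (C3 `^ ka)%R; first by rewrite powR_gt0.
move=> K f mK [mf f0 fK].
have key b : (0 < b)%R -> \int[mu]_y f y `^ s <= b%:E -> (mu K) `^ ka <= (C3 `^ ka * b)%:E.
  move=> b0 fb.
  have bs0 : (0 < b `^ s^-1)%R by rewrite powR_gt0.
  have T0 : (0 < 2 * C1 * b `^ s^-1)%R by rewrite !mulr_gt0.
  pose t := ((2 * C1 * b `^ s^-1) `^ e^-1)%R.
  have t0 : (0 < t)%R by rewrite powR_gt0.
  pose A := (C2 * t `^ a')%R; have A0 : (0 < A)%R by rewrite mulr_gt0// powR_gt0.
  have tailE : (C1 * t `^ (a' - n%:R / s) * b `^ s^-1 = 2^-1)%R.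
    rewrite -opprB -/e powRN /t -powRrM mulVf ?gt_eqF// powRr1 ?(ltW T0)//.
    by field; rewrite !gt_eqF.
  pose P1 x := \int[mu]_y (partial_density `]0%R, t] (x - y)%R * f y).
  have mI : measurable (`]0%R, t]%classic : set (measurableTypeR R)) by exact: measurable_itv.
  have P1K x : K x -> (2^-1)%:E <= P1 x.
    move=> Kx; have := fK _ Kx; rewrite (bessel_potential_split x t0 mf f0) => h.
    have := le_trans h (leeD2l _ (tailP t b f x t0 b0 mf f0 fb)); rewrite tailE -/(P1 x).
    have P0 : 0 <= P1 x by apply: integral_ge0 => y _; rewrite mule_ge0// partial_density_ge0.
    case: (P1 x) P0 => [u||] //= _; rewrite ?leey//.
    by rewrite -EFinD !lee_fin; lra.
  have mP1 : lebesgue_measurable P1.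
    by apply: measurable_potential => //; [exact: measurable_partial_density|move=> y; exact: partial_density_ge0].
  have mK' := measurable_rV_Rn mK.
  have yg : \int[mu]_x (P1 x `^ s) <= (2 `^ s * A `^ s)%:E * b%:E.
    apply: le_trans (lee_wpmul2l _ fb); last by rewrite lee_fin mulr_ge0 ?powR_ge0.
    apply: (young_convolution A0).
    - exact: measurable_partial_density.
    - by move=> y; exact: partial_density_ge0.
    - by move=> y; exact: partial_density_opp.
    - have := integral_partial_density (0 : 'rV[R]_n) mI.
      under eq_integral do rewrite sub0r partial_density_opp.
      by move=> ->; exact: smallP.
    - exact: mf.
    - exact: f0.
  have h1 : ((2^-1) `^ s)%:E * mu K <= (2 `^ s * A `^ s * b)%:E.
    rewrite [leRHS]EFinM; apply: le_trans yg.
    rewrite -integral_cst//.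
    apply: (@le_trans _ _ (\int[mu]_(x in K) (P1 x `^ s))).
      apply: ge0_le_integral.
      - exact: mK'.
      - by move=> x _; rewrite lee_fin powR_ge0.
      - exact: measurable_cst.
      - by apply: measurable_funTS; exact: (measurableT_comp (measurable_poweR s) mP1).
      - by move=> x Kx; rewrite -poweR_EFin; apply: lee_poweR2 (P1K _ Kx); rewrite ?lee_fin ?(ltW s0).
    apply: ge0_subset_integral.
    - exact: mK'.
    - exact: measurableT.
    - exact: (measurableT_comp (measurable_poweR s) mP1).
    - by move=> x _; exact: poweR_ge0.
    - by move=> x _.
  have h2 : mu K <= (4 `^ s * A `^ s * b)%:E.
    have -> : (4 `^ s * A `^ s * b = (2 `^ s) * (2 `^ s * A `^ s * b))%R.
      have -> : (4 `^ s = 2 `^ s * 2 `^ s)%R by rewrite -powRM//; congr (_ `^ _)%R; ring.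
      by ring.
    rewrite EFinM -lee_pdivrMl ?powR_gt0//.
    by rewrite -powRN -mulN1r powRrM powR_inv1.
  have h3 : (4 `^ s * A `^ s * b = C3 * b `^ ka^-1)%R.
    have p2 : (0 <= 2 * C1)%R by rewrite mulr_ge0// ltW.
    have -> : (ka^-1 = a' / e + 1)%R.
      have ns : (n%:R / s = e + a')%R by rewrite /e subrK.
      by rewrite kaE invfM invf_div ns mulrDr mulVf ?gt_eqF// addrC mulrC.
    rewrite /C3 /A powRM ?powR_ge0 ?(ltW C20)// -powRrM /t -powRrM.
    rewrite powRM ?powR_ge0// -powRrM powRD; last by rewrite (gt_eqF b0) implybT.
    rewrite powRr1 ?(ltW b0)//.
    have -> : (e^-1 * (a' * s) = a' * s / e)%R by rewrite mulrC.
    have -> : (s^-1 * (a' * s / e) = a' / e)%R by field; rewrite !gt_eqF.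
    by ring.
  rewrite h3 in h2; apply: le_trans (lee_poweR2 (ltW ka0) (measure_ge0 _ _) h2) _.
  rewrite poweR_EFin lee_fin powRM ?powR_ge0 ?(ltW C30)// -powRrM mulVf ?gt_eqF//.
  by rewrite powRr1// ltW.
have : 0 <= \int[mu]_y f y `^ s by apply: integral_ge0 => y _; exact: poweR_ge0.
have C4 : (0 < C3 `^ ka)%R by rewrite powR_gt0.
case E : (\int[mu]_y f y `^ s) => [b||]; [|by move=> _; rewrite gt0_muley ?lte_fin// leey|by []].
rewrite lee_fin => b0; apply/lee_addgt0Pr => d d0.
have d1 : (0 < d / C3 `^ ka)%R by rewrite divr_gt0.
have h : \int[mu]_y f y `^ s <= (b + d / C3 `^ ka)%:E by rewrite E lee_fin lerDl ltW.
apply: le_trans (key _ _ h) _; first exact: ltr_wpDl.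
by rewrite -EFinM -EFinD lee_fin mulrDr; apply: eqW_le; field; rewrite gt_eqF.
Qed.

Let normal_peak_ge (t : R) : (1 <= t <= 2 -> normal_peak 2 <= normal_peak t)%R.
Proof.
move=> /andP[t1 t2]; have t0 : (0 < t)%R by exact: lt_le_trans t1.
have p0 u : (0 < u -> 0 < u ^+ 2 * pi *+ 2 :> R)%R.
  by move=> u0; rewrite mulrn_wgt0// mulr_gt0 ?pi_gt0// exprn_gt0.
rewrite /normal_peak lef_pV2 ?posrE ?sqrtr_gt0 ?p0//.
apply: ler_wsqrtr; rewrite ler_wMn2r// ler_pM2r ?pi_gt0//.
by rewrite ler_sqr ?nnegrE// ltW.
Qed.

Lemma bessel_density_cube_ge (r : R) : (0 < r)%R ->
  exists2 c : R, (0 < c)%R & forall x : 'rV[R]_n, (forall i, `|x ord0 i| <= r)%R -> c%:E <= G x.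
Proof.
move=> r0.
have m0 : (0 < fine (bessel_mass a 1))%R.
  by rewrite fine_gt0// bessel_mass_gt0//= bessel_mass_lty.
pose c1 := (2^-1 * expR (- (2 * 1)) / fine (bessel_mass a 1))%R.
have c10 : (0 < c1)%R by rewrite divr_gt0// mulr_gt0// expR_gt0.
pose c2 := (normal_peak 2 * expR (- (r ^+ 2 / 2)) : R)%R.
have c20 : (0 < c2)%R by rewrite mulr_gt0 ?expR_gt0// normal_peak_gt0.
exists (c1 * c2 ^+ n)%R; first by rewrite mulr_gt0// exprn_gt0.
move=> x xr.
have mI : measurable (`[1%R, 2%R]%classic : set (measurableTypeR R)) by exact: measurable_itv.
have mx : measurable_fun [set: measurableTypeR R] (fun t => (mixed_gaussian a (t, x))%:E).
  exact: (measurableT_comp mEmg (pair2_measurable x)).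
apply: (@le_trans _ _ (\int[lebesgue_measure]_(t in `[1%R, 2%R]) (mixed_gaussian a (t, x))%:E)); last first.
  apply: ge0_subset_integral.
  - exact: mI.
  - exact: measurableT.
  - exact: mx.
  - by move=> t _; rewrite lee_fin mixed_gaussian_ge0.
  - by move=> t _.
have -> : (c1 * c2 ^+ n)%:E = \int[lebesgue_measure]_(t in `[1%R, 2%R]) (c1 * c2 ^+ n)%:E.
  rewrite integral_cst; last exact: mI.
  by rewrite /= lebesgue_measure_itv/= lte_fin ltr1n -EFinB (_ : (2 - 1 = 1 :> R)%R) ?mule1//; ring.
apply: ge0_le_integral.
- exact: mI.
- by move=> t _; rewrite lee_fin ltW// mulr_gt0// exprn_gt0.
- exact: measurable_cst.
- exact: measurable_funTS.
- move=> t /=; rewrite in_itv/= => t12; rewrite lee_fin /mixed_gaussian/=.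
  have /andP[t1 t2] := t12; have t0 : (0 < t)%R by exact: lt_le_trans t1.
  apply: ler_pM; rewrite ?(ltW c10) ?exprn_ge0 ?(ltW c20)//.
    by rewrite /mixing_density ler_pM2r ?invr_gt0//; exact: bessel_weight_ge12.
  rewrite /gaussian -[in leLHS](card_ord n) -prodr_const; apply: ler_prod => i _.
  rewrite (ltW c20)/= normal_pdf0E ?gt_eqF//; apply: ler_pM; rewrite ?expR_ge0 ?normal_peak_ge0 ?normal_peak_ge//.
  rewrite ler_expR lerN2 ler_pM//.
  - by rewrite sqr_ge0.
  - by rewrite invr_ge0 mulrn_wge0// sqr_ge0.
  - by rewrite -(real_normK (num_real _)) ler_sqr ?nnegrE//; exact: ltW.
  - rewrite lef_pV2 ?posrE ?mulrn_wgt0 ?exprn_gt0//.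
    by apply: ler_wMn2r; exact: exprn_ege1.
Qed.

Lemma bessel_admissible_cube (r : R) : (0 < r)%R ->
  exists2 C : R, (0 < C)%R & forall z : 'rV[R]_n,
    exists2 f, bessel_admissible (cube z r) f & \int[mu]_y f y `^ s <= C%:E.
Proof.
move=> r0.
have rr0 : (0 < r + r)%R by rewrite addr_gt0.
have [c c0 cP] := bessel_density_cube_ge rr0.
pose v := ((2 * r) ^+ n)%R; have v0 : (0 < v)%R by rewrite exprn_gt0// mulr_gt0.
pose b := ((c * v)^-1)%R; have b0 : (0 < b)%R by rewrite invr_gt0 mulr_gt0.
exists (b `^ s * v)%R; first by rewrite mulr_gt0// powR_gt0.
move=> z; pose f (y : 'rV[R]_n) : \bar R := (b * \1_(cube z r) y)%:E.
have mc := measurable_rV_Rn (measurable_cube z r).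
have mf : lebesgue_measurable f.
  apply/measurable_EFinP; apply: measurable_funM; first exact: measurable_cst.
  exact: measurable_indic.
have f0 y : 0 <= f y by rewrite lee_fin mulr_ge0// ltW.
exists f.
  split=> // x xz.
  rewrite /bessel_potential.
  apply: (@le_trans _ _ (\int[mu]_y ((c * b)%:E * (\1_(cube z r) y)%:E))).
    rewrite ge0_integralZl; last 4 first.
    - exact: measurableT.
    - by apply/measurable_EFinP; exact: measurable_indic.
    - by move=> y _; rewrite lee_fin.
    - by rewrite lee_fin mulr_ge0// ltW.
    rewrite integral_indic; [|exact: measurableT|exact: mc].
    rewrite setIT (_ : _ (cube z r) = v%:E); last exact: lebesgue_cube (ltW r0).
    rewrite -EFinM lee_fin /b.
    by apply: eqW_le; field; rewrite !gt_eqF.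
  apply: ge0_le_integral.
  - exact: measurableT.
  - by move=> y _; rewrite lee_fin mulr_ge0// mulr_ge0// ltW.
  - apply: measurable_funeM; apply/measurable_EFinP; exact: measurable_indic.
  - apply: emeasurable_funM mf.
    exact: (measurableT_comp (@measurable_bessel_density R n a a0) (measurable_sub x)).
  - move=> y _; rewrite /f -EFinM -mulrA EFinM; have [yz|yz] := pselect (cube z r y); last first.
      by rewrite indicE memNset// mulr0 !mule0.
    apply: lee_wpmul2r; first by rewrite lee_fin mulr_ge0// ltW.
    apply: cP => i; rewrite !mxE.
    rewrite (_ : x ord0 i - y ord0 i = (x ord0 i - z ord0 i) - (y ord0 i - z ord0 i))%R; last by ring.
    by apply: le_trans (ler_normB _ _) _; apply: lerD; [exact: xz|exact: yz].
rewrite (_ : \int[mu]_y _ = \int[mu]_y ((b `^ s)%:E * (\1_(cube z r) y)%:E)); last first.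
  apply: eq_integral => y _; rewrite poweR_EFin -EFinM indicE; congr EFin.
  by case: (_ \in _); rewrite ?mulr1// !mulr0 powR0// gt_eqF.
rewrite ge0_integralZl; last 4 first.
- exact: measurableT.
- by apply/measurable_EFinP; exact: measurable_indic.
- by move=> y _; rewrite lee_fin.
- by rewrite lee_fin powR_ge0.
rewrite integral_indic; [|exact: measurableT|exact: mc].
by rewrite setIT (_ : _ (cube z r) = v%:E) ?EFinM//; exact: lebesgue_cube (ltW r0).
Qed.

Definition exp_kernel (d : R) (x : 'rV[R]_n) : R := \prod_(i < n) expR (- (d * `|x ord0 i|)).

Lemma exp_kernel_ge0 d x : (0 <= exp_kernel d x)%R.
Proof. by apply: prodr_ge0 => i _; exact: expR_ge0. Qed.

Lemma exp_kernelN d x : exp_kernel d (- x)%R = exp_kernel d x.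
Proof. by apply: eq_bigr => i _; rewrite mxE normrN. Qed.

Let measurable_expN d : measurable_fun [set: measurableTypeR R] (fun u : measurableTypeR R => expR (- (d * `|u|))).
Proof.
apply: (measurableT_comp (@measurable_expR R)); apply: measurable_funN.
by apply: measurable_funM; [exact: measurable_cst|exact: normr_measurable].
Qed.

Lemma measurable_exp_kernel d : measurable_fun setT (exp_kernel d).
Proof.
apply: measurable_prod => i _.
exact: (measurableT_comp (measurable_expN d) (@measurable_coord R n i)).
Qed.

Lemma exp_kernel_harnack d c (x y : 'rV[R]_n) : (0 <= d)%R -> (forall i, `|x ord0 i - y ord0 i| <= c)%R ->
  (exp_kernel d x <= expR (d * c *+ n) * exp_kernel d y)%R.
Proof.
move=> d0 xy; rewrite -mulr_natl expRM_natl -[X in (expR _ ^+ X)%R](card_ord n) -prodr_const.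
rewrite -big_split/=; apply: ler_prod => i _; rewrite expR_ge0/= -expRD ler_expR.
have h : (`|y ord0 i| - `|x ord0 i| <= c)%R.
  by apply: le_trans (xy i); rewrite distrC; exact: lerB_dist.
by rewrite -mulrN -mulrBr ler_wpM2l//; lra.
Qed.

Lemma integral_exp_kernel d : (0 < d)%R ->
  exists2 A : R, (0 < A)%R & \int[mu]_x (exp_kernel d x)%:E <= A%:E.
Proof.
move=> d0; pose I := \int[lebesgue_measure]_u (expR (- (d * `|u|)))%:E.
have mE : measurable_fun setT (fun u : measurableTypeR R => (exponential_pdf d u)%:E : \bar R).
  by apply/measurable_EFinP; exact: measurable_exponential_pdf.
have E0 u : 0 <= (exponential_pdf d u)%:E :> \bar R by rewrite lee_fin exponential_pdf_ge0// ltW.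
have mEN : measurable_fun setT (fun u : measurableTypeR R => (exponential_pdf d (0 - u))%:E : \bar R).
  apply: (measurableT_comp mE); apply: measurable_funB; first exact: measurable_cst.
  exact: measurable_id.
have IB : I <= (d^-1)%:E * (1 + 1).
  rewrite -[X in X + _](integral_exponential_pdf d0).
  rewrite -[X in _ + X](integral_exponential_pdf d0).
  rewrite -[X in _ + X](ge0_integral_reflect1 0%R mE E0).
  rewrite -ge0_integralD//.
  rewrite -ge0_integralZl//; last 3 first.
  - exact: emeasurable_funD.
  - by move=> u _; rewrite adde_ge0.
  - by rewrite lee_fin invr_ge0 ltW.
  apply: ge0_le_integral => //.
  - by apply/measurable_EFinP; exact: measurable_expN.
  - by apply: measurable_funeM; exact: emeasurable_funD.
  - move=> u _; rewrite -EFinD -EFinM lee_fin ler_pdivlMl// sub0r.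
    have [u0|u0] := leP 0%R u.
      rewrite (exponential_pdfE _ u0) ger0_norm// mulNr lerDl.
      by rewrite -lee_fin; exact: E0.
    have u0' : (0 <= - u)%R by rewrite oppr_ge0 ltW.
    rewrite (exponential_pdfE _ u0') ltr0_norm// mulNr lerDr.
    by rewrite -lee_fin; exact: E0.
have I0 : 0 <= I by apply: integral_ge0 => u _; rewrite lee_fin expR_ge0.
have If : I \is a fin_num.
  by rewrite ge0_fin_numE//; apply: le_lt_trans IB _; rewrite -EFinD -EFinM ltry.
exists (\prod_(i < n) fine I + 1)%R.
  by rewrite ltr_wpDl// prodr_ge0// => i _; exact: fine_ge0.
rewrite ge0_integral_Rn; last 2 first.
- by apply/measurable_EFinP; exact: measurable_exp_kernel.
- by move=> x; rewrite lee_fin exp_kernel_ge0.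
rewrite (ge0_integral_rV_prod (h := fun _ u => expR (- (d * `|u|)))).
- rewrite -/I (eq_bigr (fun _ => (fine I)%:E)); last by move=> i _; rewrite fineK.
  by rewrite prodEFin lee_fin lerDl.
- by move=> i; exact: measurable_expN.
- by move=> i u; exact: expR_ge0.
Qed.

Lemma bessel_density_far (r : R) : (0 < r)%R ->
  exists2 C : R, (0 < C)%R & forall (x : 'rV[R]_n) i, (r < `|x ord0 i|)%R ->
    G x <= (C * exp_kernel (2 * n%:R)^-1 x)%:E.
Proof.
move=> r0; have r4 : (0 < r ^+ 2 / 4)%R by rewrite divr_gt0// exprn_gt0.
have [C1 C10 C1P] := @powRN_gaussian_bound R n%:R (r ^+ 2 / 4)%R (ler0n _ _) r4.
have m0 : (0 < fine (bessel_mass a 1))%R.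
  by rewrite fine_gt0// bessel_mass_gt0//= bessel_mass_lty.
have h0 : (0 < 2^-1 :> R)%R by [].
have m2 : bessel_mass a (2^-1)%R = (fine (bessel_mass a (2^-1)%R))%:E.
  by rewrite fineK// bessel_mass_fin_num.
have m20 : (0 < fine (bessel_mass a (2^-1)%R))%R.
  by rewrite fine_gt0// bessel_mass_gt0//= ?bessel_mass_lty.
exists (C1 / fine (bessel_mass a 1) * fine (bessel_mass a (2^-1)%R))%R; first by rewrite !mulr_gt0// invr_gt0.
move=> x i0 xr.
have n0 : (0 < n%:R :> R)%R by rewrite ltr0n; exact: leq_ltn_trans (ltn_ord i0).
set E := exp_kernel _ x.
have c0 : (0 <= C1 / fine (bessel_mass a 1) * E)%R by rewrite !mulr_ge0 ?invr_ge0 ?exp_kernel_ge0 ?ltW.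
rewrite (_ : (_ * E = C1 / fine (bessel_mass a 1) * E * fine (bessel_mass a (2^-1)%R))%R); last by ring.
rewrite EFinM -m2 /bessel_mass -ge0_integralZl//; last 2 first.
- by apply/measurable_EFinP; exact: measurable_bessel_weight.
- by move=> t _; rewrite lee_fin bessel_weight_ge0.
apply: ge0_le_integral.
- exact: measurableT.
- by move=> t _; rewrite lee_fin mixed_gaussian_ge0.
- exact: (measurableT_comp mEmg (pair2_measurable x)).
- by apply: measurable_funeM; apply/measurable_EFinP; exact: measurable_bessel_weight.
move=> t _; rewrite -EFinM lee_fin /mixed_gaussian/=.
have [t0|t0] := ltP 0%R t; last first.
  by rewrite mixing_density_le0// mul0r mulr_ge0// bessel_weight_ge0.
rewrite gaussianE ?gt_eqF// /mixing_density !bessel_weightE//.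
set S := dot x x.
have xS i : (x ord0 i ^+ 2 <= S)%R.
  rewrite /S /dot (bigD1 i)//= -expr2 lerDl sumr_ge0// => j _.
  by rewrite -expr2 sqr_ge0.
have t20 : (0 < t ^+ 2)%R by rewrite exprn_gt0.
have rS : (r ^+ 2 <= S)%R.
  apply: le_trans (xS i0); rewrite -(real_normK (num_real (x ord0 i0))) ler_sqr ?nnegrE// ltW//.
have amgm i : (`|x ord0 i| / 2 <= t ^+ 2 / 4 + S / (4 * t ^+ 2))%R.
  have h : (`|x ord0 i| / 2 <= t ^+ 2 / 4 + x ord0 i ^+ 2 / (4 * t ^+ 2))%R.
    rewrite -subr_ge0 -(real_normK (num_real (x ord0 i))).
    rewrite (_ : (_ - _ = (t - `|x ord0 i| / t) ^+ 2 / 4)%R); last by field; rewrite gt_eqF.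
    by rewrite divr_ge0// sqr_ge0.
  by apply: (le_trans h); rewrite lerD2l ler_pM2r ?invr_gt0 ?mulr_gt0.
have EB : (expR (- (t ^+ 2 / 4 + S / (4 * t ^+ 2))) <= E)%R.
  rewrite /E /exp_kernel -expR_sum ler_expR sumrN lerN2 -mulr_sumr mulrC ler_pdivrMr ?mulr_gt0//.
  apply: (@le_trans _ _ (\sum_(i < n) (2 * (t ^+ 2 / 4 + S / (4 * t ^+ 2))))%R).
    by apply: ler_sum => i _; rewrite mulrC -ler_pdivrMr.
  by rewrite sumr_const card_ord -mulr_natr; apply: eqW_le; ring.
have pk : (normal_peak t ^+ n <= t `^ (- n%:R))%R.
  rewrite powRN (powR_mulrn _ (ltW t0)) -exprVn; apply: lerXn2r.
  - by rewrite nnegrE normal_peak_ge0.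
  - by rewrite nnegrE invr_ge0 ltW.
  - exact: normal_peak_leV.
have C1B : (t `^ (- n%:R) * expR (- (S / (4 * t ^+ 2))) <= C1)%R.
  apply: le_trans (C1P t t0); rewrite ler_wpM2l ?powR_ge0// ler_expR lerN2.
  by rewrite -mulrA -invfM ler_pM2r// invr_gt0 mulr_gt0.
have e12 : (expR (- (1 * t ^+ 2 / 2)) * expR (- (S / (t ^+ 2 *+ 2))) =
    expR (- (2^-1 * t ^+ 2 / 2)) * expR (- (t ^+ 2 / 4 + S / (4 * t ^+ 2))) * expR (- (S / (4 * t ^+ 2))))%R.
  by rewrite -!expRD; congr expR; field; rewrite gt_eqF.
set w := expR (- (2^-1 * t ^+ 2 / 2)) in e12 *.
set u := (t `^ (a - 1))%R.
rewrite (_ : (_ / _ * (_ * _) = (u / fine (bessel_mass a 1) * normal_peak t ^+ n) *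
    (expR (- (1 * t ^+ 2 / 2)) * expR (- (S / (t ^+ 2 *+ 2)))))%R); last by ring.
rewrite e12.
have u0 : (0 <= u / fine (bessel_mass a 1) * w)%R by rewrite !mulr_ge0 ?powR_ge0 ?expR_ge0 ?invr_ge0 ?(ltW m0).
apply: (@le_trans _ _ (u / fine (bessel_mass a 1) * w * (C1 * E))%R); last first.
  by apply: eqW_le; ring.
apply: (@le_trans _ _ (u / fine (bessel_mass a 1) * w * ((normal_peak t ^+ n * expR (- (S / (4 * t ^+ 2)))) *
    expR (- (t ^+ 2 / 4 + S / (4 * t ^+ 2)))))%R).
  by apply: eqW_le; ring.
rewrite ler_wpM2l//; apply: ler_pM => //; rewrite ?mulr_ge0 ?exprn_ge0 ?expR_ge0 ?normal_peak_ge0//.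
by apply: le_trans C1B; rewrite ler_wpM2r ?expR_ge0.
Qed.

Lemma poweR_add_le (x y : \bar R) : 0 <= x -> 0 <= y ->
  (x + y) `^ s <= (2 `^ s)%:E * (x `^ s + y `^ s).
Proof.
have H (u v : \bar R) : 0 <= u -> u <= v -> (u + v) `^ s <= (2 `^ s)%:E * (u `^ s + v `^ s).
  move=> u0 uv; have v0 := le_trans u0 uv.
  apply: (@le_trans _ _ ((2%:E * v) `^ s)).
    apply: lee_poweR2; [exact: ltW|exact: adde_ge0|].
    by rewrite mule_natl mule2n leeD2r.
  rewrite poweRM ?lee_fin// poweR_EFin; apply: lee_wpmul2l; first by rewrite lee_fin powR_ge0.
  by rewrite leeDr// poweR_ge0.
move=> x0 y0; have [xy|/ltW yx] := leP x y; first exact: H.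
by rewrite addeC (addeC (x `^ s)); exact: H.
Qed.

Let lee_mul_indic (X Y g i : \bar R) : i = 0 \/ i = 1 /\ X <= g * Y -> X * i <= g * (Y * i).
Proof. by move=> [->|[-> XY]]; rewrite ?mule0// !mule1. Qed.

(* Off the double cube, the kernel is dominated by [exp_kernel], whose potential h of f
   satisfies a Harnack inequality; so a multiple of h on the double cube makes up for the
   part of f that is cut off. *)
Lemma bessel_quasi_additivity (r : R) : (0 < n)%N -> (0 < r)%R ->
  exists2 C : R, (0 < C)%R & forall (K : set 'rV[R]_n) f, bessel_admissible K f ->
    exists F : 'rV[R]_n -> \bar R, [/\ lebesgue_measurable F, forall x, 0 <= F x,
      \int[mu]_x F x `^ s <= C%:E * \int[mu]_x f x `^ s &
      forall z, bessel_admissible (K `&` cube z r) (fun x => F x * (\1_(cube z (r + r)) x)%:E)].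
Proof.
move=> n0 r0; have rr0 : (0 < r + r)%R by rewrite addr_gt0.
have r30 : (0 < r + (r + r))%R by rewrite addr_gt0.
have [C C0 farP] := bessel_density_far r0.
have [g g0 nearP] := bessel_density_cube_ge r30.
pose d := ((2 * n%:R)^-1 : R)%R.
have dp : (0 < d)%R by rewrite invr_gt0 mulr_gt0// ltr0n.
have d0 := ltW dp.
pose k (x : 'rV[R]_n) : \bar R := (exp_kernel d x)%:E.
have [A A0 kA] := integral_exp_kernel dp.
pose w := expR (d * (r + (r + r)) *+ n).
have w0 : (0 < w)%R by exact: expR_gt0.
pose v := ((2 * (r + r)) ^+ n : R)%R.
have v0 : (0 < v)%R by rewrite exprn_gt0// mulr_gt0.
pose c := (C * w / (g * v))%R.
have c0 : (0 < c)%R by rewrite divr_gt0// mulr_gt0.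
exists (2 `^ s * (1 + c `^ s * (2 `^ s * A `^ s)))%R.
  by rewrite mulr_gt0 ?powR_gt0// addr_gt0// !mulr_gt0// powR_gt0.
move=> K f [mf f0 fK].
have mk : measurable_fun setT k by apply/measurable_EFinP; exact: measurable_exp_kernel.
have k0 x : 0 <= k x by rewrite lee_fin exp_kernel_ge0.
have kN x : k (- x)%R = k x by rewrite /k exp_kernelN.
pose h (x : 'rV[R]_n) : \bar R := \int[mu]_y (k (x - y)%R * f y).
have mh : lebesgue_measurable h by exact: measurable_potential.
have h0 x : 0 <= h x by apply: integral_ge0 => y _; rewrite mule_ge0.
have mfs : measurable_fun setT (fun y : Rn R n => f y `^ s) by exact: (measurableT_comp (measurable_poweR s) mf).
have mhs : measurable_fun setT (fun y : Rn R n => h y `^ s) by exact: (measurableT_comp (measurable_poweR s) mh).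
have hharn (x y : 'rV[R]_n) : (forall i, `|x ord0 i - y ord0 i| <= r + (r + r))%R -> h x <= w%:E * h y.
  move=> xy; rewrite /h -ge0_integralZl; last 4 first.
  - exact: measurableT.
  - by apply: emeasurable_funM mf; exact: (measurableT_comp mk (measurable_sub y)).
  - by move=> u _; rewrite mule_ge0.
  - by rewrite lee_fin ltW.
  apply: ge0_le_integral.
  - exact: measurableT.
  - by move=> u _; rewrite mule_ge0.
  - by apply: emeasurable_funM mf; exact: (measurableT_comp mk (measurable_sub x)).
  - apply: measurable_funeM.
    by apply: emeasurable_funM mf; exact: (measurableT_comp mk (measurable_sub y)).
  - move=> u _; rewrite muleA; apply: lee_wpmul2r => //.
    rewrite -EFinM lee_fin; apply: exp_kernel_harnack => // i.
    by rewrite !mxE opprB addrA subrK.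
pose F x := f x + c%:E * h x.
have mch : measurable_fun setT (fun y : Rn R n => c%:E * h y) by exact: (measurable_funeM c%:E mh).
have mF : lebesgue_measurable F by exact: (emeasurable_funD mf mch).
have F0 x : 0 <= F x by rewrite adde_ge0// mule_ge0// lee_fin ltW.
exists F; split; [exact: mF|exact: F0| |].
  have y2 : \int[mu]_x (h x `^ s) <= (2 `^ s * A `^ s)%:E * \int[mu]_x f x `^ s.
    exact: (young_convolution A0 mk k0 kN kA mf f0).
  have mchs : measurable_fun setT (fun x : Rn R n => (c%:E * h x) `^ s).
    exact: (measurableT_comp (measurable_poweR s) mch).
  apply: (@le_trans _ _ (\int[mu]_x ((2 `^ s)%:E * (f x `^ s + (c%:E * h x) `^ s)))).
    apply: ge0_le_integral.
    - exact: measurableT.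
    - by move=> x _; exact: poweR_ge0.
    - exact: (measurableT_comp (measurable_poweR s) mF).
    - exact: (measurable_funeM _ (emeasurable_funD mfs mchs)).
    - by move=> x _; apply: poweR_add_le => //; rewrite mule_ge0 ?lee_fin ?(ltW c0).
  rewrite ge0_integralZl; last 4 first.
  - exact: measurableT.
  - exact: (emeasurable_funD mfs mchs).
  - by move=> x _; rewrite adde_ge0 ?poweR_ge0.
  - by rewrite lee_fin powR_ge0.
  rewrite (EFinM (2 `^ s)%R) -muleA; apply: lee_wpmul2l; first by rewrite lee_fin powR_ge0.
  rewrite ge0_integralD; last 5 first.
  - exact: measurableT.
  - by move=> x _; exact: poweR_ge0.
  - exact: mfs.
  - by move=> x _; exact: poweR_ge0.
  - exact: mchs.
  have I0 : 0 <= \int[mu]_x f x `^ s by apply: integral_ge0 => x _; exact: poweR_ge0.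
  rewrite EFinD ge0_muleDl// ?mul1e; last by rewrite lee_fin !mulr_ge0 ?powR_ge0.
  rewrite leeD2l//.
  rewrite (_ : \int[mu]_x ((c%:E * h x) `^ s) = \int[mu]_x ((c `^ s)%:E * h x `^ s)); last first.
    by apply: eq_integral => x _; rewrite poweRM ?lee_fin ?(ltW c0)// poweR_EFin.
  rewrite ge0_integralZl; last 4 first.
  - exact: measurableT.
  - exact: mhs.
  - by move=> x _; exact: poweR_ge0.
  - by rewrite lee_fin powR_ge0.
  by rewrite (EFinM (c `^ s)%R) -muleA; apply: lee_wpmul2l; first by rewrite lee_fin powR_ge0.
move=> z; have mc := measurable_rV_Rn (measurable_cube z (r + r)).
split.
- have mQ : measurable_fun setT (fun y : Rn R n => (\1_(cube z (r + r)) y)%:E : \bar R).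
    by apply/measurable_EFinP; exact: measurable_indic.
  exact: (emeasurable_funM mF mQ).
- by move=> x; rewrite mule_ge0.
move=> x [Kx xz]; apply: le_trans (fK _ Kx) _.
have cxy y : cube z (r + r) y -> forall i, (`|x ord0 i - y ord0 i| <= r + (r + r))%R.
  move=> yz i; rewrite (_ : x ord0 i - y ord0 i = (x ord0 i - z ord0 i) - (y ord0 i - z ord0 i))%R; last by ring.
  by apply: le_trans (ler_normB _ _) _; apply: lerD; [exact: xz|exact: yz].
have mGx : measurable_fun [set: Rn R n] (fun y : Rn R n => G (x - y)%R).
  exact: (measurableT_comp (@measurable_bessel_density R n a a0) (measurable_sub x)).
have Gx0 y : 0 <= G (x - y)%R by exact: bessel_density_ge0.
have mQ : measurable_fun setT (fun y : Rn R n => (\1_(cube z (r + r)) y)%:E : \bar R).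
  by apply/measurable_EFinP; exact: measurable_indic.
have C0' : 0 <= C%:E by rewrite lee_fin ltW.
have c0' : 0 <= c%:E by rewrite lee_fin ltW.
have iQ1 (y : 'rV[R]_n) : cube z (r + r) y -> (\1_(cube z (r + r)) y)%:E = 1 :> \bar R.
  by move=> yz; rewrite indicE (mem_set yz).
have iQ0 (y : 'rV[R]_n) : ~ cube z (r + r) y -> (\1_(cube z (r + r)) y)%:E = 0 :> \bar R.
  by move=> yz; rewrite indicE (memNset yz).
have gc0 : (0 <= g * c / w)%R by rewrite ltW// divr_gt0// mulr_gt0.
have gcE : (g * c / w)%:E * h x = g%:E * (c%:E * ((w^-1)%:E * h x)).
  by rewrite -mulrA 2!EFinM -!muleA.
have near y : cube z (r + r) y -> (g * c / w)%:E * h x <= G (x - y)%R * (c%:E * h y).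
  move=> yz; rewrite gcE; apply: lee_pmul.
  - by rewrite lee_fin ltW.
  - by rewrite !mule_ge0// lee_fin invr_ge0 ltW.
  - by apply: nearP => i; rewrite !mxE; exact: cxy.
  - apply: lee_wpmul2l; first exact: c0'.
    by rewrite lee_pdivrMl//; apply: hharn; exact: cxy.
have far : C%:E * h x <= \int[mu]_y (G (x - y)%R * (c%:E * h y * (\1_(cube z (r + r)) y)%:E)).
  apply: (@le_trans _ _ (\int[mu]_y (((g * c / w)%:E * h x) * (\1_(cube z (r + r)) y)%:E))).
    
    rewrite ge0_integralZl; last 4 first.
    - exact: measurableT.
    - exact: mQ.
    - by move=> y _; rewrite lee_fin.
    - by rewrite mule_ge0.
    rewrite integral_indic; [|exact: measurableT|exact: mc].
    rewrite setIT (_ : _ (cube z (r + r)) = v%:E); last exact: lebesgue_cube (ltW rr0).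
    rewrite muleAC -EFinM (_ : g * c / w * v = C)%R//.
    by rewrite /c; field; rewrite !gt_eqF.
  apply: ge0_le_integral.
  - exact: measurableT.
  - by move=> y _; rewrite !mule_ge0 ?lee_fin.
  - exact: measurable_funeM.
  - exact: (emeasurable_funM mGx (emeasurable_funM mch mQ)).
  - move=> y _; apply: lee_mul_indic; have [yz|yz] := pselect (cube z (r + r) y).
      by right; split; [exact: iQ1|exact: near].
    by left; exact: iQ0.
apply: (@le_trans _ _ (\int[mu]_y (G (x - y)%R * (f y * (\1_(cube z (r + r)) y)%:E)) + C%:E * h x)).
  rewrite -ge0_integralZl; last 4 first.
  - exact: measurableT.
  - by apply: emeasurable_funM mf; exact: (measurableT_comp mk (measurable_sub x)).
  - by move=> u _; rewrite mule_ge0.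
  - by rewrite lee_fin ltW.
  rewrite -ge0_integralD; last 5 first.
  - exact: measurableT.
  - by move=> y _; rewrite !mule_ge0.
  - exact: (emeasurable_funM mGx (emeasurable_funM mf mQ)).
  - by move=> y _; rewrite !mule_ge0.
  - apply: measurable_funeM.
    by apply: emeasurable_funM mf; exact: (measurableT_comp mk (measurable_sub x)).
  apply: ge0_le_integral.
  - exact: measurableT.
  - by move=> y _; rewrite !mule_ge0.
  - exact: emeasurable_funM.
  - apply: emeasurable_funD.
      exact: (emeasurable_funM mGx (emeasurable_funM mf mQ)).
    apply: measurable_funeM.
    by apply: emeasurable_funM mf; exact: (measurableT_comp mk (measurable_sub x)).
  - move=> y _; have [yz|yz] := pselect (cube z (r + r) y).
      by rewrite (iQ1 _ yz) mule1 leeDl// !mule_ge0.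
    rewrite (iQ0 _ yz) mule0 mule0 add0e muleA; apply: lee_wpmul2r => //.
    have [i yi] : exists i, (r + r < `|y ord0 i - z ord0 i|)%R.
      apply: contrapT => nx; apply: yz => i; rewrite leNgt; apply/negP => yi; apply: nx.
      by exists i.
    rewrite -EFinM; apply: (farP _ i); rewrite !mxE.
    have xi : (`|y ord0 i - z ord0 i| <= `|x ord0 i - z ord0 i| + `|x ord0 i - y ord0 i|)%R.
      by rewrite (_ : y ord0 i - _ = (x ord0 i - z ord0 i) - (x ord0 i - y ord0 i))%R ?ler_normB//; ring.
    by rewrite -(ltrD2l r); apply: (lt_le_trans yi); apply: (le_trans xi); rewrite lerD2r; exact: xz.
apply: le_trans (leeD2l _ far) _.
rewrite -ge0_integralD; last 5 first.
- exact: measurableT.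
- by move=> y _; rewrite !mule_ge0.
- exact: (emeasurable_funM mGx (emeasurable_funM mf mQ)).
- by move=> y _; rewrite !mule_ge0.
- exact: (emeasurable_funM mGx (emeasurable_funM mch mQ)).
apply: eqW_le; apply: eq_integral => y _.
have ch0 : 0 <= c%:E * h y by rewrite mule_ge0 ?lee_fin ?(ltW c0).
by rewrite -ge0_muleDr ?mule_ge0// -ge0_muleDl.
Qed.

Lemma indic_cube (r : R) (z y : 'rV[R]_n) : \1_(cube 0%R r) (z - y)%R = \1_(cube z r) y :> R.
Proof.
rewrite !indicE; congr ((nat_of_bool _)%:R)%R; apply/idP/idP; rewrite !inE => h i.
  by have := h i; rewrite !mxE subr0 distrC.
by rewrite !mxE subr0 distrC; exact: h.
Qed.

Lemma measure_le_capacity a' : (0 < a')%R -> (a' <= a)%R -> (a' < n%:R / s)%R ->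
  exists2 C : R, (0 < C)%R & forall (K : set 'rV[R]_n), measurable K ->
    (mu K) `^ (1 - a' * s / n%:R)%R <= C%:E * capacity a s K.
Proof.
move=> a'0 aa an; have [C C0 CP] := measure_le_admissible a'0 aa an.
exists C => // K mK; rewrite capacity_bessel -lee_pdivrMl//; apply: le_ereal_inf_tmp => _ [f fK <-].
by rewrite lee_pdivrMl//; exact: CP.
Qed.

Lemma capacity_cube_le (r : R) : (0 < r)%R ->
  exists2 C : R, (0 < C)%R & forall z : 'rV[R]_n, capacity a s (cube z r) <= C%:E.
Proof.
move=> r0; have [C C0 CP] := bessel_admissible_cube r0; exists C => // z.
by have [f fz fC] := CP z; apply: le_trans fC; exact: capacity_le_admissible.
Qed.

Lemma capacity_cubes (r : R) : (0 < n)%N -> (0 < r)%R ->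
  exists2 C : R, (0 < C)%R & forall K : set 'rV[R]_n, 0 < capacity a s K -> capacity a s K < +oo ->
    exists v : 'rV[R]_n -> \bar R, [/\ lebesgue_measurable v, forall z, 0 <= v z,
      forall z, capacity a s (K `&` cube z r) <= v z & \int[mu]_z v z <= C%:E * capacity a s K].
Proof.
move=> n0 r0; have [C C0 CP] := bessel_quasi_additivity n0 r0.
have rr0 : (0 < r + r)%R by rewrite addr_gt0.
pose V := ((2 * (r + r)) ^+ n : R)%R.
have V0 : (0 < V)%R by rewrite exprn_gt0// mulr_gt0.
exists (V * (C * 2))%R; first by rewrite !mulr_gt0.
move=> K K0 Koo.
have Kf : capacity a s K \is a fin_num by rewrite ge0_fin_numE// capacity_ge0.
have [f fK fle] : exists2 f, bessel_admissible K f & \int[mu]_x f x `^ s <= 2%:E * capacity a s K.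
  move: (K0) (Kf) (Koo); rewrite capacity_bessel => K1 K2 K3.
  have [_ [f fK <-] fe] := lb_ereal_inf_adherent (fine_gt0 (introT andP (conj K1 K3))) K2.
  exists f => //; apply: (le_trans (ltW fe)).
  by rewrite fineK// mule_natl mule2n.
have [F [mF F0 FC FP]] := CP K f fK.
have mFs : lebesgue_measurable (fun x => F x `^ s) by exact: (measurableT_comp (measurable_poweR s) mF).
have Fs0 x : 0 <= F x `^ s by exact: poweR_ge0.
pose k (x : 'rV[R]_n) : \bar R := (\1_(cube 0%R (r + r)) x)%:E.
have mk : measurable_fun setT k.
  by apply/measurable_EFinP; apply: measurable_indic; exact: measurable_cube.
have k0 x : 0 <= k x by rewrite lee_fin.
have kN x : k (- x)%R = k x by rewrite /k -sub0r indic_cube.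
exists (fun z => \int[mu]_y (k (z - y)%R * F y `^ s)); split.
- exact: measurable_potential.
- by move=> z; apply: integral_ge0 => y _; rewrite mule_ge0.
- move=> z; apply: le_trans (capacity_le_admissible (FP z)) _.
  apply: eqW_le; apply: eq_integral => y _.
  rewrite /k indic_cube indicE; case: (_ \in _); first by rewrite mule1 mul1e.
  by rewrite mule0 mul0e poweR0r// gt_eqF.
rewrite (integral_potential mk k0 kN mFs Fs0).
rewrite integral_indic; [|exact: measurableT|exact: measurable_rV_Rn (measurable_cube _ _)].
rewrite setIT (_ : _ (cube _ _) = V%:E); last exact: lebesgue_cube (ltW rr0).
rewrite (EFinM V) -muleA; apply: lee_wpmul2l; first by rewrite lee_fin ltW.
apply: le_trans FC _; rewrite EFinM -muleA; apply: lee_wpmul2l => //.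
by rewrite lee_fin ltW.
Qed.

End bessel_capacity_theory.

(** * Lorentz norms *)

Section lorentz.
Context (R : realType) (n : nat) (p q : R).
Hypothesis q0 : 0 < q.
Hypothesis p0 : 0 < p.
Local Notation mu := (@lebesgue_rV R n).
Local Open Scope ereal_scope.

Definition level_set (f : 'rV[R]_n -> \bar R) (K : set 'rV[R]_n) (t : R) : set 'rV[R]_n :=
  [set x | K x /\ t%:E < `|f x|].

Definition lorentz_energy (f : 'rV[R]_n -> \bar R) (K : set 'rV[R]_n) : \bar R :=
  \int[lebesgue_measure]_(t in `]0%R, +oo[) (mu (level_set f K t) `^ (q / p) * (t `^ q / t)%:E).

Lemma lorentz_norm_restr f K :
  lorentz_norm p q (restr f K) = (p `^ q^-1)%:E * lorentz_energy f K `^ q^-1.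
Proof.
rewrite /lorentz_norm /lorentz_energy; congr (_ * _ `^ _).
apply: eq_integral => t; rewrite inE/= in_itv/= andbT => t0.
congr (mu _ `^ _ * _); apply/seteqP; split => x /=; rewrite /restr /level_set/= indicE.
  have [xK|xK] := pselect (K x); first by rewrite (mem_set xK) mule1.
  by rewrite (memNset xK) mule0 abse0 lte_fin ltNge (ltW t0).
by move=> [Kx ?]; rewrite (mem_set Kx) mule1.
Qed.

Lemma lorentz_energy_ge0 f K : 0 <= lorentz_energy f K.
Proof.
apply: integral_ge0 => t /=; rewrite in_itv/= andbT => t0.
by rewrite mule_ge0 ?poweR_ge0// lee_fin divr_ge0 ?powR_ge0// ltW.
Qed.

Lemma lorentz_ratio_le (I : \bar R) (c L : R) : 0 <= I -> (0 < c)%R -> (0 <= L)%R ->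
  ((p `^ q^-1)%:E * I `^ q^-1 / c%:E `^ q^-1 <= L%:E) = (p%:E * I <= (L `^ q * c)%:E).
Proof.
move=> I0 c0 L0; have qv : (0 < q^-1)%R by rewrite invr_gt0.
have cq : (0 < c `^ q^-1)%R by rewrite powR_gt0.
have pq : (0 < p `^ q^-1)%R by rewrite powR_gt0.
rewrite poweR_EFin inver gt_eqF//.
case: I I0 => [i||]//; last first.
  move=> _; rewrite poweRyr ?gt_eqF// gt0_muley ?lte_fin// gt0_mulye ?lte_fin ?invr_gt0//.
  by rewrite gt0_muley ?lte_fin.
rewrite lee_fin => i0; rewrite poweR_EFin -!EFinM !lee_fin -powRM ?(ltW p0)//.
have pi0 : (0 <= p * i)%R by rewrite mulr_ge0// ltW.
have Lc0 : (0 <= L `^ q * c)%R by rewrite mulr_ge0 ?powR_ge0// ltW.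
rewrite ler_pdivrMr//.
have -> : (L * c `^ q^-1 = (L `^ q * c) `^ q^-1)%R.
  by rewrite powRM ?powR_ge0 ?(ltW c0)// -powRrM mulfV ?gt_eqF// powRr1.
apply/idP/idP => h; last by apply: (ge0_ler_powR (ltW qv)); rewrite ?nnegrE.
have := @ge0_ler_powR R q (ltW q0) _ _ _ _ h; rewrite !nnegrE !powR_ge0 -!powRrM mulVf ?gt_eqF//.
by rewrite !powRr1// => ->.
Qed.

Lemma measurable_level_set f K t : lebesgue_measurable f -> measurable K ->
  measurable (level_set f K t : set (Rn R n)).
Proof.
move=> mf mK; apply: measurableI; first exact: measurable_rV_Rn.
rewrite -[X in measurable X]setTI; apply: measurable_lte; first exact: measurableT.
- exact: measurable_cst.
- exact: (measurableT_comp (@abse_measurable R setT) mf).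
Qed.

Lemma measurable_level_cube f K r : lebesgue_measurable f -> measurable K ->
  measurable_fun setT (fun z : Rn R n * measurableTypeR R => mu (level_set f K z.2 `&` cube (z.1 : 'rV[R]_n) r)).
Proof.
move=> mf mK.
pose S := [set w : (Rn R n * measurableTypeR R) * Rn R n |
   level_set f K w.1.2 w.2 /\ cube (w.1.1 : 'rV[R]_n) r w.2].
have mS : measurable S.
  have mS1 : measurable [set w : (Rn R n * measurableTypeR R) * Rn R n | K w.2].
    rewrite -[X in measurable X]setTI; apply: measurable_snd; first exact: measurableT.
    exact: measurable_rV_Rn.
  have mS2 : measurable [set w : (Rn R n * measurableTypeR R) * Rn R n | (w.1.2)%:E < `|f w.2|].
    rewrite -[X in measurable X]setTI; apply: measurable_lte; first exact: measurableT.
    - by apply/measurable_EFinP; exact: (measurableT_comp measurable_snd measurable_fst).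
    - apply: (measurableT_comp (@abse_measurable R setT)).
      exact: (measurableT_comp mf measurable_snd).
  have mS3 : measurable [set w : (Rn R n * measurableTypeR R) * Rn R n | cube 0%R r (w.1.1 - w.2 : 'rV[R]_n)%R].
    have mp : measurable_fun setT (fun w : (Rn R n * measurableTypeR R) * Rn R n => (w.1.1 - w.2)%R : 'rV[R]_n).
      apply: measurable_rV_affine.
      - apply: (measurableT_comp (@measurable_Rn_id R n)).
        exact: (measurableT_comp measurable_fst measurable_fst).
      - exact: (measurableT_comp (@measurable_Rn_id R n) measurable_snd).
    rewrite -[X in measurable X]setTI; apply: mp; first exact: measurableT.
    exact: measurable_cube.
  rewrite (_ : S = [set w | K w.2] `&` [set w | (w.1.2)%:E < `|f w.2|] `&`
    [set w | cube 0%R r (w.1.1 - w.2 : 'rV[R]_n)%R]).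
    by apply: measurableI mS3; exact: measurableI.
  by apply/seteqP; split=> -[[z t] x] [h1 h2]; split=> // i; have := h2 i;
    rewrite /= !mxE subr0 distrC.
have := measurable_fun_xsection mu mS.
rewrite (_ : mu \o xsection S = fun z => mu (level_set f K z.2 `&` cube (z.1 : 'rV[R]_n) r))//.
apply/funext => z; congr (mu _); apply/seteqP; split=> x.
  by rewrite /xsection/= inE.
by move=> h; rewrite /xsection/= inE.
Qed.

Let weight (t : measurableTypeR R) : \bar R := (\1_(`]0%R, +oo[%classic : set (measurableTypeR R)) t * (t `^ q / t))%:E.

Let weight_ge0 t : 0 <= weight t.
Proof.
rewrite /weight lee_fin indicE; case: (boolP (_ \in _)); last by rewrite mul0r.
by rewrite inE/= in_itv/= andbT => t0; rewrite mul1r divr_ge0 ?powR_ge0// ltW.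
Qed.

Let weight_pos t : (0 < t)%R -> weight t = (t `^ q / t)%:E.
Proof. by move=> t0; rewrite /weight indicE mem_set ?mul1r//= in_itv/= t0. Qed.

Let measurable_weight : measurable_fun setT weight.
Proof.
apply/measurable_EFinP; rewrite (_ : (fun _ => _) = fun t : measurableTypeR R =>
  (\1_(`]0%R, +oo[%classic : set (measurableTypeR R)) t * (t `^ q * t `^ (-1)))%R).
  apply: measurable_funM; first by apply: measurable_indic; exact: measurable_itv.
  by apply: measurable_funM; exact: measurable_powR.
apply/funext => t; rewrite indicE; case: (boolP (_ \in _)); last by rewrite !mul0r.
by rewrite inE/= in_itv/= andbT => t0; rewrite powR_inv1// ltW.
Qed.

Let lorentz_energyE f K :
  lorentz_energy f K = \int[lebesgue_measure]_t (mu (level_set f K t) `^ (q / p) * weight t).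
Proof.
rewrite /lorentz_energy integral_mkcond; apply: eq_integral => t _.
rewrite patchE; case: ifPn => [|t0]; last by rewrite /weight indicE (negbTE t0) mul0r mule0.
by rewrite inE/= in_itv/= andbT => t0; rewrite weight_pos.
Qed.

Let measurable_level f K : lebesgue_measurable f -> measurable K ->
  measurable_fun setT (fun t : measurableTypeR R => mu (level_set f K t)).
Proof.
move=> mf mK.
pose S := [set w : measurableTypeR R * Rn R n | level_set f K w.1 w.2].
have mS : measurable S.
  have mS1 : measurable [set w : measurableTypeR R * Rn R n | K w.2].
    rewrite -[X in measurable X]setTI; apply: measurable_snd; first exact: measurableT.
    exact: measurable_rV_Rn.
  apply: (measurableI _ _ mS1).
  rewrite -[X in measurable X]setTI; apply: measurable_lte; first exact: measurableT.
  - by apply/measurable_EFinP; exact: measurable_fst.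
  - apply: (measurableT_comp (@abse_measurable R setT)).
    exact: (measurableT_comp mf measurable_snd).
have := measurable_fun_xsection mu mS.
rewrite (_ : mu \o xsection S = fun t => mu (level_set f K t))//.
apply/funext => z; congr (mu _); apply/seteqP; split=> x.
  by rewrite /xsection/= inE.
by move=> h; rewrite /xsection/= inE.
Qed.

(* As 0 < theta <= 1, mu(A `&` Q)^theta >= mu(A)^(theta - 1) * mu(A `&` Q), and averaging
   the right-hand side over the translates Q of a cube gives mu(A)^theta * |Q|. *)
Lemma measure_poweR_cubes (A : set 'rV[R]_n) (r theta : R) : measurable (A : set (Rn R n)) ->
  mu A < +oo -> (0 < r)%R -> (0 < theta <= 1)%R ->
  ((2 * r) ^+ n)%:E * mu A `^ theta <= \int[mu]_z (mu (A `&` cube z r) `^ theta).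
Proof.
move=> mA Aoo r0 /andP[th0 th1].
have mc z : measurable (cube z r : set (Rn R n)) by exact: measurable_rV_Rn (measurable_cube _ _).
pose k (x : 'rV[R]_n) : \bar R := (\1_(cube 0%R r) x)%:E.
have mk : measurable_fun setT k.
  by apply/measurable_EFinP; apply: measurable_indic; exact: measurable_cube.
have k0 x : 0 <= k x by rewrite lee_fin.
have kN x : k (- x)%R = k x by rewrite /k -sub0r indic_cube.
pose u (x : 'rV[R]_n) : \bar R := (\1_A x)%:E.
have mu' : lebesgue_measurable u by apply/measurable_EFinP; exact: measurable_indic.
have u0 x : 0 <= u x by rewrite lee_fin.
have IE z : \int[mu]_y (k (z - y)%R * u y) = mu (A `&` cube z r).
  have := integral_indic mu measurableT (measurableI _ _ mA (mc z)); rewrite setIT => <-.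
  apply: eq_integral => y _.
  by rewrite /k indic_cube -EFinM indicI mulrC.
have mP : lebesgue_measurable (fun z => mu (A `&` cube z r)).
  have := measurable_potential mk k0 mu' u0.
  by rewrite (_ : (fun x => _) = fun z => mu (A `&` cube z r))//; apply/funext => z; exact: IE.
have ip : \int[mu]_z mu (A `&` cube z r) = ((2 * r) ^+ n)%:E * mu A.
  rewrite -(lebesgue_cube (0%R : 'rV[R]_n) (ltW r0)).
  have := integral_potential mk k0 kN mu' u0.
  under [LHS]eq_integral do rewrite IE.
  move=> ->; congr (_ * _).
    by rewrite integral_indic ?setIT//.
  by rewrite integral_indic ?setIT//.
have Af : mu A = (fine (mu A))%:E by rewrite fineK// ge0_fin_numE.
set b := fine (mu A) in Af.
have b0 : (0 <= b)%R by rewrite fine_ge0.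
have [bz|bz] := eqVneq b 0%R.
  rewrite Af bz poweR0r ?gt_eqF// mule0; apply: integral_ge0 => z _; exact: poweR_ge0.
have bp : (0 < b)%R by rewrite lt0r bz.
have -> : ((2 * r) ^+ n)%:E * mu A `^ theta = \int[mu]_z ((b `^ (theta - 1))%:E * mu (A `&` cube z r)).
  rewrite ge0_integralZl//; last by rewrite lee_fin powR_ge0.
  rewrite ip muleCA; congr (_ * _); rewrite Af poweR_EFin -EFinM; congr EFin.
  by rewrite mulrC mulr_powRB1.
apply: ge0_le_integral.
- exact: measurableT.
- by move=> z _; rewrite mule_ge0// lee_fin powR_ge0.
- exact: (measurable_funeM _ mP).
- exact: (measurableT_comp (measurable_poweR theta) mP).
move=> z _.
have Ab : mu (A `&` cube z r) <= b%:E.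
  by rewrite -Af; apply: le_measure; rewrite ?inE//; exact: measurableI.
have : 0 <= mu (A `&` cube z r) by [].
case: (mu (A `&` cube z r)) Ab => [w||]//; rewrite !lee_fin => wb w0.
have [->|wz] := eqVneq w 0%R; first by rewrite mulr0 powR_ge0.
have wp : (0 < w)%R by rewrite lt0r wz.
rewrite -(mulr_powRB1 (ltW wp) th0) mulrC ler_pM2l//.
rewrite -opprB !powRN lef_pV2 ?posrE ?powR_gt0//.
by apply: ge0_ler_powR; rewrite ?nnegrE ?subr_ge0// ltW.
Qed.

Lemma lorentz_energy_cubes (f : 'rV[R]_n -> \bar R) (K : set 'rV[R]_n) (r : R)
    (v : 'rV[R]_n -> \bar R) :
  lebesgue_measurable f -> measurable K -> mu K < +oo -> (0 < r)%R -> (q <= p)%R ->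
  lebesgue_measurable v -> (forall z, lorentz_energy f (K `&` cube z r) <= v z) ->
  ((2 * r) ^+ n)%:E * lorentz_energy f K <= \int[mu]_z v z.
Proof.
move=> mf mK Koo r0 qp mv fv.
have th01 : (0 < q / p <= 1)%R by rewrite divr_gt0// ler_pdivrMr// mul1r.
have V0 : 0 <= ((2 * r) ^+ n)%:E :> \bar R by rewrite lee_fin exprn_ge0// mulr_ge0// ltW.
have mlc := @measurable_level_cube f K r mf mK.
pose F (w : Rn R n * measurableTypeR R) : \bar R :=
  mu (level_set f K w.2 `&` cube (w.1 : 'rV[R]_n) r) `^ (q / p) * weight w.2.
have mF : measurable_fun setT F.
  apply: emeasurable_funM.
    exact: (measurableT_comp (measurable_poweR (q / p)) mlc).
  exact: (measurableT_comp measurable_weight measurable_snd).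
have F0 w : 0 <= F w by rewrite mule_ge0 ?poweR_ge0.
have mlt t : measurable_fun setT (fun z : Rn R n => mu (level_set f K t `&` cube (z : 'rV[R]_n) r) `^ (q / p)).
  exact: (measurableT_comp (measurable_poweR (q / p)) (measurableT_comp mlc (pair2_measurable t))).
have mw : measurable_fun setT (fun t : measurableTypeR R => mu (level_set f K t) `^ (q / p) * weight t).
  apply: emeasurable_funM measurable_weight.
  exact: (measurableT_comp (measurable_poweR (q / p)) (measurable_level mf mK)).
have FE z : lorentz_energy f (K `&` cube z r) = \int[lebesgue_measure]_t F (z, t).
  rewrite lorentz_energyE; apply: eq_integral => t _.
  congr (mu _ `^ _ * _); apply/seteqP; split=> x; rewrite /level_set/=.
    by move=> [[? ?] ?].
  by move=> [[? ?] ?].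
apply: (@le_trans _ _ (\int[mu]_z \int[lebesgue_measure]_t F (z, t))); last first.
  apply: ge0_le_integral.
  - exact: measurableT.
  - by move=> z _; apply: integral_ge0 => t _; exact: F0.
  - exact: (measurable_fun_fubini_tonelli_F (m2 := lebesgue_measure) F mF F0).
  - exact: mv.
  - by move=> z _; rewrite -FE; exact: fv.
rewrite (fubini_tonelli (m1 := mu) (m2 := lebesgue_measure) F mF F0).
rewrite lorentz_energyE -ge0_integralZl; last 4 first.
- exact: measurableT.
- exact: mw.
- by move=> t _; rewrite mule_ge0 ?poweR_ge0.
- exact: V0.
apply: ge0_le_integral.
- exact: measurableT.
- by move=> t _; rewrite !mule_ge0 ?poweR_ge0.
- exact: (measurable_funeM _ mw).
- exact: (measurable_fun_fubini_tonelli_G (m1 := mu) F mF F0).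
move=> t _; rewrite /F/= ge0_integralZr; last 4 first.
- exact: measurableT.
- exact: mlt.
- by move=> z _; exact: poweR_ge0.
- exact: weight_ge0.
rewrite muleA; apply: lee_wpmul2r; first exact: weight_ge0.
apply: measure_poweR_cubes => //; first exact: measurable_level_set.
apply: le_lt_trans Koo; apply: le_measure; rewrite ?inE.
- exact: measurable_level_set.
- exact: measurable_rV_Rn.
- by move=> x [].
Qed.

Lemma measurable_lorentz_integrand f K : lebesgue_measurable f -> measurable K ->
  measurable_fun (`]0%R, +oo[%classic : set (measurableTypeR R))
    (fun t : measurableTypeR R => mu (level_set f K t) `^ (q / p) * (t `^ q / t)%:E).
Proof.
move=> mf mK.
apply: (eq_measurable_fun (fun t : measurableTypeR R => mu (level_set f K t) `^ (q / p) * weight t)).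
  by move=> t; rewrite inE/= in_itv/= andbT => t0; rewrite weight_pos.
apply: measurable_funTS; apply: emeasurable_funM measurable_weight.
exact: (measurableT_comp (measurable_poweR (q / p)) (measurable_level mf mK)).
Qed.

Let powRB1_div t : (0 < t -> t `^ (q - 1) = t `^ q / t)%R.
Proof. by move=> t0; rewrite -(mulr_powRB1 (ltW t0) q0) mulrC mulKf// gt_eqF. Qed.

Let le_level f K t : lebesgue_measurable f -> measurable K -> mu (level_set f K t) <= mu K.
Proof.
move=> mf mK; apply: le_measure; rewrite ?inE.
- exact: measurable_level_set.
- exact: measurable_rV_Rn.
- by move=> x [].
Qed.

Lemma lorentz_energy_bounded (f : 'rV[R]_n -> \bar R) (K : set 'rV[R]_n) (M : R) :
  lebesgue_measurable f -> measurable K -> (0 <= M)%R ->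
  (forall t, (M < t)%R -> mu (level_set f K t) = 0) ->
  lorentz_energy f K <= mu K `^ (q / p) * (M `^ q / q)%:E.
Proof.
move=> mf mK M0 fM; have th0 : (0 < q / p)%R by rewrite divr_gt0.
have K0 : 0 <= mu K `^ (q / p) by exact: poweR_ge0.
pose J : set (measurableTypeR R) := `]0%R, M]%classic.
have mJ : measurable J by exact: measurable_itv.
have JE t : (t \in J) = (0 < t <= M)%R by apply/idP/idP; rewrite inE /J /= in_itv.
have mpow : measurable_fun J (fun t => (t `^ (q - 1))%:E : \bar R) by exact: measurable_powR_EFin.
apply: (@le_trans _ _ (mu K `^ (q / p) * \int[lebesgue_measure]_(t in J) (t `^ (q - 1))%:E)); last first.
  apply: lee_wpmul2l => //; have [Mz|Mz] := eqVneq M 0%R.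
    have -> : J = set0.
      apply/seteqP; split=> // u; rewrite /J Mz /= in_itv/= => /andP[u0 /(lt_le_trans u0)].
      by rewrite ltxx.
    by rewrite integral_set0 lee_fin divr_ge0 ?powR_ge0// ltW.
  by apply: integral_powR0 => //; rewrite lt0r Mz.
rewrite lorentz_energyE -ge0_integralZl//; last by move=> t _; rewrite lee_fin powR_ge0.
rewrite [leRHS]integral_mkcond; apply: ge0_le_integral.
- exact: measurableT.
- by move=> t _; rewrite mule_ge0 ?poweR_ge0.
- apply: emeasurable_funM measurable_weight.
  exact: (measurableT_comp (measurable_poweR (q / p)) (measurable_level mf mK)).
- by apply/(measurable_restrictT _ mJ); exact: measurable_funeM.
move=> t _; rewrite patchE; case: ifPn => tJ.
  move: (tJ); rewrite JE => /andP[t0 _].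
  rewrite (weight_pos t0) (powRB1_div t0).
  apply: lee_wpmul2r; first by rewrite lee_fin divr_ge0 ?powR_ge0// ltW.
  by apply: lee_poweR2; [exact: ltW|exact: measure_ge0|exact: le_level].
have [t0|t0] := ltP 0%R t; last first.
  by rewrite /weight indicE memNset ?mul0r ?mule0//= in_itv/= andbT; apply/negP; rewrite -leNgt.
rewrite fM ?poweR0r ?mul0e ?gt_eqF// ltNge; apply/negP => tM.
by move/negP: tJ; apply; rewrite JE t0.
Qed.

Lemma level_set_le_lorentz_energy (f : 'rV[R]_n -> \bar R) (K : set 'rV[R]_n) (t : R) :
  lebesgue_measurable f -> measurable K -> (1 <= q)%R -> (0 < t)%R ->
  mu (level_set f K t) `^ (q / p) * ((t / 2) `^ q)%:E <= lorentz_energy f K.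
Proof.
move=> mf mK q1 t0; have th0 : (0 < q / p)%R by rewrite divr_gt0.
have t20 : (0 < t / 2)%R by rewrite divr_gt0.
pose J : set (measurableTypeR R) := `](t / 2)%R, t]%classic.
have mJ : measurable J by exact: measurable_itv.
have mw : measurable_fun setT (fun t : measurableTypeR R => mu (level_set f K t) `^ (q / p) * weight t).
  apply: emeasurable_funM measurable_weight.
  exact: (measurableT_comp (measurable_poweR (q / p)) (measurable_level mf mK)).
have w0 u : 0 <= mu (level_set f K u) `^ (q / p) * weight u by rewrite mule_ge0 ?poweR_ge0.
rewrite lorentz_energyE.
apply: (@le_trans _ _ (\int[lebesgue_measure]_(u in J) (mu (level_set f K u) `^ (q / p) * weight u))); last first.
  by apply: ge0_subset_integral.
have -> : mu (level_set f K t) `^ (q / p) * ((t / 2) `^ q)%:E =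
    \int[lebesgue_measure]_(u in J) (mu (level_set f K t) `^ (q / p) * ((t / 2) `^ (q - 1))%:E).
  have h2 : (t / 2 < t)%R by rewrite ltr_pdivrMr// ltr_pMr// ltr1n.
  rewrite integral_cst// [X in _ = _ * X](_ : _ = (t / 2)%:E).
    by rewrite -muleA -EFinM (powRB1_div t20) divfK// gt_eqF.
  rewrite /= lebesgue_measure_itv/= lte_fin h2 -EFinB; congr EFin; by field.
apply: ge0_le_integral => //.
- by move=> u _; rewrite mule_ge0 ?poweR_ge0// lee_fin powR_ge0.
- exact: measurable_funTS.
move=> u; rewrite /J/= in_itv/= => /andP[tu ut].
have u0 := lt_trans t20 tu.
apply: lee_pmul; [exact: poweR_ge0|by rewrite lee_fin powR_ge0| |].
  apply: lee_poweR2; [exact: ltW|exact: measure_ge0|].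
  apply: le_measure; rewrite ?inE; [exact: measurable_level_set..|].
  by move=> x [Kx tx]; split=> //; apply: le_lt_trans tx; rewrite lee_fin.
rewrite (weight_pos u0) lee_fin -(powRB1_div u0).
by apply: ge0_ler_powR; rewrite ?nnegrE ?subr_ge0// ltW.
Qed.

End lorentz.

(* The q-integrand is the r-integrand times (t mu(|f| > t)^(1/p))^(q - r), and
   Chebyshev's inequality bounds that factor by a power of the r-energy. *)
Lemma lorentz_energy_embed (R : realType) (n : nat) (p r q : R) (f : 'rV[R]_n -> \bar R) (K : set 'rV[R]_n) :
  lebesgue_measurable f -> measurable K -> 0 < p -> 1 <= r -> r < q ->
  (lorentz_energy p q f K <= (2 `^ (q - r))%:E * (lorentz_energy p r f K) `^ (q / r))%E.
Proof.
move=> mf mK p0 r1 rq; have r0 : 0 < r by exact: lt_le_trans r1.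
have q0 : 0 < q by exact: lt_trans rq.
have qr0 : 0 < q / r by rewrite divr_gt0.
have D0 : 0 <= (q - r) / r by rewrite divr_ge0 ?subr_ge0 ?ltW.
have E0 := @lorentz_energy_ge0 R n p r f K.
have wk := fun t => @level_set_le_lorentz_energy R n p r r0 p0 f K t mf mK r1.
move: E0 wk; case eE : (lorentz_energy p r f K) => [e||]//; last first.
  by move=> _ _; rewrite poweRyr ?gt_eqF// gt0_muley ?leey// lte_fin powR_gt0.
rewrite lee_fin => e0 wk.
pose c := 2 `^ (q - r) * e `^ ((q - r) / r).
have c0 : 0 <= c by rewrite mulr_ge0 ?powR_ge0.
apply: (@le_trans _ _ (c%:E * lorentz_energy p r f K)%E); last first.
  rewrite eE poweR_EFin -!EFinM lee_fin /c -mulrA ler_wpM2l ?powR_ge0//.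
  rewrite (_ : (q - r) / r = q / r - 1); last by field; rewrite gt_eqF.
  by rewrite mulrC mulr_powRB1.
rewrite -ge0_integralZl//; last 2 first.
- exact: measurable_lorentz_integrand.
- move=> t /=; rewrite in_itv/= andbT => t0.
  by rewrite mule_ge0 ?poweR_ge0// lee_fin divr_ge0 ?powR_ge0// ltW.
apply: ge0_le_integral => //.
- move=> t /=; rewrite in_itv/= andbT => t0.
  by rewrite mule_ge0 ?poweR_ge0// lee_fin divr_ge0 ?powR_ge0// ltW.
- exact: measurable_lorentz_integrand.
- by apply: measurable_funeM; exact: measurable_lorentz_integrand.
move=> t /=; rewrite in_itv/= andbT => t0.
have t20 : 0 < t / 2 by rewrite divr_gt0.
have := wk t t0.
have : (0 <= @lebesgue_rV R n (level_set f K t))%E by exact: measure_ge0.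
case: (@lebesgue_rV R n (level_set f K t)) => [d||]//; last first.
  by move=> _; rewrite poweRyr ?gt_eqF ?divr_gt0// gt0_mulye ?lte_fin ?powR_gt0.
rewrite lee_fin => d0; rewrite !poweR_EFin -!EFinM !lee_fin => de.
have X0 : 0 <= d `^ (r / p) * (t / 2) `^ r by rewrite mulr_ge0 ?powR_ge0.
have h : (d `^ (r / p) * (t / 2) `^ r) `^ ((q - r) / r) <= e `^ ((q - r) / r).
  by apply: ge0_ler_powR; rewrite ?nnegrE.
have XE : (d `^ (r / p) * (t / 2) `^ r) `^ ((q - r) / r) = d `^ ((q - r) / p) * (t / 2) `^ (q - r).
  rewrite powRM ?powR_ge0// -!powRrM; congr (_ `^ _ * _ `^ _).
    by field; rewrite !gt_eqF.
  by field; rewrite gt_eqF.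
have dE : d `^ (q / p) = d `^ ((q - r) / p) * d `^ (r / p).
  rewrite -powRD; last by rewrite -mulrDl subrK gt_eqF// divr_gt0.
  by rewrite -mulrDl subrK.
have tE : t `^ q = 2 `^ (q - r) * (t / 2) `^ (q - r) * t `^ r.
  rewrite -powRM ?(ltW t20)// (mulrC 2) divfK// -powRD; last by rewrite (gt_eqF t0) implybT.
  by rewrite subrK.
rewrite dE tE /c.
apply: (@le_trans _ _ (2 `^ (q - r) * (d `^ ((q - r) / p) * (t / 2) `^ (q - r)) * (d `^ (r / p) * (t `^ r / t)))).
  by apply: eqW_le; ring.
apply: ler_wpM2r; first by rewrite !mulr_ge0 ?powR_ge0// invr_ge0 ltW.
by rewrite -XE ler_wpM2l// powR_ge0.
Qed.

(** * Comparison of the norms *)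

Section geometry.
Context (R : realType) (n : nat).
Implicit Types (x y v : 'rV[R]_n) (K : set 'rV[R]_n).

Lemma coord_le_enorm v i : `|v ord0 i| <= enorm v.
Proof.
rewrite /enorm -sqrtr_sqr ler_wsqrtr// /dot (bigD1 i)//= -expr2 lerDl sumr_ge0// => j _.
by rewrite -expr2 sqr_ge0.
Qed.

Lemma diam_sub_cube K x : (diam K <= 1)%E -> K x -> K `<=` cube x 1.
Proof.
move=> dK Kx y Ky i; have := coord_le_enorm (y - x) i; rewrite !mxE => /le_trans; apply.
rewrite -lee_fin; apply: le_trans dK; apply: ereal_sup_ubound.
by exists y, x.
Qed.

Lemma diam_cube K z : (0 < n)%N -> K `<=` cube z (2 * n%:R)^-1 -> (diam K <= 1)%E.
Proof.
move=> n0 Kz; have n0' : 0 < n%:R :> R by rewrite ltr0n.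
apply: ge_ereal_sup => _ [x [y [Kx Ky ->]]]; rewrite lee_fin /enorm -[leRHS](sqrtr1 R).
apply: ler_wsqrtr.
have xy i : `|(x - y) ord0 i| <= n%:R^-1.
  rewrite !mxE (_ : _ - _ = (x ord0 i - z ord0 i) - (y ord0 i - z ord0 i)); last by ring.
  apply: le_trans (ler_normB _ _) _; apply: le_trans (lerD (Kz _ Kx i) (Kz _ Ky i)) _.
  by apply: eqW_le; field; rewrite gt_eqF.
apply: (@le_trans _ _ (\sum_(i < n) n%:R^-1)); last first.
  by rewrite sumr_const card_ord -[leLHS]mulr_natr mulVf ?gt_eqF.
apply: ler_sum => i _; rewrite -expr2 -(real_normK (num_real _)).
apply: (@le_trans _ _ (n%:R^-1 ^+ 2)).
  by rewrite ler_sqr ?nnegrE// invr_ge0 ltW.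
by rewrite expr2 ler_piMl ?invr_ge0 ?(ltW n0')// invf_le1 ?ltr0n// ler1n.
Qed.

End geometry.

Section capacity.
Context (R : realType) (n : nat) (a s : R).
Hypothesis a0 : 0 < a.
Hypothesis s1 : 1 < s.
Local Notation mu := (@lebesgue_rV R n).
Local Open Scope ereal_scope.

Lemma capacity_cube_neq0 (z : 'rV[R]_n) (r : R) : (0 < n)%N -> (a * s <= n%:R)%R -> (0 < r)%R ->
  capacity a s (cube z r) != 0.
Proof.
move=> n0 asn r0.
have n0' : (0 < n%:R :> R)%R by rewrite ltr0n.
have s0 : (0 < s)%R by exact: lt_trans s1.
have h1 : (0 < a / 2)%R by rewrite divr_gt0.
have h2 : (a / 2 <= a)%R by rewrite ler_pdivrMr// ler_peMr ?ler1n// ltW.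
have h3 : (a / 2 < n%:R / s)%R.
  by rewrite ltr_pdivlMr// mulrAC ltr_pdivrMr//; nra.
have [C C0 CP] := measure_le_capacity a0 s1 h1 h2 h3.
have := CP _ (measurable_cube z r); rewrite (_ : mu _ = ((2 * r) ^+ n)%:E); last exact: lebesgue_cube (ltW r0).
apply: contraPneq => ->; rewrite mule0 poweR_EFin lee_fin leNgt => /negP; apply.
by rewrite powR_gt0// exprn_gt0// mulr_gt0.
Qed.

End capacity.

Section ratio.
Context (R : realType) (n : nat) (a s p q : R).
Hypothesis p0 : 0 < p.
Hypothesis q0 : 0 < q.
Local Notation mu := (@lebesgue_rV R n).
Local Open Scope ereal_scope.
Implicit Types (K : set 'rV[R]_n) (f : 'rV[R]_n -> \bar R).

Lemma capacitary_ratio_ge0 f K : 0 <= capacitary_ratio a s p q f K.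
Proof.
rewrite /capacitary_ratio mule_ge0 ?inve_ge0 ?poweR_ge0//.
by rewrite lorentz_norm_restr// mule_ge0 ?poweR_ge0// lee_fin powR_ge0.
Qed.

Lemma capacitary_ratio_pinfty f K : capacity a s K = +oo -> capacitary_ratio a s p q f K = 0.
Proof.
by move=> KE; rewrite /capacitary_ratio KE poweRyr ?gt_eqF ?invr_gt0// invey mule0.
Qed.

Lemma capacitary_ratio_leP f K (c L : R) : capacity a s K = c%:E -> (0 < c)%R -> (0 <= L)%R ->
  (capacitary_ratio a s p q f K <= L%:E) = (p%:E * lorentz_energy p q f K <= (L `^ q * c)%:E).
Proof.
move=> KE c0 L0; rewrite /capacitary_ratio KE lorentz_norm_restr//.
by rewrite lorentz_ratio_le// lorentz_energy_ge0.
Qed.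

End ratio.

Lemma lorentz_energy_null (R : realType) (n : nat) (p q : R) (f : 'rV[R]_n -> \bar R) (K : set 'rV[R]_n) :
  0 < p -> 0 < q -> lebesgue_measurable f -> measurable K -> @lebesgue_rV R n K = 0%E ->
  lorentz_energy p q f K = 0%E.
Proof.
move=> p0 q0 mf mK K0; apply/eqP; rewrite eq_le lorentz_energy_ge0// andbT.
have := @lorentz_energy_bounded R n p q q0 p0 f K 0 mf mK (lexx 0).
rewrite K0 poweR0r ?gt_eqF ?divr_gt0// mul0e; apply => t _.
apply/eqP; rewrite eq_le measure_ge0 andbT -K0; apply: le_measure; rewrite ?inE.
- exact: measurable_level_set.
- exact: measurable_rV_Rn.
- by move=> x [].
Qed.

Section embeddings.
Context (R : realType) (n : nat) (a s p q : R).
Hypothesis a0 : 0 < a.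
Hypothesis s1 : 1 < s.
Hypothesis n0 : (0 < n)%N.
Hypothesis asn : a * s <= n%:R.
Hypothesis q1 : 1 < q.
Hypothesis qp : q <= p.
Local Notation mu := (@lebesgue_rV R n).
Local Open Scope ereal_scope.
Implicit Types (K : set 'rV[R]_n) (f : 'rV[R]_n -> \bar R).

Let q0 : (0 < q)%R. Proof. exact: lt_trans q1. Qed.

Let p0 : (0 < p)%R. Proof. exact: lt_le_trans qp. Qed.

Let s0 : (0 < s)%R. Proof. exact: lt_trans s1. Qed.

Let n0' : (0 < n%:R :> R)%R. Proof. by rewrite ltr0n. Qed.

Let measure_capacity : exists2 k : R, (0 < k)%R & exists2 C : R, (0 < C)%R &
  forall K, measurable K -> mu K `^ k <= C%:E * capacity a s K.
Proof.
have h1 : (0 < a / 2)%R by rewrite divr_gt0.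
have h2 : (a / 2 <= a)%R by rewrite ler_pdivrMr// ler_peMr ?ler1n// ltW.
have h3 : (a / 2 * s < n%:R)%R.
  by rewrite mulrAC ltr_pdivrMr//; apply: (le_lt_trans asn); rewrite ltr_pMr// ltr1n.
have h4 : (a / 2 < n%:R / s)%R by rewrite ltr_pdivlMr.
exists (1 - a / 2 * s / n%:R)%R; first by rewrite subr_gt0 ltr_pdivrMr// mul1r.
have [C C0 CP] := measure_le_capacity a0 s1 h1 h2 h4.
by exists C.
Qed.

Let measure_lty K : measurable K -> capacity a s K < +oo -> mu K < +oo.
Proof.
move=> mK Koo; have [k k0 [C C0 CP]] := measure_capacity.
rewrite ltey; apply/eqP => Ky; have := CP K mK.
rewrite Ky poweRyr ?gt_eqF// leye_eq => /eqP E.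
have Kf : capacity a s K \is a fin_num by rewrite ge0_fin_numE ?capacity_ge0.
by move: E; rewrite -(fineK Kf) -EFinM.
Qed.

Let measure_null K : measurable K -> capacity a s K = 0 -> mu K = 0.
Proof.
move=> mK K0; have [k k0 [C C0 CP]] := measure_capacity.
have := CP K mK; rewrite K0 mule0 => h.
have : mu K `^ k == 0 by rewrite eq_le h poweR_ge0.
by move/eqP/poweR_eq0_eq0; apply; rewrite measure_ge0.
Qed.

Lemma capacitary_ratio_globalize : exists2 C : R, (0 < C)%R & forall f L, lebesgue_measurable f -> (0 <= L)%R ->
  (forall K, compact K -> capacity a s K != 0 -> diam K <= 1 -> capacitary_ratio a s p q f K <= L%:E) ->
  forall K, compact K -> capacity a s K != 0 -> capacitary_ratio a s p q f K <= (C * L)%:E.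
Proof.
pose r := ((2 * n%:R)^-1 : R)%R; have r0 : (0 < r)%R by rewrite invr_gt0 mulr_gt0.
have [C1 C10 CP] := capacity_cubes a0 s1 n0 r0.
pose V := ((2 * r) ^+ n)%R; have V0 : (0 < V)%R by rewrite exprn_gt0// mulr_gt0.
have CV0 : (0 < C1 / V)%R by rewrite divr_gt0.
exists ((C1 / V) `^ q^-1)%R; first by rewrite powR_gt0.
move=> f L mf L0 fL K cK Kn0.
have mK := compact_rV_measurable cK.
have [Koo|Koo] := eqVneq (capacity a s K) +oo.
  by rewrite capacitary_ratio_pinfty// lee_fin mulr_ge0// powR_ge0.
have Kpos : 0 < capacity a s K by rewrite lt0e Kn0 capacity_ge0.
have Klt : capacity a s K < +oo by rewrite ltey.
have Kc : capacity a s K = (fine (capacity a s K))%:E by rewrite fineK// ge0_fin_numE// ltW.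
have c0 : (0 < fine (capacity a s K))%R by rewrite fine_gt0// Kpos.
have Lq0 : (0 <= L `^ q / p)%R by rewrite divr_ge0 ?powR_ge0// ltW.
rewrite (capacitary_ratio_leP p0 q0 f Kc c0); last by rewrite mulr_ge0// powR_ge0.
have Kfin := measure_lty mK Klt.
have [v [mv v0 vP vI]] := CP K Kpos Klt.
have vb z : lorentz_energy p q f (K `&` cube z r) <= (L `^ q / p)%:E * v z.
  have mKz : measurable (K `&` cube z r) by apply: measurableI mK _; exact: measurable_cube.
  have cKz : compact (K `&` cube z r).
    apply: compact_closedI cK _; apply: compact_closed; first exact: norm_hausdorff.
    exact: compact_cube.
  have [K0|K0] := eqVneq (capacity a s (K `&` cube z r)) 0.
    rewrite lorentz_energy_null//; first by rewrite mule_ge0.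
    exact: measure_null.
  have dK : diam (K `&` cube z r) <= 1.
    by apply: (@diam_cube R n _ z n0) => x [].
  have Kz := fL _ cKz K0 dK.
  have KzK : capacity a s (K `&` cube z r) < +oo.
    by apply: le_lt_trans Klt; apply: le_capacity => x [].
  have Kzc : capacity a s (K `&` cube z r) = (fine (capacity a s (K `&` cube z r)))%:E.
    by rewrite fineK// ge0_fin_numE// capacity_ge0.
  have cz0 : (0 < fine (capacity a s (K `&` cube z r)))%R.
    by rewrite fine_gt0// KzK lt0e K0 capacity_ge0.
  have : p%:E * lorentz_energy p q f (K `&` cube z r) <= (L `^ q)%:E * v z.
    move: Kz; rewrite (capacitary_ratio_leP p0 q0 f Kzc cz0 L0) => /le_trans; apply.
    rewrite EFinM -Kzc; apply: lee_wpmul2l; first by rewrite lee_fin powR_ge0.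
    exact: vP.
  rewrite -lee_pdivlMl// => /le_trans; apply.
  by rewrite muleA -EFinM mulrC.
have mLv : lebesgue_measurable (fun z => (L `^ q / p)%:E * v z) by exact: (measurable_funeM _ mv).
have h := lorentz_energy_cubes q0 p0 mf mK Kfin r0 qp mLv vb.
have h2 : V%:E * lorentz_energy p q f K <= (L `^ q / p)%:E * (C1%:E * capacity a s K).
  apply: (le_trans h); rewrite ge0_integralZl; last 4 first.
  - exact: measurableT.
  - exact: mv.
  - by move=> z _; exact: v0.
  - by rewrite lee_fin.
  by apply: lee_wpmul2l; rewrite ?lee_fin.
move: h2; rewrite -lee_pdivlMl// => /(@lee_wpmul2l _ p%:E) -/(_ _) h2.
apply: (le_trans (h2 _)); first by rewrite lee_fin ltW.
rewrite Kc -!EFinM lee_fin powRM ?powR_ge0// -powRrM mulVf ?gt_eqF// powRr1 ?(ltW CV0)//.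
by apply: eqW_le; field; rewrite !gt_eqF.
Qed.

Hypothesis apq : (a * s = n%:R \/ ((n%:R - a * s) / n%:R <= q / p) /\ (a * s < n%:R))%R.

Lemma measure_poweR_le_capacity : exists2 C : R, (0 < C)%R & forall K, measurable K -> diam K <= 1 ->
  mu K `^ (q / p) <= C%:E * capacity a s K.
Proof.
have th0 : (0 < q / p)%R by rewrite divr_gt0.
have th1 : (q / p <= 1)%R by rewrite ler_pdivrMr// mul1r.
have [a' [a'0 aa an kth]] : exists a' : R, [/\ (0 < a')%R, (a' <= a)%R, (a' < n%:R / s)%R &
    (1 - a' * s / n%:R <= q / p)%R].
  case: apq => [asE|[nth aslt]].
    exists (n%:R * (1 - q / p / 2) / s)%R.
    have h : (0 < 1 - q / p / 2)%R by lra.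
    have h' : (1 - q / p / 2 < 1)%R by lra.
    split.
    - by rewrite divr_gt0// mulr_gt0.
    - by rewrite ler_pdivrMr// asE ler_piMr// ltW.
    - by rewrite ltr_pM2r ?invr_gt0// gtr_pMr.
    - rewrite divfK ?gt_eqF// mulrAC mulfV ?gt_eqF// mul1r; lra.
  exists a; split=> //; first by rewrite ltr_pdivlMr.
  by move: nth; rewrite mulrBl mulfV// gt_eqF.
have [C C0 CP] := measure_le_capacity a0 s1 a'0 aa an.
set k := (1 - _)%R in kth CP.
have W0 : (0 < 2 ^+ n :> R)%R by rewrite exprn_gt0.
exists ((2 ^+ n) `^ (q / p - k) * C)%R; first by rewrite mulr_gt0// powR_gt0.
move=> K mK dK; have [[x Kx]|K0] := pselect (K !=set0); last first.
  have -> : K = set0 by apply/seteqP; split=> // x Kx; apply: K0; exists x.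
  rewrite measure0 poweR0r ?gt_eqF// mule_ge0 ?capacity_ge0// lee_fin mulr_ge0 ?powR_ge0//.
  exact: ltW.
have KW : mu K <= (2 ^+ n)%:E.
  have := lebesgue_cube x (@ler01 R); rewrite mulr1 => <-.
  apply: le_measure; rewrite ?inE; [exact: measurable_rV_Rn..| |exact: diam_sub_cube].
  by apply: measurable_rV_Rn; exact: measurable_cube.
have := CP K mK.
have : 0 <= mu K by exact: measure_ge0.
case: (mu K) KW => [m||]//; rewrite !lee_fin => mW m0 h.
apply: (@le_trans _ _ (((2 ^+ n) `^ (q / p - k))%:E * (m%:E `^ k))); last first.
  by rewrite EFinM -muleA; apply: lee_wpmul2l => //; rewrite lee_fin powR_ge0.
rewrite !poweR_EFin -EFinM lee_fin -[X in (_ `^ X <= _)%R](subrK k) powRD; last first.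
  by rewrite subrK gt_eqF.
by rewrite ler_wpM2r ?powR_ge0//; apply: ge0_ler_powR; rewrite ?nnegrE ?subr_ge0 ?(ltW W0).
Qed.

Lemma capacitary_ratio_Linfty : exists2 C : R, (0 < C)%R & forall f (L : R), lebesgue_measurable f ->
  Linfty_norm f <= L%:E -> forall K, compact K -> capacity a s K != 0 -> diam K <= 1 ->
  capacitary_ratio a s p q f K <= (C * L)%:E.
Proof.
have [C C0 CP] := measure_poweR_le_capacity.
have B0 : (0 < p * C / q)%R by rewrite divr_gt0// mulr_gt0.
exists ((p * C / q) `^ q^-1)%R; first by rewrite powR_gt0.
move=> f L mf fL K cK Kn0 dK.
have mK := compact_rV_measurable cK.
have L0 : (0 <= L)%R by rewrite -lee_fin; apply: le_trans fL; exact: Lnorm_ge0.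
have BL0 : (0 <= (p * C / q) `^ q^-1 * L)%R by rewrite mulr_ge0 ?powR_ge0.
have [Koo|Koo] := eqVneq (capacity a s K) +oo.
  by rewrite capacitary_ratio_pinfty// lee_fin.
have Kpos : 0 < capacity a s K by rewrite lt0e Kn0 capacity_ge0.
have Klt : capacity a s K < +oo by rewrite ltey.
have Kc : capacity a s K = (fine (capacity a s K))%:E by rewrite fineK// ge0_fin_numE// ltW.
have c0 : (0 < fine (capacity a s K))%R by rewrite fine_gt0// Kpos.
rewrite (capacitary_ratio_leP p0 q0 f Kc c0)//.
have fn t : (L < t)%R -> mu (level_set f K t) = 0.
  move=> Lt; have muT : 0 < mu setT.
    apply: (@lt_le_trans _ _ (mu (cube (0%R : 'rV[R]_n) 1))).
      by rewrite lebesgue_cube// lte_fin exprn_gt0// mulr_gt0.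
    by apply: le_measure; rewrite ?inE//; apply: measurable_rV_Rn; exact: measurable_cube.
  have ae : \forall x \ae mu, (abse \o f) x <= L%:E.
    apply/ess_supP; move: fL; rewrite /Linfty_norm unlock /Lnorm/=.
    by rewrite ifT.
  case: ae => N [mN N0 sub].
  apply: (subset_measure0 (B := N)) => //.
    exact: measurable_level_set.
  move=> x [Kx tx]; apply: sub => /= h.
  by have := lt_le_trans tx h; rewrite lte_fin ltNge (ltW Lt).
have := lorentz_energy_bounded q0 p0 mf mK L0 fn.
move=> /(@lee_wpmul2l _ p%:E) h.
apply: (le_trans (h _)); first by rewrite lee_fin ltW.
have Lq0 : 0 <= (L `^ q / q)%:E by rewrite lee_fin divr_ge0 ?powR_ge0// ltW.
apply: (@le_trans _ _ (p%:E * ((C%:E * capacity a s K) * (L `^ q / q)%:E))).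
  apply: lee_wpmul2l; first by rewrite lee_fin ltW.
  by apply: lee_wpmul2r => //; exact: CP.
rewrite Kc -!EFinM lee_fin powRM ?powR_ge0// -powRrM mulVf ?gt_eqF// powRr1 ?(ltW B0)//.
by apply: eqW_le; ring.
Qed.

Lemma capacitary_ratio_embed r : (1 < r)%R -> (r < q)%R ->
  exists2 C : R, (0 < C)%R & forall f (L : R), lebesgue_measurable f -> (0 <= L)%R ->
  forall K, compact K -> capacity a s K != 0 -> diam K <= 1 ->
  capacitary_ratio a s p r f K <= L%:E -> capacitary_ratio a s p q f K <= (C * L)%:E.
Proof.
move=> r1 rq; have r0 : (0 < r)%R by exact: lt_trans r1.
have [C1 C10 CP] := capacity_cube_le n a0 s1 (@ltr01 R).
pose B := (p * 2 `^ (q - r) * (p^-1) `^ (q / r) * C1 `^ (q / r - 1))%R.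
have B0 : (0 < B)%R by rewrite !mulr_gt0 ?powR_gt0// invr_gt0.
have qr0 : (0 < q / r)%R by rewrite divr_gt0.
have qr1 : (0 <= q / r - 1)%R by rewrite subr_ge0 ler_pdivlMr// mul1r ltW.
exists (B `^ q^-1)%R; first by rewrite powR_gt0.
move=> f L mf L0 K cK Kn0 dK.
have mK := compact_rV_measurable cK.
have BL0 : (0 <= B `^ q^-1 * L)%R by rewrite mulr_ge0 ?powR_ge0.
have [Koo|Koo] := eqVneq (capacity a s K) +oo.
  by move=> _; rewrite capacitary_ratio_pinfty// lee_fin.
have Kpos : 0 < capacity a s K by rewrite lt0e Kn0 capacity_ge0.
have Klt : capacity a s K < +oo by rewrite ltey.
have Kc : capacity a s K = (fine (capacity a s K))%:E by rewrite fineK// ge0_fin_numE// ltW.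
have c0 : (0 < fine (capacity a s K))%R by rewrite fine_gt0// Kpos.
set c := fine (capacity a s K) in Kc c0.
have cC1 : (c <= C1)%R.
  have [[x Kx]|Ke] := pselect (K !=set0); last first.
    exfalso; move/negP: Kn0; apply; apply/eqP.
    have -> : K = set0 by apply/seteqP; split=> // x Kx; apply: Ke; exists x.
    by rewrite capacity_set0.
  rewrite -lee_fin -Kc; apply: le_trans (CP x); apply: le_capacity.
  exact: diam_sub_cube.
rewrite (capacitary_ratio_leP p0 q0 f Kc c0)// (capacitary_ratio_leP p0 r0 f Kc c0)//.
move=> Er0.
have Er : lorentz_energy p r f K <= (p^-1 * (L `^ r * c))%:E.
  by rewrite EFinM lee_pdivlMl.
have Lc0 : (0 <= L `^ r * c)%R by rewrite mulr_ge0 ?powR_ge0// ltW.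
have h := lorentz_energy_embed mf mK p0 (ltW r1) rq.
have h2 := lee_poweR2 (ltW qr0) (lorentz_energy_ge0 _ _ _ _) Er.
have h3 : lorentz_energy p q f K <= (2 `^ (q - r))%:E * (p^-1 * (L `^ r * c))%:E `^ (q / r).
  by apply: le_trans h _; apply: lee_wpmul2l; rewrite ?lee_fin ?powR_ge0.
move: h3 => /(@lee_wpmul2l _ p%:E) h3; apply: (le_trans (h3 _)); first by rewrite lee_fin ltW.
have pv : (0 <= p^-1)%R by rewrite invr_ge0 ltW.
rewrite poweR_EFin -!EFinM lee_fin.
rewrite (powRM _ pv Lc0) (powRM _ (powR_ge0 _ _) (ltW c0)) -powRrM (mulrC r) divfK ?gt_eqF//.
rewrite (powRM _ (powR_ge0 _ _) L0) -powRrM mulVf ?gt_eqF// (powRr1 (ltW B0)) /B.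
rewrite -(mulr_powRB1 (ltW c0) qr0).
have : (c `^ (q / r - 1) <= C1 `^ (q / r - 1))%R.
  by apply: (ge0_ler_powR qr1); rewrite ?nnegrE ?(ltW c0) ?(ltW C10).
move: (c `^ _)%R (C1 `^ _)%R => u w uw.
have P0 : (0 <= p * 2 `^ (q - r) * p^-1 `^ (q / r) * L `^ q * c)%R.
  by rewrite !mulr_ge0 ?powR_ge0 ?(ltW p0) ?(ltW c0).
apply: (@le_trans _ _ (p * 2 `^ (q - r) * p^-1 `^ (q / r) * L `^ q * c * u)%R).
  by apply: eqW_le; ring.
apply: (le_trans (ler_wpM2l P0 uw)).
by apply: eqW_le; ring.
Qed.

End embeddings.

Section M_norms.
Context (R : realType) (n : nat) (a s p q : R).
Hypothesis a0 : 0 < a.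
Hypothesis s1 : 1 < s.
Hypothesis n0 : (0 < n)%N.
Hypothesis asn : a * s <= n%:R.
Hypothesis p0 : 0 < p.
Hypothesis q0 : 0 < q.
Local Open Scope ereal_scope.
Implicit Types (K : set 'rV[R]_n) (f : 'rV[R]_n -> \bar R).

Lemma M_norm_le f X : (forall K, compact K -> capacity a s K != 0 -> capacitary_ratio a s p q f K <= X) ->
  M_norm a s p q f <= X.
Proof. by move=> fX; apply: ge_ereal_sup => _ [K [cK K0] <-]; exact: fX. Qed.

Lemma M_norm_local_le f : M_norm_local a s p q f <= M_norm a s p q f.
Proof. by apply: ereal_sup_le => _ [K [cK K0 _] <-]; exists K. Qed.

Lemma M_norm_local_ge0 f : 0 <= M_norm_local a s p q f.
Proof.
pose r := ((2 * n%:R)^-1 : R)%R.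
have r0 : (0 < r)%R by rewrite invr_gt0 mulr_gt0// ltr0n.
apply: (@le_trans _ _ (capacitary_ratio a s p q f (cube (0%R : 'rV[R]_n) r))).
  exact: capacitary_ratio_ge0.
apply: ereal_sup_ubound; exists (cube (0%R : 'rV[R]_n) r) => //; split.
- exact: compact_cube.
- exact: capacity_cube_neq0.
- by apply: (@diam_cube R n _ 0%R n0).
Qed.

Lemma M_norm_ge0 f : 0 <= M_norm a s p q f.
Proof. exact: le_trans (M_norm_local_ge0 f) (M_norm_local_le f). Qed.

End M_norms.

Theorem proposition4p3 (R : realType) (n : nat) (alpha s p q : R)
  (alpha_gt0 : 0 < alpha) (s_gt1 : 1 < s) (s_le : s <= n%:R / alpha) :
  exists2 C : R, 0 < C &
    forall r : R,
      [/\ 1 < r, r < q, q <= p & alpha * s = n%:R] \/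
      [/\ 1 < r, r < q, q <= p,
          (n%:R - alpha * s) / n%:R <= q / p & alpha * s < n%:R] ->
      [/\ @embeds R n (M_norm alpha s p r) (M_norm alpha s p q),
          @embeds R n Linfty_norm (M_norm alpha s p q) &
          forall f : 'rV[R]_n -> \bar R, lebesgue_measurable f ->
            (C^-1%:E * M_norm alpha s p q f <= M_norm_local alpha s p q f)%E /\
            (M_norm_local alpha s p q f <= C%:E * M_norm alpha s p q f)%E].
Proof.
have asn : alpha * s <= n%:R by rewrite mulrC -ler_pdivlMr.
have n0 : (0 < n)%N.
  rewrite -(ltr0n R); apply: lt_le_trans asn; rewrite mulr_gt0//.
  exact: lt_trans s_gt1.
(* C is chosen before r, so the part of the hypotheses free of r is decided first. *)
pose P := [/\ 1 < q, q <= p & alpha * s = n%:R \/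
  ((n%:R - alpha * s) / n%:R <= q / p) /\ (alpha * s < n%:R)].
have [[q1 qp apq]|nP] := pselect P; last first.
  exists 1 => // r h; exfalso; apply: nP.
  by case: h => [[r1 rq qp asE]|[r1 rq qp h1 h2]]; split=> //;
    [exact: lt_trans rq|left|exact: lt_trans rq|right].
have q0 : 0 < q by exact: lt_trans q1.
have p0 : 0 < p by exact: lt_le_trans qp.
have Mge0 (r : R) (f : 'rV[R]_n -> \bar R) : (0 <= M_norm alpha s p r f)%E by exact: M_norm_ge0.
have Lge0 (f : 'rV[R]_n -> \bar R) : (0 <= M_norm_local alpha s p q f)%E by exact: M_norm_local_ge0.
have LM (f : 'rV[R]_n -> \bar R) : (M_norm_local alpha s p q f <= M_norm alpha s p q f)%E.
  exact: M_norm_local_le.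
have [C C0 CP] := capacitary_ratio_globalize alpha_gt0 s_gt1 n0 asn q1 qp.
have MC (f : 'rV[R]_n -> \bar R) (L : R) : lebesgue_measurable f -> 0 <= L ->
    (forall K, compact K -> capacity alpha s K != 0 -> (diam K <= 1)%E ->
      (capacitary_ratio alpha s p q f K <= L%:E)%E) ->
    (M_norm alpha s p q f <= (C * L)%:E)%E.
  by move=> mf L0 fL; apply: M_norm_le => K; exact: CP.
have C1 : 0 < C + 1 by rewrite addr_gt0.
exists (C + 1) => // r h.
have [r1 rq] : 1 < r /\ r < q by case: h => [[]|[]].
have r0 : 0 < r by exact: lt_trans r1.
split.
- have [D D0 DP] := @capacitary_ratio_embed R n alpha s p q alpha_gt0 s_gt1 q1 qp r r1 rq.
  exists (C * D) => [|f mf]; first exact: mulr_gt0.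
  have := Mge0 r f; case E : (M_norm alpha s p r f) => [L||]//; rewrite lee_fin => L0 _.
  rewrite -EFinM -mulrA; apply: MC => //; first by rewrite mulr_ge0// ltW.
  move=> K cK K0 dK; apply: DP => //; rewrite -E; apply: ereal_sup_ubound.
  by exists K.
- have [D D0 DP] := @capacitary_ratio_Linfty R n alpha s p q alpha_gt0 s_gt1 n0 q1 qp apq.
  exists (C * D) => [|f mf]; first exact: mulr_gt0.
  have : (0 <= Linfty_norm f)%E by exact: Lnorm_ge0.
  case E : (Linfty_norm f) => [L||]//; rewrite lee_fin => L0 _.
  rewrite -EFinM -mulrA; apply: MC => //; first by rewrite mulr_ge0// ltW.
  by move=> K cK K0 dK; apply: DP => //; rewrite E.
- move=> f mf; split; last first.
    apply: le_trans (LM f) _; rewrite -[leLHS]mul1e; apply: lee_wpmul2r; first exact: Mge0.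
    by rewrite lee_fin lerDr ltW.
  rewrite lee_pdivrMl//.
  have := Lge0 f; case E : (M_norm_local alpha s p q f) => [L||]//; last first.
    by move=> _; rewrite gt0_muley ?leey.
  rewrite lee_fin => L0; apply: (@le_trans _ _ (C * L)%:E).
    apply: MC => // K cK K0 dK; rewrite -E; apply: ereal_sup_ubound.
    by exists K.
  by rewrite -EFinM lee_fin ler_wpM2r// lerDl.
Qed.
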